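(* Let $\Lambda$ be a basic Artin algebra with Jacobson radical $J$ and $e\in\Lambda$ an idempotent such that the left $\Lambda$-module $\Lambda(1-e)/J(1-e)$ has finite projective dimension (i.e., all simple left $\Lambda$-modules of infinite projective dimension belong to $\operatorname{add}(\Lambda e/Je)$) and $\operatorname{pdim}_{e\Lambda e}e\Lambda(1-e)<\infty$. Then the category $\Lambda\text{-mod}$ allows for unlimited iteration of strong tilting if and only if the same is true for the category $e\Lambda e\text{-mod}$.
   Context: For an Artin algebra $A$, $A\text{-mod}$ (resp. $\text{mod-}A$) is the category of finitely generated left (resp. right) $A$-modules, and $\mathcal{P}^{<\infty}(A\text{-mod})$ (resp. $\mathcal{P}^{<\infty}(\text{mod-}A)$) its full subcategory of modules of finite projective dimension. $A$ is basic if $A/J(A)$ is a product of division rings; a module is basic if it has no indecomposable direct summand of multiplicity $>1$. A module $T\in A\text{-mod}$ is a tilting module if (1) $T\in\mathcal{P}^{<\infty}(A\text{-mod})$, (2) $\operatorname{Ext}^i_A(T,T)=0$ for $i\ge1$, (3) there is an exact sequence $0\to A\to T_0\to\cdots\to T_s\to0$ with all $T_j\in\operatorname{add}(T)$. It is strong if, in addition, $\operatorname{Ext}^i_A(M,T)=0$ for all $M\in\mathcal{P}^{<\infty}(A\text{-mod})$ and $i\ge1$. Similarly for right modules. If $A\text{-mod}$ has a strong tilting module, the basic one is unique up to isomorphism. For basic Artin algebras $A,B$: $\text{mod-}B$ results from $A\text{-mod}$ via strong tilting if $A\text{-mod}$ has a basic strong tilting module $T$ and $B\cong\operatorname{End}_A(T)^{\mathrm{op}}$;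 $B\text{-mod}$ results from $\text{mod-}A$ via strong tilting if $\text{mod-}A$ has a basic strong tilting module $T$ and $B\cong\operatorname{End}_A(T)$. The category $A\text{-mod}$ allows for unlimited iteration of strong tilting if there is an infinite sequence of basic algebras $(A_i)_{i\ge0}$ with $A_0=A$ such that $\text{mod-}A_{i+1}$ results from $A_i\text{-mod}$ via strong tilting for $i$ even, and $A_{i+1}\text{-mod}$ results from $\text{mod-}A_i$ via strong tilting for $i$ odd. *)

(* Defs.v *)
From HB Require Import structures.
From mathcomp Require Import all_boot all_algebra boolp.

Set Implicit Arguments.
Unset Strict Implicit.
Unset Printing Implicit Defensive.

Import GRing.Theory.
Local Open Scope ring_scope.

(* Rings are pzRingType, so that the zero ring is a ring: for e = 0 the corner
   e L e is the zero ring, and it has the zero module as its (basic) strong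
   tilting module.  Left A-modules are lmodType A, right A-modules are
   lmodType A^c, and A^o is A seen as a left module over itself. *)

Section Ideals.
Variable A : pzRingType.
Implicit Types (I M : A -> Prop).

Definition left_ideal I : Prop :=
  [/\ I 0, forall x y, I x -> I y -> I (x + y)
    & forall a x, I x -> I (a * x)].

Definition maximal_left_ideal M : Prop :=
  [/\ left_ideal M, ~ M 1
    & forall I, left_ideal I -> (forall x, M x -> I x) -> ~ I 1 ->
        forall x, I x -> M x].

Definition jacobson (x : A) : Prop := forall M, maximal_left_ideal M -> M x.

Lemma jacobson_left_ideal : left_ideal jacobson.
Proof.
split=> [M [[]] //|x y Jx Jy M maxM|a x Jx M maxM].
  by have [[_ MD _] _ _] := maxM; apply: MD; [apply: Jx | apply: Jy].
by have [[_ _ MM] _ _] := maxM; apply: MM; apply: Jx.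
Qed.

End Ideals.

Definition left_artinian (A : pzRingType) : Prop :=
  forall I : nat -> A -> Prop, (forall n, left_ideal (I n)) ->
    (forall n x, I n.+1 x -> I n x) ->
    exists n, forall m, (n <= m)%N -> forall x, I m x <-> I n x.

Definition artin_algebra (A : pzRingType) : Prop :=
  exists (R : comPzRingType) (f : {rmorphism R -> A}),
    [/\ left_artinian R,
        forall r a, f r * a = a * f r
      & exists (n : nat) (v : 'I_n -> A),
          forall a, exists c : 'I_n -> R, a = \sum_i f (c i) * v i].

Definition division_ring (D : pzRingType) : Prop :=
  (1 : D) <> 0 /\
  forall x : D, x <> 0 -> exists y : D, x * y = 1 /\ y * x = 1.

(* The isomorphism of A / J(A) with the product of the D i is given as a
   surjective ring morphism from A to that product (written componentwise)
   whose kernel is J(A). *)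
Definition basic_ring (A : pzRingType) : Prop :=
  exists (n : nat) (D : 'I_n -> pzRingType)
         (f : forall i, {rmorphism A -> D i}),
    [/\ forall i, division_ring (D i),
        forall y : (forall i, D i), exists a, forall i, f i a = y i
      & forall a, (forall i, f i a = 0) <-> jacobson a].

Definition ring_iso (A B : pzRingType) : Prop :=
  exists f : {rmorphism A -> B}, bijective f.

Section Modules.
Variable A : pzRingType.
Implicit Types M N P T X Y : lmodType A.

Definition zero_module M : Prop := forall x : M, x = 0.

Definition module_iso M N : Prop := exists f : {linear M -> N}, bijective f.

Definition finitely_generated M : Prop :=
  exists (n : nat) (v : 'I_n -> M),
    forall x, exists c : 'I_n -> A, x = \sum_i c i *: v i.

Definition surj M N (f : {linear M -> N}) : Prop := forall y, exists x, f x = y.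

Definition exact_at M N P (f : {linear M -> N}) (g : {linear N -> P}) : Prop :=
  forall y, g y = 0 <-> exists x, f x = y.

Definition indecomposable X : Prop :=
  ~ zero_module X /\
  forall Y Z : lmodType A, module_iso X (Y * Z)%type ->
    zero_module Y \/ zero_module Z.

Definition basic_module M : Prop :=
  forall X, indecomposable X ->
    ~ exists Y, module_iso M ((X * X) * Y)%type.

Definition in_add T X : Prop :=
  exists (n : nat) (i : {linear X -> {ffun 'I_n -> T}})
         (p : {linear {ffun 'I_n -> T} -> X}), forall x, p (i x) = x.

Definition projective P : Prop :=
  forall (M N : lmodType A) (g : {linear M -> N}) (f : {linear P -> N}),
    surj g -> exists h : {linear P -> M}, forall x, g (h x) = f x.

Record projective_resolution M := ProjectiveResolution {
  res_obj : nat -> lmodType A;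
  res_aug : {linear res_obj 0 -> M};
  res_diff : forall i, {linear res_obj i.+1 -> res_obj i};
  res_projective : forall i, projective (res_obj i);
  res_surj : surj res_aug;
  res_exact0 : exact_at (res_diff 0) res_aug;
  res_exact : forall i, exact_at (res_diff i.+1) (res_diff i) }.

Definition finite_pdim M : Prop :=
  exists (n : nat) (P : projective_resolution M),
    forall i, (n < i)%N -> zero_module (res_obj P i).

(* Cocycles and coboundaries of the complex Hom_A(P, N). *)
Definition cocycle M (P : projective_resolution M) N i
    (c : {linear res_obj P i -> N}) : Prop :=
  forall x, c (res_diff P i x) = 0.

Definition coboundary M (P : projective_resolution M) N i :
    {linear res_obj P i -> N} -> Prop :=
  match i with
  | 0 => fun c => forall x, c x = 0
  | j.+1 => fun c => exists b : {linear res_obj P j -> N},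
                       forall x, c x = b (res_diff P j x)
  end.

(* Ext^i_A(M, N) = 0.  The cohomology of Hom_A(P, N) does not depend on the
   projective resolution P of M, and every module has one. *)
Definition Ext_eq0 i M N : Prop :=
  forall (P : projective_resolution M) (c : {linear res_obj P i -> N}),
    cocycle c -> coboundary c.

Definition fin_pdim_mod M : Prop := finitely_generated M /\ finite_pdim M.

(* 0 -> A -> X 0 -> ... -> X s -> 0, continued by X j = 0 for j > s. *)
Definition tilting_coresolution T : Prop :=
  exists (s : nat) (X : nat -> lmodType A) (eps : {linear A^o -> X 0})
         (d : forall j, {linear X j -> X j.+1}),
    [/\ injective eps,
        exact_at eps (d 0),
        forall j, exact_at (d j) (d j.+1),
        forall j, (j <= s)%N -> in_add T (X j)
      & forall j, (s < j)%N -> zero_module (X j)].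

Definition tilting T : Prop :=
  [/\ fin_pdim_mod T,
      forall i, (1 <= i)%N -> Ext_eq0 i T T
    & tilting_coresolution T].

Definition strong_tilting T : Prop :=
  tilting T /\
  forall M, fin_pdim_mod M -> forall i, (1 <= i)%N -> Ext_eq0 i M T.

End Modules.

(* The ring End_A(T); its product is composition of maps, (f * g) x = f (g x). *)
Definition endring (A : pzRingType) (T : lmodType A) : Type := {linear T -> T}.

HB.instance Definition _ (A : pzRingType) (T : lmodType A) :=
  gen_eqMixin (endring T).
HB.instance Definition _ (A : pzRingType) (T : lmodType A) :=
  gen_choiceMixin (endring T).

Section EndRing.
Variables (A : pzRingType) (T : lmodType A).
Implicit Types f g h : endring T.

Definition endring_fun f : {linear T -> T} := f.

Lemma endring_ext f g : endring_fun f =1 endring_fun g -> f = g.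
Proof.
rewrite /endring_fun.
case: f => f [[hf1] [hf2]]; case: g => g [[hg1] [hg2]] /= /funext eq_fg.
subst g; congr (GRing.Linear.Pack (GRing.Linear.Class _ _)).
  by congr (GRing.isNmodMorphism.Axioms_ _); apply: Prop_irrelevance.
by congr (GRing.isScalable.Axioms_ _); apply: Prop_irrelevance.
Qed.

Definition endring_zero : endring T := (\0 : T -> T).
Definition endring_opp f : endring T := (\- endring_fun f).
Definition endring_add f g : endring T := (endring_fun f \+ endring_fun g).
Definition endring_one : endring T := (idfun : T -> T).
Definition endring_mul f g : endring T := (endring_fun f \o endring_fun g).

Lemma endring_addA : associative endring_add.
Proof. by move=> f g h; apply: endring_ext => x /=; rewrite addrA. Qed.
Lemma endring_addC : commutative endring_add.
Proof. by move=> f g; apply: endring_ext => x /=; rewrite addrC. Qed.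
Lemma endring_add0 : left_id endring_zero endring_add.
Proof. by move=> f; apply: endring_ext => x /=; rewrite add0r. Qed.
Lemma endring_addN : left_inverse endring_zero endring_opp endring_add.
Proof. by move=> f; apply: endring_ext => x /=; rewrite addNr. Qed.
Lemma endring_mulA : associative endring_mul.
Proof. by move=> f g h; apply: endring_ext. Qed.
Lemma endring_mul1 : left_id endring_one endring_mul.
Proof. by move=> f; apply: endring_ext. Qed.
Lemma endring_mulr1 : right_id endring_one endring_mul.
Proof. by move=> f; apply: endring_ext. Qed.
Lemma endring_mulDl : left_distributive endring_mul endring_add.
Proof. by move=> f g h; apply: endring_ext. Qed.
Lemma endring_mulDr : right_distributive endring_mul endring_add.
Proof. by move=> f g h; apply: endring_ext => x /=; rewrite raddfD. Qed.

HB.instance Definition _ := GRing.isPzRing.Build (endring T)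
  endring_addA endring_addC endring_add0 endring_addN endring_mulA
  endring_mul1 endring_mulr1 endring_mulDl endring_mulDr.

End EndRing.

Section QuotientModule.
Variables (A : pzRingType) (V : lmodType A) (S : {pred V}).

(* The proof argument is what the zmodClosed instance is attached to. *)
Definition submod_pred of GRing.submod_closed S : V -> bool := fun x => x \in S.

Variable hS : GRing.submod_closed S.

HB.instance Definition _ :=
  GRing.isZmodClosed.Build V (submod_pred hS) (GRing.submod_closedB hS).

Definition submod_zmodClosed : zmodClosed V :=
  GRing.ZmodClosed.clone V (submod_pred hS) _.

Definition quot_module : Type := Quotient.quot submod_zmodClosed.

HB.instance Definition _ := GRing.Zmodule.on quot_module.

Definition quot_pi (x : V) : quot_module :=
  \pi_(Quotient.quot submod_zmodClosed)%qT x.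

Definition quot_scale (a : A) (x : quot_module) : quot_module :=
  quot_pi (a *: repr (x : Quotient.quot submod_zmodClosed)).

Lemma quot_pi_eq x y : quot_pi x = quot_pi y <-> x - y \in S.
Proof.
rewrite -[x - y \in S]/(x - y \in submod_zmodClosed) Quotient.idealrBE.
by split=> [xy|/eqP //]; apply/eqP.
Qed.

Lemma quot_piD : {morph quot_pi : x y / x + y}.
Proof. by move=> x y; rewrite /quot_pi raddfD. Qed.

Lemma quot_piP (x : quot_module) : exists y, x = quot_pi y.
Proof.
by exists (repr (x : Quotient.quot submod_zmodClosed)); rewrite /quot_pi reprK.
Qed.

Lemma quot_piZ a x : quot_scale a (quot_pi x) = quot_pi (a *: x).
Proof.
apply/quot_pi_eq; rewrite -scalerBr.
have /quot_pi_eq Sx : quot_pi (repr (\pi_(Quotient.quot submod_zmodClosed)%qT x))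
    = quot_pi x by rewrite /quot_pi reprK.
by rewrite -[_ *: _]addr0; case: hS => S0; apply.
Qed.

Lemma quot_scaleA a b x : quot_scale a (quot_scale b x) = quot_scale (a * b) x.
Proof. by have [y ->] := quot_piP x; rewrite !quot_piZ scalerA. Qed.
Lemma quot_scale1 : left_id 1 quot_scale.
Proof. by move=> x; have [y ->] := quot_piP x; rewrite quot_piZ scale1r. Qed.
Lemma quot_scaleDr : right_distributive quot_scale +%R.
Proof.
move=> a x y; have [u ->] := quot_piP x; have [v ->] := quot_piP y.
by rewrite -quot_piD !quot_piZ scalerDr quot_piD.
Qed.
Lemma quot_scaleDl x : {morph quot_scale^~ x : a b / a + b}.
Proof.
by move=> a b; have [y ->] := quot_piP x; rewrite !quot_piZ scalerDl quot_piD.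
Qed.

HB.instance Definition _ := GRing.Zmodule_isLmodule.Build A quot_module
  quot_scaleA quot_scale1 quot_scaleDr quot_scaleDl.

End QuotientModule.

Section PrincipalModule.
Variables (A : pzRingType) (f : A).

Definition principal_pred : {pred A^o} := fun x => `[< exists a : A, x = a * f >].

Lemma principal_closed : GRing.submod_closed principal_pred.
Proof.
split; first by apply/asboolP; exists 0; rewrite mul0r.
move=> a x y /asboolP[b ->] /asboolP[c ->]; apply/asboolP; exists (a * b + c).
by rewrite mulrDl -mulrA.
Qed.

(* The left module A f; radical_pred below is its submodule J(A) f, and
   top_module the quotient A f / J(A) f. *)
Record principal := Principal {
  principal_val : A^o; _ : principal_val \in principal_pred }.

HB.instance Definition _ := [isSub for principal_val].
HB.instance Definition _ := [Choice of principal by <:].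
HB.instance Definition _ := GRing.isZmodClosed.Build A^o principal_pred
  (GRing.submod_closedB principal_closed).
HB.instance Definition _ := [SubChoice_isSubZmodule of principal by <:].
HB.instance Definition _ := GRing.SubZmodule_isSubLmodule.Build
  A A^o principal_pred principal principal_closed.

Definition radical_pred : {pred principal} :=
  fun x => `[< exists2 j : A, jacobson j & val x = j * f >].

Lemma radical_closed : GRing.submod_closed radical_pred.
Proof.
have [J0 JD JM] := jacobson_left_ideal A.
split; first by apply/asboolP; exists 0; rewrite ?mul0r.
move=> a x y /asboolP[i Ji xi] /asboolP[j Jj yj]; apply/asboolP.
exists (a * i + j); first by apply: JD => //; apply: JM.
by rewrite linearP mulrDl -mulrA -xi -yj.
Qed.

Definition top_module : lmodType A := quot_module radical_closed.

End PrincipalModule.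

Section Peirce.
Variables (A : pzRingType) (e f : A).

Definition peirce_pred : {pred A} := fun x => `[< exists a, x = e * a * f >].

Lemma peirce_closed : GRing.zmod_closed peirce_pred.
Proof.
split; first by apply/asboolP; exists 0; rewrite mulr0 mul0r.
move=> x y /asboolP[a ->] /asboolP[b ->]; apply/asboolP.
by exists (a - b); rewrite mulrBr mulrBl.
Qed.

(* The subgroup e A f of A. *)
Record peirce := Peirce { peirce_val : A; _ : peirce_val \in peirce_pred }.

HB.instance Definition _ := [isSub for peirce_val].
HB.instance Definition _ := [Choice of peirce by <:].
HB.instance Definition _ :=
  GRing.isZmodClosed.Build A peirce_pred peirce_closed.
HB.instance Definition _ := [SubChoice_isSubZmodule of peirce by <:].

End Peirce.

Lemma peirce_mulP (A : pzRingType) (e f : A) (x : peirce e e) (y : peirce e f) :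
  val x * val y \in peirce_pred e f.
Proof.
case: x y => x /asboolP[a xE] [y /asboolP[b yE]] /=; apply/asboolP.
by exists (a * e * e * b); rewrite xE yE !mulrA.
Qed.

Definition peirce_mul (A : pzRingType) (e f : A) (x : peirce e e)
  (y : peirce e f) : peirce e f := Peirce (peirce_mulP x y).

Section Corner.
Variables (A : pzRingType) (e : A).

(* The ring e A e with unit e, and the left e A e-module e A f.  The proof that e
   is idempotent is an argument because the structures depend on it. *)
Definition corner of e * e = e : Type := peirce e e.
Definition corner_module (_ : e * e = e) (f : A) : Type := peirce e f.

Variable he : e * e = e.

HB.instance Definition _ := GRing.Zmodule.on (corner he).

Lemma peirce_unitl f (x : peirce e f) : e * val x = val x.
Proof. by case: x => x /= /asboolP[a ->]; rewrite !mulrA he. Qed.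
Lemma peirce_unitr (x : peirce e e) : val x * e = val x.
Proof. by case: x => x /= /asboolP[a ->]; rewrite -mulrA he. Qed.

Lemma corner_oneP : e \in peirce_pred e e.
Proof. by apply/asboolP; exists 1; rewrite mulr1 he. Qed.

Definition corner_one : corner he := Peirce corner_oneP.
Definition corner_mul : corner he -> corner he -> corner he := @peirce_mul A e e.

Lemma corner_mulA : associative corner_mul.
Proof. by move=> x y z; apply: val_inj; rewrite /= mulrA. Qed.
Lemma corner_mul1 : left_id corner_one corner_mul.
Proof. by move=> x; apply: val_inj; rewrite /= peirce_unitl. Qed.
Lemma corner_mulr1 : right_id corner_one corner_mul.
Proof. by move=> x; apply: val_inj; rewrite /= peirce_unitr. Qed.
Lemma corner_mulDl : left_distributive corner_mul +%R.
Proof. by move=> x y z; apply: val_inj; rewrite /= mulrDl. Qed.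
Lemma corner_mulDr : right_distributive corner_mul +%R.
Proof. by move=> x y z; apply: val_inj; rewrite /= mulrDr. Qed.

HB.instance Definition _ := GRing.Zmodule_isPzRing.Build (corner he)
  corner_mulA corner_mul1 corner_mulr1 corner_mulDl corner_mulDr.

Variable f : A.

HB.instance Definition _ := GRing.Zmodule.on (corner_module he f).

Definition corner_scale (a : corner he) (x : corner_module he f) :
  corner_module he f := peirce_mul a x.

Lemma corner_scaleA a b x :
  corner_scale a (corner_scale b x) = corner_scale (a * b) x.
Proof. by apply: val_inj; rewrite /= mulrA. Qed.
Lemma corner_scale1 : left_id 1 corner_scale.
Proof. by move=> x; apply: val_inj; rewrite /= peirce_unitl. Qed.
Lemma corner_scaleDr : right_distributive corner_scale +%R.
Proof. by move=> a x y; apply: val_inj; rewrite /= mulrDr. Qed.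
Lemma corner_scaleDl x : {morph corner_scale^~ x : a b / a + b}.
Proof. by move=> a b; apply: val_inj; rewrite /= mulrDl. Qed.

HB.instance Definition _ := GRing.Zmodule_isLmodule.Build (corner he)
  (corner_module he f)
  corner_scaleA corner_scale1 corner_scaleDr corner_scaleDl.

End Corner.

(* mod-B results from A-mod: the converse ring is End_A(T)^op. *)
Definition right_results_from_left (A B : pzRingType) : Prop :=
  exists T : lmodType A,
    [/\ basic_module T, strong_tilting T & ring_iso B (endring T)^c].

(* B-mod results from mod-A. *)
Definition left_results_from_right (A B : pzRingType) : Prop :=
  exists T : lmodType A^c,
    [/\ basic_module T, strong_tilting T & ring_iso B (endring T)].

Definition unlimited_strong_tilting (A : pzRingType) : Prop :=
  exists A_ : nat -> pzRingType,
    [/\ A_ 0 = A,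
        forall i, artin_algebra (A_ i) /\ basic_ring (A_ i)
      & forall i, if odd i then left_results_from_right (A_ i) (A_ i.+1)
                  else right_results_from_left (A_ i) (A_ i.+1)].

(* Main.v *)
(** All modules are left modules, every second ring of a sequence being replaced by its converse.
    Let B = e A e and F M = e M.  Since modules killed by e have finite projective dimension over A and
    F A has finite projective dimension over B, the functor F preserves and reflects finite projective
    dimension, and it is full and faithful on maps into Ext-injective modules without nonzero submodule
    killed by e (torsion-free modules).  Hence if T is a basic strong tilting A-module with largest
    torsion-free direct summand T', then F T' is a basic strong tilting B-module, and every basic strong
    tilting B-module arises in this way.  Let D = End T and let e' in D be the projection onto T'.  Then
    e' D e' = End T' = End (F T'), and (D, e') inherits both hypotheses: e' D = Hom (F T, F T') has a
    resolution coming from a coresolution of F T by summands of powers of F T', and a simple D-module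
    killed by e' is Hom (M, T) for a submodule M of T killed by e.  So tilting sequences can be followed
    from A to B and back, one step at a time. *)

From HB Require Import structures.
Require Import Defs.
From mathcomp Require Import all_boot all_algebra boolp classical_sets.

Set Implicit Arguments.
Unset Strict Implicit.
Unset Printing Implicit Defensive.

Import GRing.Theory.
Local Open Scope ring_scope.

(** * Linear maps and exact sequences *)

Section LinearMaps.
Variable A : pzRingType.
Implicit Types K M N P Q : lmodType A.

(** Strong tilting is handled through three conditions ([stilt]): finite projective dimension,
    vanishing of Ext^1 from all modules of finite projective dimension, and a finite coresolution of
    the ring; dimension shift recovers the higher Ext groups. The hard direction is from B to A,
    where a strong tilting A-module has to be produced. Over B, every finitely generated module is
    covered by one of finite projective dimension with Ext-injective kernel. Applied to F E for an
    injective E and pulled back along the unit E -> Hom_B(e A, F E), this yields enough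
    Ext-injective A-modules of finite projective dimension. Since finitistic dimensions are finite,
    a coresolution of A by such modules stops, and the sum of its terms is tilting. Fitting
    idempotents and the splitting off of common summands play the part of Krull-Schmidt. Basicness
    becomes the absence of 2 x 2 matrix units, which corners and converse rings inherit. Corners and
    endomorphism rings enter through maps [theta] and [rho], so that a ring can be replaced by an
    isomorphic one without moving modules. *)

Definition mklin M N (f : M -> N) (h : linear f) : {linear M -> N} :=
  HB.pack f (GRing.isLinear.Build A M N *:%R f h).

(** Most linear maps below are specified by what their values satisfy and obtained by choice from a
    functional linear relation. *)
Lemma linear_graph M N (G : M -> N -> Prop) :
  (forall x, exists y, G x y) ->
  (forall x y y', G x y -> G x y' -> y = y') ->
  (forall a x x' y y', G x y -> G x' y' -> G (a *: x + x') (a *: y + y')) ->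
  exists f : {linear M -> N}, forall x, G x (f x).
Proof.
move=> tot fn lin; have [f fG] := choice tot.
have h : linear f.
  by move=> a x x'; apply: (fn (a *: x + x')) => //; apply: lin.
by exists (mklin h).
Qed.

Definition submodP M (S : M -> Prop) : Prop :=
  S 0 /\ forall a x y, S x -> S y -> S (a *: x + y).

Lemma submodPD M (S : M -> Prop) x y : submodP S -> S x -> S y -> S (x + y).
Proof. by move=> [_ h] Sx Sy; have := h 1 x y Sx Sy; rewrite scale1r. Qed.

Lemma submodPZ M (S : M -> Prop) a x : submodP S -> S x -> S (a *: x).
Proof. by move=> [h0 h] Sx; have := h a x 0 Sx h0; rewrite addr0. Qed.

Lemma submodPB M (S : M -> Prop) x y : submodP S -> S x -> S y -> S (x - y).
Proof. by move=> [h0 h] Sx Sy; have := h (-1) y x Sy Sx; rewrite scaleN1r addrC. Qed.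

Section Sub.
Variables (M : lmodType A) (S : M -> Prop) (hS : submodP S).

Definition sub_pred : {pred M} := fun x => `[< S x >].

Lemma sub_closed : GRing.submod_closed sub_pred.
Proof.
split; first by apply/asboolP; case: hS.
by move=> a x y /asboolP Sx /asboolP Sy; apply/asboolP; case: hS => _; apply.
Qed.

(** The closure proof is a parameter of the type because the module structure attached to the type
    depends on it. *)
Record subm_of (h : GRing.submod_closed sub_pred) := Subm { subm_val : M; _ : subm_val \in sub_pred }.
Let h := sub_closed.
Local Notation subm := (subm_of h).
HB.instance Definition _ := [isSub for @subm_val h].
HB.instance Definition _ := [Choice of subm by <:].
HB.instance Definition _ := GRing.isZmodClosed.Build M sub_pred
  (GRing.submod_closedB h).
HB.instance Definition _ := [SubChoice_isSubZmodule of subm by <:].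
HB.instance Definition _ := GRing.SubZmodule_isSubLmodule.Build
  A M sub_pred subm h.

Lemma ker_exists : exists (K : lmodType A) (i : {linear K -> M}),
  injective i /\ forall x, S x <-> exists y, i y = x.
Proof.
have lin : linear (val : subm -> M) by move=> a x y; rewrite linearP.
exists subm, (mklin lin); split; first exact: val_inj.
move=> x; split=> [Sx|[y <-]].
  have Sx' : x \in sub_pred by apply/asboolP.
  by exists (Subm h Sx').
by case: y => y /= /asboolP.
Qed.

Lemma coker_exists : exists (Q : lmodType A) (p : {linear M -> Q}),
  surj p /\ forall x, p x = 0 <-> S x.
Proof.
pose Q : lmodType A := quot_module h.
have lin : linear (quot_pi h : M -> Q).
  by move=> a x y; rewrite quot_piD -quot_piZ.
exists Q, (mklin lin); split; first by move=> y; have [x ->] := quot_piP y; exists x.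
move=> x; rewrite /=; have -> : (0 : Q) = quot_pi h 0 by rewrite /quot_pi raddf0.
have := quot_pi_eq h x 0; rewrite subr0 => ->; split=> [/asboolP|Sx] //.
exact/asboolP.
Qed.
End Sub.

End LinearMaps.

Section ExactSequences.
Variable A : pzRingType.
Implicit Types K L M N P Q W X Y Z : lmodType A.

Definition ses K P M (f : {linear K -> P}) (g : {linear P -> M}) : Prop :=
  [/\ injective f, surj g & exact_at f g].

Definition retract X Y : Prop :=
  exists (i : {linear X -> Y}) (p : {linear Y -> X}), forall x, p (i x) = x.

Definition zero_mod : lmodType A := {ffun 'I_0 -> A^o}.

Lemma zero_modP : zero_module zero_mod.
Proof. by move=> x; apply/ffunP => -[]. Qed.

Definition zero_map M N : {linear M -> N} := \0 : M -> N.

Lemma linear_inj M N (f : {linear M -> N}) :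
  (forall x, f x = 0 -> x = 0) -> injective f.
Proof. by move=> h x y xy; apply: subr0_eq; apply: h; rewrite linearB xy subrr. Qed.

Lemma factor_inj K P M (f : {linear K -> P}) (h : {linear M -> P}) :
  injective f -> (forall x, exists y, f y = h x) ->
  exists h' : {linear M -> K}, forall x, f (h' x) = h x.
Proof.
move=> injf tot; apply: (@linear_graph _ _ _ (fun x y => f y = h x)) => //.
  by move=> x y y' e1 e2; apply: injf; rewrite e1 e2.
by move=> a x x' y y' e1 e2; rewrite !linearP e1 e2.
Qed.

Lemma factor_surj P M N (g : {linear P -> M}) (h : {linear P -> N}) :
  surj g -> (forall x, g x = 0 -> h x = 0) ->
  exists h' : {linear M -> N}, forall x, h' (g x) = h x.
Proof.
move=> sg k; have [|||h' hh'] := @linear_graph _ M N (fun x y => exists2 z, g z = x & h z = y).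
- by move=> x; have [z <-] := sg x; exists (h z), z.
- move=> x y y' [z e1 <-] [z' e2 <-]; apply: subr0_eq; rewrite -linearB; apply: k.
  by rewrite linearB e1 e2 subrr.
- move=> a x x' y y' [z <- <-] [z' <- <-]; exists (a *: z + z'); by rewrite linearP.
exists h' => x; have [z e1 <-] := hh' (g x).
by apply: subr0_eq; rewrite -linearB k // linearB e1 subrr.
Qed.

Lemma kerP M N (g : {linear M -> N}) : submodP (fun x => g x = 0).
Proof. by split=> [|a x y e1 e2]; rewrite ?linear0 // linearP e1 e2 scaler0 addr0. Qed.

Lemma imageP M N (g : {linear M -> N}) : submodP (fun x => exists y, g y = x).
Proof.
split=> [|a x y [u <-] [v <-]]; first by exists 0; rewrite linear0.
by exists (a *: u + v); rewrite linearP.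
Qed.

Lemma ker_ses P M (g : {linear P -> M}) : surj g ->
  exists K (f : {linear K -> P}), ses f g.
Proof.
by move=> sg; have [K [i [inji iP]]] := ker_exists (kerP g); exists K, i; split.
Qed.

Lemma coker_ses K P (f : {linear K -> P}) : injective f ->
  exists M (g : {linear P -> M}), ses f g.
Proof.
by move=> injf; have [K' [i [inji iP]]] := coker_exists (imageP f); exists K', i; split.
Qed.

Lemma image_fact M N (g : {linear M -> N}) : exists X (q : {linear M -> X}) (j : {linear X -> N}),
  [/\ surj q, injective j & forall x, j (q x) = g x].
Proof.
have [X [j [injj jP]]] := ker_exists (imageP g).
have [|q qP] := @factor_inj _ _ _ j g injj; first by move=> x; apply/jP; exists x.
exists X, q, j; split=> // y; have [x e] : exists x, g x = j y by apply/jP; exists y.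
by exists x; apply: injj; rewrite qP.
Qed.

Lemma ses_comp0 K P M (f : {linear K -> P}) (g : {linear P -> M}) x :
  ses f g -> g (f x) = 0.
Proof. by case=> _ _ e; apply/e; exists x. Qed.

Lemma module_isoC M N : module_iso M N -> module_iso N M.
Proof.
move=> [f [g fg gf]]; have lin : linear g.
  by move=> a x y; apply: (can_inj fg); rewrite linearP !gf.
by exists (mklin lin); exists f.
Qed.

Lemma iso_of_bij M N (f : {linear M -> N}) : injective f -> surj f -> module_iso M N.
Proof.
move=> injf sf; have [g fg] := choice sf; exists f; exists g => // x; exact: injf.
Qed.

Lemma module_iso_inv M N : module_iso M N -> exists (f : {linear M -> N}) (g : {linear N -> M}),
  (forall x, g (f x) = x) /\ (forall x, f (g x) = x).
Proof.
move=> [f bf]; have [g fg gf] := bf.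
have lin : linear g by move=> a x y; apply: (can_inj fg); rewrite linearP !gf.
by exists f, (mklin lin).
Qed.

Lemma module_iso_retract M N : module_iso M N -> retract M N.
Proof. by move=> /module_iso_inv[f [g [fg _]]]; exists f, g. Qed.

Definition inl_map M N : {linear M -> (M * N)%type}.
Proof. by refine (@mklin A M (M * N)%type (fun x => (x, 0)) _) => a x y; apply/pair_equal_spec; rewrite /= scaler0 addr0. Defined.
Definition inr_map M N : {linear N -> (M * N)%type}.
Proof. by refine (@mklin A N (M * N)%type (fun x => (0, x)) _) => a x y; apply/pair_equal_spec; rewrite /= scaler0 addr0. Defined.
Definition fst_map M N : {linear (M * N)%type -> M}.
Proof. by refine (@mklin A (M * N)%type M fst _). Defined.
Definition snd_map M N : {linear (M * N)%type -> N}.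
Proof. by refine (@mklin A (M * N)%type N snd _). Defined.
Definition pair_map X M N (f : {linear X -> M}) (g : {linear X -> N}) : {linear X -> (M * N)%type}.
Proof. by refine (@mklin A X (M * N)%type (fun x => (f x, g x)) _) => a x y; rewrite !linearP. Defined.
Definition copair_map X M N (f : {linear M -> X}) (g : {linear N -> X}) : {linear (M * N)%type -> X}.
Proof.
refine (@mklin A (M * N)%type X (fun x => f x.1 + g x.2) _) => a x y.
by rewrite /= !linearP scalerDr addrACA.
Defined.
Definition prod_map M N M' N' (f : {linear M -> M'}) (g : {linear N -> N'}) : {linear (M * N)%type -> (M' * N')%type} :=
  pair_map (f \o fst_map M N) (g \o snd_map M N).

Lemma ses_split_prod M N : ses (inl_map M N) (snd_map M N).
Proof.
split=> [x y [] //|y|[x y]] /=; first by exists (0, y).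
by split=> [->|[z [_ <-]]] //; exists x.
Qed.

Lemma ses_prod K P M K' P' M' (f : {linear K -> P}) (g : {linear P -> M})
  (f' : {linear K' -> P'}) (g' : {linear P' -> M'}) :
  ses f g -> ses f' g' -> ses (prod_map f f') (prod_map g g').
Proof.
move=> [i s e] [i' s' e']; split.
- by move=> [x y] [x' y'] /= [/i -> /i' ->].
- by move=> [x y]; have [u <-] := s x; have [v <-] := s' y; exists (u, v).
move=> [x y] /=; split=> [[/e[u <-] /e'[v <-]]|[[u v]] /= [<- <-]]; first by exists (u, v).
by congr pair; [apply/e; exists u | apply/e'; exists v].
Qed.

Lemma ses_isor K P M M' (f : {linear K -> P}) (g : {linear P -> M}) :
  ses f g -> module_iso M M' -> exists g' : {linear P -> M'}, ses f g'.
Proof.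
move=> [i s e] /module_iso_inv[u [v [uv vu]]]; exists (u \o g); split=> //=.
  by move=> y; have [x xe] := s (v y); exists x; rewrite /= xe.
by move=> y /=; rewrite -e; split=> [/(congr1 v)|->]; rewrite ?uv linear0.
Qed.

Lemma ses_isol K K' P M (f : {linear K -> P}) (g : {linear P -> M}) :
  ses f g -> module_iso K' K -> exists f' : {linear K' -> P}, ses f' g.
Proof.
move=> [i s e] /module_iso_inv[u [v [uv vu]]]; exists (f \o u); split=> //=.
  by move=> x y /= /i /(congr1 v); rewrite !uv.
move=> y; rewrite e; split=> [[x <-]|[x <-]]; last by exists (u x).
by exists (v x); rewrite /= vu.
Qed.

Lemma pushout K P M N (f : {linear K -> P}) (g : {linear P -> M}) (h : {linear K -> N}) :
  ses f g -> exists W (j : {linear N -> W}) (q : {linear W -> M}) (k : {linear P -> W}),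
  [/\ ses j q, forall x, k (f x) = j (h x), forall x, q (k x) = g x &
      forall w, exists n p, w = j n + k p].
Proof.
move=> [inf sg ex].
(* [W] is the quotient of [N * P] by the antidiagonal copy of [K]. *)
have hS : submodP (fun z : (N * P)%type => exists x, z = (h x, - f x)).
  split.
    by exists 0; apply/pair_equal_spec; rewrite !linear0.
  move=> a _ _ [x ->] [y ->]; exists (a *: x + y); apply/pair_equal_spec.
    by rewrite /= !linearP.
have [W [p [sp kp]]] := coker_exists hS.
have [||q qP] := @factor_surj _ W M p (g \o snd_map N P) => //.
  move=> x /kp[y ->] /=; rewrite linearN; apply/eqP; rewrite oppr_eq0; apply/eqP.
  by apply/ex; exists y.
exists W, (p \o inl_map N P), q, (p \o inr_map N P).
have sumE n x : p (n, x) = p (n, 0) + p (0, x).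
  by rewrite -linearD; congr (p _); apply/pair_equal_spec; rewrite /= addr0 add0r.
split.
- split.
  + apply: linear_inj => x /= /kp[y [-> /eqP]]; rewrite eq_sym oppr_eq0 => /eqP e0.
    by have -> : y = 0; [apply: inf; rewrite e0 linear0 | rewrite linear0].
  + by move=> y; have [x <-] := sg y; exists (p (0, x)); rewrite qP.
  move=> w; have [[n x] <-] := sp w; rewrite qP /=; split=> [/ex[y <-]|[m]].
    exists (n + h y); apply: subr0_eq; rewrite /= -linearB; apply/kp; exists y.
    by apply/pair_equal_spec; rewrite /= addrAC subrr add0r sub0r.
  move=> /(congr1 q); rewrite !qP /= linear0 => /esym; exact.
- move=> x; apply: subr0_eq; rewrite /= -linearB; apply/kp; exists (- x).
  by apply/pair_equal_spec; rewrite /= !linearN opprK sub0r subr0.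
- by move=> x; rewrite qP.
by move=> w; have [[n x] <-] := sp w; exists n, x; rewrite /= sumE.
Qed.

Lemma pullback N X Z M (j : {linear N -> X}) (p : {linear X -> Z}) (h : {linear M -> Z}) :
  ses j p -> exists W (j' : {linear N -> W}) (p' : {linear W -> M}) (k : {linear W -> X}),
  [/\ ses j' p', forall w, p (k w) = h (p' w), forall x, k (j' x) = j x &
      injective (pair_map k p') /\ forall x m, p x = h m -> exists w, pair_map k p' w = (x, m)].
Proof.
move=> [inj_j sp ex].
have hS : submodP (fun z : (X * M)%type => p z.1 = h z.2).
  by split=> [|a x y e1 e2]; rewrite /= ?linear0 // !linearP e1 e2.
have [W [i [inji iP]]] := ker_exists hS.
have [|j' j'P] := @factor_inj _ _ _ i (inl_map X M \o j) inji.
  by move=> x; apply/iP; rewrite /= linear0; apply/ex; exists x.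
exists W, j', (snd_map X M \o i), (fst_map X M \o i); split.
- split.
  + by apply: linear_inj => x e; apply: inj_j; have := congr1 fst (j'P x); rewrite e !linear0.
  + move=> m; have [x xe] := sp (h m).
    by have /iP[y ye] : p (x, m).1 = h (x, m).2 by []; exists y; rewrite /= ye.
  move=> w; split=> [/= e|[n <-]]; last by rewrite /= j'P.
  have /iP : exists y, i y = i w by exists w.
  rewrite e linear0 => /ex[n ne]; exists n; apply: inji; rewrite j'P /= ne.
  by case: (i w) e => /= a b ->.
- by move=> w /=; apply/iP; exists w.
- by move=> x /=; rewrite j'P.
have kE w : pair_map (fst_map X M \o i) (snd_map X M \o i) w = i w by rewrite /=; case: (i w).
split=> [w w'|x m e]; first by rewrite !kE => /inji.
have /iP[w wE] : p (x, m).1 = h (x, m).2 by [].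
by exists w; rewrite kE.
Qed.

End ExactSequences.

(** * Projective dimension *)

Section ProjectiveDimension.
Variable A : pzRingType.
Implicit Types K L M N P Q W X Y Z : lmodType A.

Definition free_mod k : lmodType A := {ffun 'I_k -> A^o}.

Lemma free_delta k (x : free_mod k) :
  x = \sum_i (x i : A) *: ([ffun j => (j == i)%:R] : free_mod k).
Proof.
apply/ffunP => j; rewrite sum_ffunE (bigD1 j) //= !ffunE eqxx /= big1 => [|i ij].
  by rewrite addr0 /GRing.scale /= mulr1.
by rewrite !ffunE eq_sym (negbTE ij) /GRing.scale /= mulr0.
Qed.

Definition comb k M (v : 'I_k -> M) : {linear free_mod k -> M}.
Proof.
refine (@mklin A (free_mod k) M (fun c => \sum_i (c i : A) *: v i) _) => a x y.
rewrite scaler_sumr -big_split; apply: eq_bigr => i _ /=.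
by rewrite !ffunE scalerDl scalerA.
Defined.

Lemma combE k M (v : 'I_k -> M) c : comb v c = \sum_i (c i : A) *: v i.
Proof. by []. Qed.

Lemma comb_delta k M (v : 'I_k -> M) i : comb v [ffun j => (j == i)%:R] = v i.
Proof.
rewrite combE (bigD1 i) //= ffunE eqxx scale1r big1 ?addr0 // => j ji.
by rewrite ffunE (negbTE ji) scale0r.
Qed.

Lemma projective_free k : projective (free_mod k).
Proof.
move=> M N g f sg; have [s gs] := choice sg.
exists (comb (fun i => s (f [ffun j => (j == i)%:R]))) => x.
rewrite [in RHS](free_delta x) combE !linear_sum; apply: eq_bigr => i _.
by rewrite !linearZ /= gs.
Qed.

Lemma fgP M : finitely_generated M <-> exists k (g : {linear free_mod k -> M}), surj g.
Proof.
split=> [[k [v hv]]|[k [g sg]]].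
  exists k, (comb v) => y; have [c ->] := hv y; exists [ffun i => c i].
  by rewrite combE; apply: eq_bigr => i _; rewrite ffunE.
exists k, (fun i => g [ffun j => (j == i)%:R]) => x; have [c <-] := sg x.
exists c; rewrite {1}(free_delta c) linear_sum; by apply: eq_bigr => i _; rewrite linearZ.
Qed.

Lemma fg_surj M N (g : {linear M -> N}) :
  surj g -> finitely_generated M -> finitely_generated N.
Proof.
move=> sg /fgP[k [h sh]]; apply/fgP; exists k, (g \o h) => y.
by have [x <-] := sg y; have [z <-] := sh x; exists z.
Qed.

Lemma fg_iso M N : module_iso M N -> finitely_generated M -> finitely_generated N.
Proof. by move=> [f [g fg gf]]; apply: (@fg_surj _ _ f) => y; exists (g y). Qed.

Lemma fg_retract M N : retract M N -> finitely_generated N -> finitely_generated M.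
Proof. by move=> [i [p ip]]; apply: (@fg_surj _ _ p) => y; exists (i y). Qed.

Lemma fg_free k : finitely_generated (free_mod k).
Proof. by apply/fgP; exists k, (idfun : free_mod k -> free_mod k) => y; exists y. Qed.

Lemma fg_regular : finitely_generated A^o.
Proof.
exists 1%N, (fun=> 1) => x; exists (fun=> x); rewrite big_ord1.
by rewrite /GRing.scale /= mulr1.
Qed.

Lemma fg_ext K P M (f : {linear K -> P}) (g : {linear P -> M}) : ses f g ->
  finitely_generated K -> finitely_generated M -> finitely_generated P.
Proof.
move=> [_ sg ex] [k [v hv]] [m [w hw]]; have [s gs] := choice sg.
exists (k + m)%N, (fun i => match split i with inl j => f (v j) | inr j => s (w j) end) => x.
have [c cE] := hw (g x).
have /ex[y yE] : g (x - \sum_j c j *: s (w j)) = 0.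
  rewrite linearB linear_sum cE; apply/eqP; rewrite subr_eq0; apply/eqP.
  by apply: eq_bigr => i _; rewrite linearZ /= gs.
have [d dE] := hv y.
exists (fun i => match split i with inl j => d j | inr j => c j end).
rewrite big_split_ord /=.
have -> : x = f y + \sum_j c j *: s (w j) by rewrite yE subrK.
congr (_ + _); last first.
  by apply: eq_bigr => i _; case: splitP => j /= e; [have := ltn_ord j; rewrite -e ltnNge leq_addr|
   have -> : j = i by apply/val_inj/eqP; rewrite -(eqn_add2l k) -e].
rewrite dE linear_sum; apply: eq_bigr => i _; rewrite linearZ /=.
case: splitP => j /= e; first by have -> : j = i by apply: val_inj.
by have := ltn_ord i; rewrite e ltnNge leq_addr.
Qed.

Lemma fg_prod M N : finitely_generated M -> finitely_generated N ->
  finitely_generated (M * N)%type.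
Proof. exact: (fg_ext (ses_split_prod M N)). Qed.

Lemma fg_zero M : zero_module M -> finitely_generated M.
Proof. by move=> M0; exists 0%N, (fun=> 0) => x; exists (fun=> 0); rewrite big_ord0; apply: M0. Qed.

Lemma projective_retract Q P : retract Q P -> projective P -> projective Q.
Proof.
move=> [i [p ip]] hP M N g f sg; have [h hE] := hP M N g (f \o p) sg.
by exists (h \o i) => x; rewrite /= hE /= ip.
Qed.

Lemma projective_prod P Q : projective P -> projective Q -> projective (P * Q)%type.
Proof.
move=> hP hQ M N g f sg.
have [h hE] := hP M N g (f \o inl_map P Q) sg.
have [k kE] := hQ M N g (f \o inr_map P Q) sg.
exists (copair_map h k) => -[x y] /=; rewrite linearD hE kE /= -linearD; congr (f _).
by apply/pair_equal_spec; rewrite /= addr0 add0r.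
Qed.

Lemma projective_zero Q : zero_module Q -> projective Q.
Proof. by move=> Q0 M N g f sg; exists (zero_map Q M) => x; rewrite (Q0 x) !linear0. Qed.

Lemma section_iso K P M (f : {linear K -> P}) (g : {linear P -> M}) (s : {linear M -> P}) :
  ses f g -> (forall x, g (s x) = x) -> module_iso (K * M)%type P.
Proof.
move=> [inf _ ex] gs; apply: (@iso_of_bij _ _ _ (copair_map f s)).
  apply: linear_inj => -[x y] /= e; have : g (f x + s y) = 0 by rewrite e linear0.
  have gf : g (f x) = 0 by apply/ex; exists x.
  rewrite linearD gf gs add0r => y0; rewrite y0 linear0 addr0 in e *.
  by rewrite (inf x 0) // linear0.
move=> p; have /ex[x xE] : g (p - s (g p)) = 0 by rewrite linearB gs subrr.
by exists (x, g p); rewrite /= xE subrK.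
Qed.

Lemma retraction_section K P M (f : {linear K -> P}) (g : {linear P -> M}) (r : {linear P -> K}) :
  ses f g -> (forall x, r (f x) = x) -> exists s : {linear M -> P}, forall x, g (s x) = x.
Proof.
move=> [inf sg ex] rf; pose h : {linear P -> P} := idfun \- (f \o r).
have [|s sE] := @factor_surj _ _ _ _ g h sg.
  by move=> x /ex[y <-]; rewrite /= rf subrr.
exists s => x; have [p <-] := sg x; rewrite sE /= linearB.
by have -> : g (f (r p)) = 0; [apply/ex; exists (r p) | rewrite subr0].
Qed.

Lemma retraction_iso K P M (f : {linear K -> P}) (g : {linear P -> M}) (r : {linear P -> K}) :
  ses f g -> (forall x, r (f x) = x) -> module_iso (K * M)%type P.
Proof. by move=> h rf; have [s sE] := retraction_section h rf; apply: section_iso h sE. Qed.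

Lemma projective_iso K P M (f : {linear K -> P}) (g : {linear P -> M}) : ses f g ->
  projective M -> module_iso (K * M)%type P.
Proof.
move=> h hM; have [_ sg _] := h.
have [s sE] := hM _ _ g idfun sg; exact: section_iso h sE.
Qed.

Lemma module_iso_trans M N P : module_iso M N -> module_iso N P -> module_iso M P.
Proof. by move=> [f bf] [g bg]; exists (g \o f); apply: bij_comp. Qed.

Lemma retract_trans M N P : retract M N -> retract N P -> retract M P.
Proof.
move=> [i [p ip]] [j [q jq]]; exists (j \o i), (p \o q) => x.
by rewrite /= jq ip.
Qed.

Lemma retract_l M N : retract M (M * N)%type.
Proof. by exists (inl_map M N), (fst_map M N). Qed.

Lemma retract_r M N : retract N (M * N)%type.
Proof. by exists (inr_map M N), (snd_map M N). Qed.

Lemma retract_refl M : retract M M.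
Proof. by exists idfun, idfun. Qed.

Lemma retract_prod M N M' N' : retract M M' -> retract N N' ->
  retract (M * N)%type (M' * N')%type.
Proof.
move=> [i [p ip]] [j [q jq]]; exists (prod_map i j), (prod_map p q) => -[x y] /=.
by rewrite ip jq.
Qed.

Lemma projective_of_iso M N : module_iso M N -> projective N -> projective M.
Proof. by move=> h; apply/projective_retract/module_iso_retract. Qed.

(** Projective dimension at most [n], counted by syzygies so that dimension arguments become
    inductions on [n]. The agreement with resolutions is [finite_pdimP]. *)
Inductive pdle : nat -> lmodType A -> Prop :=
| pdle_proj n M : projective M -> pdle n M
| pdle_step n K P M (f : {linear K -> P}) (g : {linear P -> M}) :
    ses f g -> projective P -> pdle n K -> pdle n.+1 M.

Lemma pdle_iso n M N : module_iso M N -> pdle n M -> pdle n N.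
Proof.
move=> iMN h; case: h iMN => [m M' hM'|m K P M' f g h hP hK] iMN.
  by apply/pdle_proj/(projective_of_iso _ hM')/module_isoC.
by have [g' h'] := ses_isor h iMN; apply: pdle_step h' hP hK.
Qed.

Lemma pdle0 M : pdle 0 M -> projective M.
Proof. by move E: 0%N => n h; case: h E. Qed.

Lemma pdle_cover n M : pdle n.+1 M -> exists K P (f : {linear K -> P}) (g : {linear P -> M}),
  [/\ ses f g, projective P & pdle n K].
Proof.
move E: n.+1 => m h; case: h E => [k M' hM' _|k K P M' f g h hP hK [->]].
  exists (zero_mod A), M', (zero_map (zero_mod A) M'), idfun; split=> //.
    split=> [x y _|y|y] /=; first by rewrite (zero_modP x) (zero_modP y).
      by exists y.
    by split=> [->|[x <-]] //; exists 0.
  exact/pdle_proj/projective_zero/zero_modP.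
by exists K, P, f, g.
Qed.

Lemma prod_isoC M N : module_iso (M * N)%type (N * M)%type.
Proof.
exists (pair_map (snd_map M N) (fst_map M N)).
by exists (fun x => (x.2, x.1)) => -[].
Qed.

Lemma pdle_prod n M N : pdle n M -> pdle n N -> pdle n (M * N)%type.
Proof.
elim: n M N => [|n IH] M N hM hN.
  by apply/pdle_proj/projective_prod; apply: pdle0.
have [K [P [f [g [h hP hK]]]]] := pdle_cover hM.
have [K' [P' [f' [g' [h' hP' hK']]]]] := pdle_cover hN.
by apply: (pdle_step (ses_prod h h')); [apply: projective_prod | apply: IH].
Qed.

(** The kernel [K1] of [P -> X] is an extension of the projective [Q] by the syzygy [K] of [X * Q];
    it splits, so [K1] is [K * Q] and no longer than [K]. *)
Lemma pdle_retract_proj n X Q : projective Q -> pdle n (X * Q)%type -> pdle n X.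
Proof.
elim: n X Q => [|n IH] X Q hQ hX.
  by apply/pdle_proj/(projective_retract (retract_l X Q))/pdle0.
have [K [P [f [g [h hP hK]]]]] := pdle_cover hX; have [inf sg ex] := h.
pose g1 : {linear P -> X} := fst_map X Q \o g.
have s1 : surj g1 by move=> x; have [p pE] := sg (x, 0); exists p; rewrite /= pE.
have [K1 [f1 h1]] := ker_ses s1; apply: (pdle_step h1) => //; apply: (IH _ (zero_mod A)).
  exact/projective_zero/zero_modP.
have [if1 _ ex1] := h1.
have s2 : surj (snd_map X Q \o g \o f1).
  move=> q; have [p pE] := sg (0, q).
  have /ex1[y yE] : g1 p = 0 by rewrite /= pE.
  by exists y; rewrite /= yE pE.
have [|k kE] := @factor_inj _ _ _ _ f1 f if1.
  by move=> x; apply/ex1; rewrite /= (ses_comp0 _ h).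
have h2 : ses k (snd_map X Q \o g \o f1).
  split=> // [x y e|y]; first by apply: inf; rewrite -!kE e.
  split=> [/= e|[x <-]]; last by rewrite /= kE (ses_comp0 _ h).
  have e1 := ses_comp0 y h1; rewrite /g1 /= in e1.
  have /ex[x xE] : g (f1 y) = 0 by case: (g (f1 y)) e e1 => a b /= -> ->.
  by exists x; apply: if1; rewrite kE.
apply: (pdle_iso (M := (K * Q)%type)).
  apply: (module_iso_trans (projective_iso h2 hQ)).
  exists (inl_map K1 (zero_mod A)); exists fst => // -[x y] /=.
  by congr pair; rewrite (zero_modP y).
by apply: pdle_prod => //; apply: pdle_proj.
Qed.

(** Lifts [a] and [b] of the identity of [M] between the two covers give the isomorphism and its
    inverse by explicit formulas. *)
Lemma schanuel K P M (f : {linear K -> P}) (g : {linear P -> M}) K' P'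
  (f' : {linear K' -> P'}) (g' : {linear P' -> M}) :
  ses f g -> ses f' g' -> projective P -> projective P' ->
  module_iso (K * P')%type (K' * P)%type.
Proof.
move=> [inf sg ex] [inf' sg' ex'] hP hP'.
have [a aE] := hP _ _ g' g sg'; have [b bE] := hP' _ _ g g' sg.
have gf x : g (f x) = 0 by apply/ex; exists x.
have gf' x : g' (f' x) = 0 by apply/ex'; exists x.
pose u : {linear (K * P')%type -> P} := copair_map f b.
pose v : {linear (K' * P)%type -> P'} := copair_map f' a.
have [|c cE] := @factor_inj _ _ _ _ f' (snd_map K P' \- (a \o u)) inf'.
  by move=> [x y]; apply/ex'; rewrite /= linearB aE linearD gf add0r bE subrr.
have [|d dE] := @factor_inj _ _ _ _ f (snd_map K' P \- (b \o v)) inf.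
  by move=> [x y]; apply/ex; rewrite /= linearB bE linearD gf' add0r aE subrr.
exists (pair_map c u), (pair_map d v) => [[x y]|[x y]] /=.
  have e : f' (c (x, y)) + a (f x + b y) = y by rewrite cE /= subrK.
  rewrite e; congr pair; apply: inf; rewrite dE /= e.
  by rewrite addrK.
have e : f (d (x, y)) + b (f' x + a y) = y by rewrite dE /= subrK.
rewrite e; congr pair; apply: inf'; rewrite cE /= e.
by rewrite addrK.
Qed.

Lemma pdle_syzygy n K P M (f : {linear K -> P}) (g : {linear P -> M}) :
  ses f g -> projective P -> pdle n.+1 M -> pdle n K.
Proof.
move=> h hP hM; have [K' [P' [f' [g' [h' hP' hK']]]]] := pdle_cover hM.
apply: (@pdle_retract_proj _ _ P') => //.
apply: (pdle_iso (module_isoC (schanuel h h' hP hP'))).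
by apply: pdle_prod => //; apply: pdle_proj.
Qed.

Lemma pdleS n M : pdle n M -> pdle n.+1 M.
Proof. by elim=> [m M' h|m K P M' f g h hP _ IH]; [apply: pdle_proj | apply: pdle_step h hP IH]. Qed.

Lemma pdle_leq n m M : (n <= m)%N -> pdle n M -> pdle m M.
Proof. by move=> /subnK <- h; elim: (m - n)%N => // k IH; apply: pdleS. Qed.

(** A cover [P] of [X * Y] covers [X] and [Y] separately, and the product of these two kernels is
    again a syzygy of [X * Y]; the induction hypothesis applies to that product. *)
Lemma pdle_summand n X Y : pdle n (X * Y)%type -> pdle n X.
Proof.
elim: n X Y => [|n IH] X Y hX.
  by apply/pdle_proj/(projective_retract (retract_l X Y))/pdle0.
have [K [P [f [g [h hP hK]]]]] := pdle_cover hX; have [inf sg ex] := h.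
have s1 : surj (fst_map X Y \o g) by move=> x; have [p pE] := sg (x, 0); exists p; rewrite /= pE.
have s2 : surj (snd_map X Y \o g) by move=> x; have [p pE] := sg (0, x); exists p; rewrite /= pE.
have [K1 [f1 h1]] := ker_ses s1; have [K2 [f2 h2]] := ker_ses s2.
apply: (pdle_step h1) => //; apply: (IH _ K2).
apply: (pdle_syzygy (ses_prod h1 h2)) hX; exact: projective_prod.
Qed.

Lemma retract_iso X Y : retract X Y -> exists Z, module_iso (X * Z)%type Y.
Proof.
move=> [i [p ip]]; have inji : injective i by apply: (can_inj ip).
by have [Z [g h]] := coker_ses inji; exists Z; apply: retraction_iso h ip.
Qed.

Lemma pdle_ret n X Y : retract X Y -> pdle n Y -> pdle n X.
Proof. by move=> /retract_iso[Z iso] h; apply: (@pdle_summand _ _ Z); apply: pdle_iso (module_isoC iso) h. Qed.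

(* The kernel of the composite P -> Y -> Z as an extension of X by the kernel of P -> Y. *)
Lemma ses_comp X Y Z (f : {linear X -> Y}) (g : {linear Y -> Z}) K P (i : {linear K -> P})
  (p : {linear P -> Y}) L (j : {linear L -> P}) :
  ses f g -> ses i p -> ses j (g \o p) ->
  exists (u : {linear K -> L}) (v : {linear L -> X}), ses u v /\ forall x, j (u x) = i x.
Proof.
move=> [inf sg ex] [ini sp exi] [inj_j _ exj].
have [|u uE] := @factor_inj _ _ _ _ j i inj_j.
  move=> x; apply/exj => /=; have -> : p (i x) = 0 by apply/exi; exists x.
  by rewrite linear0.
have [|v vE] := @factor_inj _ _ _ _ f (p \o j) inf.
  by move=> x; apply/ex; apply/exj; exists x.
exists u, v; split=> //; split.
- by move=> x y e; apply: ini; rewrite -!uE e.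
- move=> x; have [q qE] := sp (f x).
  have /exj[l lE] : (g \o p) q = 0 by rewrite /= qE; apply/ex; exists x.
  by exists l; apply: inf; rewrite vE /= lE.
move=> l; split=> [e|[x <-]].
  have /exi[x xE] : p (j l) = 0 by rewrite -[LHS](vE l) e linear0.
  by exists x; apply: inj_j; rewrite uE.
by apply: inf; rewrite vE /= uE linear0; apply/exi; exists x.
Qed.

(* Horseshoe lemma. *)
Lemma pdle_mid n X Y Z (f : {linear X -> Y}) (g : {linear Y -> Z}) :
  ses f g -> pdle n X -> pdle n Z -> pdle n Y.
Proof.
elim: n X Y Z f g => [|n IH] X Y Z f g h hX hZ.
  apply: (pdle_iso (projective_iso h (pdle0 hZ))).
  by apply: pdle_prod.
have [inf sg ex] := h.
have [K [P [i [p [hi hP hK]]]]] := pdle_cover hX.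
have [L [Q [j [q [hj hQ hL]]]]] := pdle_cover hZ.
have [ini sp exi] := hi; have [inj_j sq exj] := hj.
have [s sE] := hQ _ _ g q sg.
pose c : {linear (P * Q)%type -> Y} := copair_map (f \o p) s.
have gf x : g (f x) = 0 by apply/ex; exists x.
have sc : surj c.
  move=> y; have [z zE] := sq (g y).
  have /ex[x xE] : g (y - s z) = 0 by rewrite linearB sE zE subrr.
  have [w wE] := sp x; exists (w, z); by rewrite /= wE xE subrK.
have [N [k hk]] := ker_ses sc; apply: (pdle_step hk); first exact: projective_prod.
have [ink _ exk] := hk.
have cE a b : c (a, b) = f (p a) + s b by [].
have [|u uE] := @factor_inj _ _ _ _ k (inl_map P Q \o i) ink.
  move=> x; apply/exk; rewrite /= linear0 addr0.
  by have -> : p (i x) = 0; [apply/exi; exists x | rewrite linear0].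
have [|v vE] := @factor_inj _ _ _ _ j (snd_map P Q \o k) inj_j.
  move=> x; apply/exj; rewrite /= -sE.
  have /(congr1 g) : c (k x) = 0 by apply/exk; exists x.
  by rewrite linear0 /= linearD gf add0r.
apply: (IH K N L u v) => //; split.
- by move=> x y e; apply: ini; have := congr1 fst (uE x); rewrite e uE /=.
- move=> l; have qj : q (j l) = 0 by apply/exj; exists l.
  have /ex[x xE] : g (s (j l)) = 0 by rewrite sE.
  have [w wE] := sp x.
  have /exk[y yE] : c (- w, j l) = 0 by rewrite cE !linearN /= wE xE addNr.
  by exists y; apply: inj_j; rewrite vE /= yE.
move=> y; split=> [e|[x <-]]; last by apply: inj_j; rewrite vE /= uE linear0.
have k2 : (k y).2 = 0 by have := vE y; rewrite e linear0.
have : c (k y) = 0 by apply/exk; exists y.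
case E: (k y) k2 => [a b] /= ->; rewrite linear0 addr0 => pa.
have /exi[x xE] : p a = 0 by apply: inf; rewrite pa linear0.
by exists x; apply: ink; rewrite uE /= xE E; congr pair; have := vE y; rewrite e linear0 /= E.
Qed.

(** A syzygy of [Z] is an extension of [X] by a syzygy of [Y]. The lemma after it rotates the
    sequence once more in the same way. *)
Lemma pdle_right n X Y Z (f : {linear X -> Y}) (g : {linear Y -> Z}) :
  ses f g -> pdle n X -> pdle n.+1 Y -> pdle n.+1 Z.
Proof.
move=> h hX hY; have [K [P [i [p [hi hP hK]]]]] := pdle_cover hY.
have [_ sg _] := h; have [_ sp _] := hi.
have sgp : surj (g \o p).
  by move=> z; have [y <-] := sg z; have [x <-] := sp y; exists x.
have [L [j hj]] := ker_ses sgp; apply: (pdle_step hj) => //.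
have [u [v [huv _]]] := ses_comp h hi hj; exact: pdle_mid huv hK hX.
Qed.

Lemma pdle_left n X Y Z (f : {linear X -> Y}) (g : {linear Y -> Z}) :
  ses f g -> pdle n Y -> pdle n Z -> pdle n X.
Proof.
move=> h hY; case: n hY => [|n] hY hZ.
  apply: (pdle_ret _ hY); apply: (retract_trans (retract_l X Z)).
  exact/module_iso_retract/(projective_iso h)/pdle0.
have [K [P [i [p [hi hP hK]]]]] := pdle_cover hY.
have [_ sg _] := h; have [_ sp _] := hi.
have sgp : surj (g \o p).
  by move=> z; have [y <-] := sg z; have [x <-] := sp y; exists x.
have [L [j hj]] := ker_ses sgp.
have [u [v [huv _]]] := ses_comp h hi hj.
apply: (pdle_right huv) => //; apply: pdleS; exact: (pdle_syzygy hj) hZ.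
Qed.

Lemma pdle_zero n M : zero_module M -> pdle n M.
Proof. by move=> M0; apply/pdle_proj/projective_zero. Qed.

End ProjectiveDimension.

(** * Ext and strong tilting modules *)

Section Ext.
Variable A : pzRingType.
Implicit Types K L M N P Q T W X Y Z : lmodType A.

(* [Ext^1(M, N) = 0], in terms of extending maps into N. *)
Definition ext1 M N : Prop :=
  forall K P (f : {linear K -> P}) (g : {linear P -> M}), ses f g ->
  forall h : {linear K -> N}, exists h' : {linear P -> N}, forall x, h' (f x) = h x.

Lemma ext1_lift M N X Z (j : {linear N -> X}) (p : {linear X -> Z}) (a : {linear M -> Z}) :
  ext1 M N -> ses j p -> exists b : {linear M -> X}, forall x, p (b x) = a x.
Proof.
move=> hMN /(pullback a)[W [j' [p' [k [h pk _ _]]]]].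
have [r rE] := hMN _ _ _ _ h idfun.
have [s sE] := retraction_section h rE.
by exists (k \o s) => x; rewrite /= pk sE.
Qed.

Lemma ext1_split M N W (j : {linear N -> W}) (p : {linear W -> M}) :
  ext1 M N -> ses j p -> module_iso (N * M)%type W.
Proof.
move=> hMN h; have [r rE] := hMN _ _ _ _ h idfun; exact: retraction_iso h rE.
Qed.

(** One projective presentation suffices to test Ext^1: a lift [a] of [g] makes [P'] a quotient of
    [K' * P], and on this quotient [h] and the extension of [h \o c] agree where they overlap. *)
Lemma ext1_cover K P M N (f : {linear K -> P}) (g : {linear P -> M}) :
  ses f g -> projective P ->
  (forall h : {linear K -> N}, exists h' : {linear P -> N}, forall x, h' (f x) = h x) ->
  ext1 M N.
Proof.
move=> [inf sg ex] hP hext K' P' f' g' [inf' sg' ex'] h.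
have [a aE] := hP _ _ g' g sg'.
have [|c cE] := @factor_inj _ _ _ _ f' (a \o f) inf'.
  by move=> x; apply/ex'; rewrite /= aE; apply/ex; exists x.
have [e eE] := hext (h \o c).
have [||u uE] := @factor_surj _ _ _ N (copair_map f' a) (copair_map h e).
- move=> y; have [z zE] := sg (g' y).
  have /ex'[x xE] : g' (y - a z) = 0 by rewrite linearB aE zE subrr.
  by exists (x, z); rewrite /= xE subrK.
- move=> [x y] /= /eqP; rewrite addr_eq0 => /eqP xy.
  have /ex[z zE] : g y = 0.
    rewrite -aE; apply/eqP; rewrite -oppr_eq0 -linearN; apply/eqP.
    by apply/ex'; exists x.
  have -> : x = - c z by apply: inf'; rewrite xy linearN cE /= zE.
  by rewrite -zE eE /= linearN addNr.
exists u => x; have := uE (x, 0); by rewrite /= !linear0 !addr0.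
Qed.

Lemma ext1_projective M N : projective M -> ext1 M N.
Proof.
move=> hM K P f g h k.
have [_ sg _] := h; have [s sE] := hM _ _ g idfun sg.
have [inf _ ex] := h.
have [|r rE] := @factor_inj _ _ _ _ f (idfun \- (s \o g)) inf.
  by move=> x; apply/ex; rewrite /= linearB sE subrr.
exists (k \o r) => x /=; congr (k _); apply: inf; rewrite rE /=.
by rewrite (ses_comp0 _ h) linear0 subr0.
Qed.

Lemma ext1_retractr M N N' : retract N N' -> ext1 M N' -> ext1 M N.
Proof.
move=> [i [p ip]] h K P f g hs k; have [k' kE] := h _ _ _ _ hs (i \o k).
by exists (p \o k') => x; rewrite /= kE /= ip.
Qed.

Lemma ext1_prodr M N N' : ext1 M N -> ext1 M N' -> ext1 M (N * N')%type.
Proof.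
move=> h h' K P f g hs k.
have [u uE] := h _ _ _ _ hs (fst_map N N' \o k).
have [v vE] := h' _ _ _ _ hs (snd_map N N' \o k).
by exists (pair_map u v) => x; rewrite /= uE vE /=; case: (k x).
Qed.

Lemma ext1_ffun M N k : ext1 M N -> ext1 M {ffun 'I_k -> N}.
Proof.
move=> h K P f g hs u.
have evlin i : linear (fun x : {ffun 'I_k -> N} => x i) by move=> a x y; rewrite !ffunE.
have /choice[v vE] i : exists v : {linear P -> N}, forall x, v (f x) = u x i.
  by have [v vE] := h _ _ _ _ hs (mklin (evlin i) \o u); exists v => x; rewrite vE.
have lin : linear (fun x => [ffun i => v i x] : {ffun 'I_k -> N}).
  by move=> a x y; apply/ffunP => i; rewrite !ffunE linearP.
by exists (mklin lin) => x; apply/ffunP => i; rewrite /= ffunE vE.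
Qed.

Lemma in_addP T X : in_add T X <-> exists n, retract X {ffun 'I_n -> T}.
Proof.
split=> [[n [i [p ip]]]|[n [i [p ip]]]]; first by exists n, i, p.
by exists n, i, p.
Qed.

Lemma ext1_in_add M N T : in_add T N -> ext1 M T -> ext1 M N.
Proof. by move=> /in_addP[n hr] h; apply: (ext1_retractr hr); apply: ext1_ffun. Qed.

Lemma ext1_zero M N : zero_module N -> ext1 M N.
Proof. by move=> N0 K P f g _ h; exists (zero_map P N) => x; rewrite (N0 (h x)). Qed.

Lemma ext1_mid M N1 N2 N3 (j : {linear N1 -> N2}) (p : {linear N2 -> N3}) :
  ses j p -> finitely_generated M -> ext1 M N1 -> ext1 M N3 -> ext1 M N2.
Proof.
move=> h /fgP[k [g sg]] h1 h3; have [K [f hf]] := ker_ses sg.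
apply: (ext1_cover hf (@projective_free A k)) => u.
have [v vE] := h3 _ _ _ _ hf (p \o u).
have [_ sp exp] := h; have [inj_j _ _] := h.
have [w wE] := projective_free v sp.
have [|d dE] := @factor_inj _ _ _ _ j (u \- (w \o f)) inj_j.
  by move=> x; apply/exp; rewrite /= linearB wE vE subrr.
have [e eE] := h1 _ _ _ _ hf d.
exists (w \+ (j \o e)) => x /=; by rewrite eE dE /= addrC subrK.
Qed.

(* Dimension shift: [Ext^1(M, N2) = 0] and [Ext^2(M, N1) = 0] give [Ext^1(M, N3) = 0]. *)
Lemma ext1_coker K P M N1 N2 N3 (j : {linear N1 -> N2}) (p : {linear N2 -> N3})
  (f : {linear K -> P}) (g : {linear P -> M}) :
  ses j p -> ses f g -> projective P -> ext1 K N1 -> ext1 M N2 -> ext1 M N3.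
Proof.
move=> h hf hP h1 h2; apply: (ext1_cover hf hP) => u.
have [v vE] := ext1_lift u h1 h; have [w wE] := h2 _ _ _ _ hf v.
by exists (p \o w) => x; rewrite /= wE vE.
Qed.

(* Dimension shift: [Ext^1(K, N2) = 0] and [Ext^1(M, N3) = 0] give [Ext^1(K, N1) = 0]. *)
Lemma ext1_syzygy k K P M N1 N2 N3 (j : {linear N1 -> N2}) (p : {linear N2 -> N3})
  (f : {linear K -> P}) (g : {linear P -> M}) (w : {linear free_mod A k -> K}) :
  ses j p -> ses f g -> projective P -> surj w -> ext1 K N2 -> ext1 M N3 -> ext1 K N1.
Proof.
move=> h hf hP sw h2 h3; have [L [v hv]] := ker_ses sw.
apply: (ext1_cover hv (@projective_free A k)) => u.
have [t tE] := h2 _ _ _ _ hv (j \o u).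
have [_ sp exp] := h; have [inj_j _ _] := h.
have [inf _ _] := hf; have [_ _ exv] := hv.
have [|s sE] := @factor_surj _ _ _ _ w (p \o t) sw.
  by move=> x /exv[y <-]; rewrite /= tE; apply/exp; exists (u y).
have [r rE] := h3 _ _ _ _ hf s; have [q qE] := hP _ _ p r sp.
have [|d dE] := @factor_inj _ _ _ _ j (t \- (q \o f \o w)) inj_j.
  by move=> x; apply/exp; rewrite /= linearB qE rE sE subrr.
exists d => x; apply: inj_j; rewrite dE /= tE.
have -> : w (v x) = 0 by apply/exv; exists x.
by rewrite !linear0 addr0.
Qed.

Definition noetherian : Prop :=
  forall K P (f : {linear K -> P}), injective f -> finitely_generated P -> finitely_generated K.

(** The working form of [fin_pdim_mod]; [fin_pdim_modP] compares the two. *)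
Definition pfin M : Prop := finitely_generated M /\ exists n, pdle n M.

Lemma pfin_retract M N : retract M N -> pfin N -> pfin M.
Proof. by move=> h [hf [n hn]]; split; [apply: fg_retract h hf | exists n; apply: pdle_ret h hn]. Qed.

Lemma pfin_iso M N : module_iso M N -> pfin N -> pfin M.
Proof. by move=> /module_iso_retract; apply: pfin_retract. Qed.

Lemma pfin_mid K P M (f : {linear K -> P}) (g : {linear P -> M}) :
  ses f g -> pfin K -> pfin M -> pfin P.
Proof.
move=> h [fK [n hK]] [fM [m hM]]; split; first exact: fg_ext h fK fM.
exists (n + m)%N; apply: (pdle_mid h); [apply: pdle_leq hK | apply: pdle_leq hM].
  exact: leq_addr.
exact: leq_addl.
Qed.

Lemma pfin_right K P M (f : {linear K -> P}) (g : {linear P -> M}) :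
  ses f g -> pfin K -> pfin P -> pfin M.
Proof.
move=> h [fK [n hK]] [fP [m hP]]; split; first by have [_ sg _] := h; apply: fg_surj sg fP.
exists (n + m).+1; apply: (pdle_right h); [apply: pdle_leq hK | apply: pdle_leq hP].
  exact: leq_addr.
by rewrite leqW // leq_addl.
Qed.

Lemma pfin_left K P M (f : {linear K -> P}) (g : {linear P -> M}) : noetherian ->
  ses f g -> pfin P -> pfin M -> pfin K.
Proof.
move=> noe h [fP [n hP]] [fM [m hM]]; split; first by have [inf _ _] := h; apply: noe inf fP.
exists (n + m)%N; apply: (pdle_left h); [apply: pdle_leq hP | apply: pdle_leq hM].
  exact: leq_addr.
exact: leq_addl.
Qed.

Lemma pfin_prod M N : pfin M -> pfin N -> pfin (M * N)%type.
Proof. exact: pfin_mid (ses_split_prod M N). Qed.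

Lemma pfin_free k : pfin (free_mod A k).
Proof. by split; [apply: fg_free | exists 0%N; apply/pdle_proj/projective_free]. Qed.

Lemma pfin_zero M : zero_module M -> pfin M.
Proof. by move=> M0; split; [apply: fg_zero | exists 0%N; apply: pdle_zero]. Qed.

Definition ffun_uncons k M : {linear {ffun 'I_k.+1 -> M} -> (M * {ffun 'I_k -> M})%type}.
Proof.
refine (@mklin A {ffun 'I_k.+1 -> M} (M * {ffun 'I_k -> M})%type
  (fun x => (x ord0, [ffun i => x (lift ord0 i)])) _) => a x y.
apply/pair_equal_spec; rewrite !ffunE; split=> //=.
by apply/ffunP => i; rewrite !ffunE.
Defined.

Lemma ffunS_iso k M : module_iso {ffun 'I_k.+1 -> M} (M * {ffun 'I_k -> M})%type.
Proof.
apply: (@iso_of_bij _ _ _ (ffun_uncons k M)).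
  move=> x y [e0 /ffunP e]; apply/ffunP => i; case: (unliftP ord0 i) => [j ->|-> //].
  by have := e j; rewrite !ffunE.
move=> [m x]; exists [ffun i => if unlift ord0 i is Some j then x j else m] => /=.
rewrite ffunE unlift_none; congr pair.
by apply/ffunP => i; rewrite !ffunE liftK.
Qed.

Lemma ffun0_zero M : zero_module {ffun 'I_0 -> M}.
Proof. by move=> x; apply/ffunP => -[]. Qed.

Lemma ffun1_iso M : module_iso M {ffun 'I_1 -> M}.
Proof.
apply: module_isoC; apply: (module_iso_trans (ffunS_iso 0 M)).
exists (fst_map _ _); exists (fun x => (x, 0)) => // -[x y] /=.
by congr pair; apply/esym/ffun0_zero.
Qed.

Lemma ffun_class (C : lmodType A -> Prop) k M :
  (forall X Y, module_iso X Y -> C Y -> C X) -> (forall X, zero_module X -> C X) ->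
  (forall X Y, C X -> C Y -> C (X * Y)%type) -> C M -> C {ffun 'I_k -> M}.
Proof.
move=> hi h0 hp hM; elim: k => [|k IH]; first exact/h0/ffun0_zero.
by apply: (hi _ _ (ffunS_iso k M)); apply: hp.
Qed.

Lemma pfin_ffun k M : pfin M -> pfin {ffun 'I_k -> M}.
Proof. apply: ffun_class; [exact: pfin_iso | exact: pfin_zero | exact: pfin_prod]. Qed.

Lemma fg_ffun k M : finitely_generated M -> finitely_generated {ffun 'I_k -> M}.
Proof.
apply: ffun_class; [|exact: fg_zero | exact: fg_prod].
by move=> X Y /module_isoC; apply: fg_iso.
Qed.

Lemma pfin_regular : pfin A^o.
Proof. exact: pfin_iso (ffun1_iso A^o) (pfin_free 1). Qed.

Lemma pfin_in_add T X : in_add T X -> pfin T -> pfin X.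
Proof. by move=> /in_addP[n h] hT; apply: (pfin_retract h); apply: pfin_ffun. Qed.

Lemma pfin_cover M : noetherian -> pfin M -> exists k K (f : {linear K -> free_mod A k}) (g : {linear _ -> M}),
  ses f g /\ pfin K.
Proof.
move=> noe [/fgP[k [g sg]] hM]; have [K [f h]] := ker_ses sg; exists k, K, f, g; split=> //.
apply: (pfin_left noe h (pfin_free k)); split=> //; apply: fg_surj sg _; exact: fg_free.
Qed.

Lemma projective_fg_free P : projective P -> finitely_generated P ->
  exists k, retract P (free_mod A k).
Proof.
move=> hP /fgP[k [g sg]]; have [s sE] := hP _ _ g idfun sg.
by exists k, s, g.
Qed.

Lemma in_add_iso T X Y : module_iso X Y -> in_add T Y -> in_add T X.
Proof.
by move=> /module_iso_retract h /in_addP[n h']; apply/in_addP; exists n; apply: retract_trans h h'.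
Qed.

Lemma in_add_retract T X Y : retract X Y -> in_add T Y -> in_add T X.
Proof. by move=> h /in_addP[n h']; apply/in_addP; exists n; apply: retract_trans h h'. Qed.

Lemma in_add_zero T X : zero_module X -> in_add T X.
Proof.
move=> X0; exists 0%N, (zero_map X _), (zero_map _ X) => x.
by rewrite (X0 x).
Qed.

Lemma ffun_add_iso n m M :
  module_iso ({ffun 'I_n -> M} * {ffun 'I_m -> M})%type {ffun 'I_(n + m) -> M}.
Proof.
elim: n => [|n IH].
  exists (snd_map _ _); exists (fun x => (0, x)) => [[x y]|x] //=; congr pair; exact/esym/ffun0_zero.
have [f bf] := IH.
apply: (module_iso_trans _ (module_isoC (ffunS_iso (n + m) M))).
have [u [v [uv vu]]] := module_iso_inv (ffunS_iso n M).
have [f' [g' [fg gf]]] := module_iso_inv IH.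
pose F1 : {linear ({ffun 'I_n.+1 -> M} * {ffun 'I_m -> M})%type -> M} := fst_map _ _ \o u \o fst_map _ _.
pose F2 : {linear ({ffun 'I_n.+1 -> M} * {ffun 'I_m -> M})%type -> {ffun 'I_(n + m) -> M}} :=
  f' \o pair_map (snd_map _ _ \o u \o fst_map _ _) (snd_map _ _).
exists (pair_map F1 F2).
exists (fun z => (v (z.1, (g' z.2).1), (g' z.2).2)) => [[x y]|[x y]] /=.
  by rewrite fg /= -surjective_pairing uv.
rewrite vu /=; congr pair; by rewrite -surjective_pairing gf.
Qed.

Lemma in_add_prod T X Y : in_add T X -> in_add T Y -> in_add T (X * Y)%type.
Proof.
move=> /in_addP[n h] /in_addP[m h']; apply/in_addP; exists (n + m)%N.
apply: (retract_trans (retract_prod h h')).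
exact/module_iso_retract/ffun_add_iso.
Qed.

Lemma in_add_refl T : in_add T T.
Proof.
by apply/in_addP; exists 1%N; apply/module_iso_retract/ffun1_iso.
Qed.

Lemma in_add_ffun T X k : in_add T X -> in_add T {ffun 'I_k -> X}.
Proof. apply: ffun_class; [exact: in_add_iso | exact: in_add_zero | exact: in_add_prod]. Qed.

Lemma in_add_trans T X Y : in_add T X -> in_add X Y -> in_add T Y.
Proof.
move=> hX /in_addP[n h]; apply: (in_add_retract h); exact: in_add_ffun.
Qed.

Lemma in_add_of_retract T X : retract X T -> in_add T X.
Proof. by move=> h; apply: in_add_retract h (in_add_refl T). Qed.

End Ext.

(** * Coresolutions by Ext-injective modules, and approximations *)

Section Coresolutions.
Variable A : pzRingType.
Implicit Types C K L M N P T W X Y Z : lmodType A.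
Implicit Types Q : lmodType A -> Prop.

(** Over a noetherian ring [pfin] is closed under syzygies, so vanishing of Ext^1 on all of [pfin]
    brings the higher Ext groups with it. *)
Definition ext_injective N : Prop := forall M, pfin M -> ext1 M N.

(** A coresolution of length [n] by modules in [Q], cut into short exact sequences. *)
Fixpoint cores Q n M : Prop :=
  if n is n'.+1 then exists X M' (f : {linear M -> X}) (g : {linear X -> M'}),
    [/\ ses f g, Q X & cores Q n' M']
  else Q M.

Lemma cores_sub Q Q' n M : (forall X, Q X -> Q' X) -> cores Q n M -> cores Q' n M.
Proof.
move=> h; elim: n M => [|n IH] M /=; first exact: h.
by move=> [X [M' [f [g [hs /h hX /IH]]]]]; exists X, M', f, g.
Qed.

(* [Ext^{n+1}(M, N) = 0] *)
Fixpoint exti n M N : Prop :=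
  if n is n'.+1 then forall k K (f : {linear K -> free_mod A k}) (g : {linear free_mod A k -> M}),
    ses f g -> exti n' K N
  else ext1 M N.

(** The dual of [ses_comp]: the cokernel of [X -> Y -> T] is an extension of [C] by [Z]. *)
Lemma ses_comp_inj X Y T Z C C1 (f : {linear X -> Y}) (g : {linear Y -> Z})
  (h : {linear Y -> T}) (h' : {linear T -> C}) (q : {linear T -> C1}) :
  ses f g -> ses h h' -> ses (h \o f) q ->
  exists (u : {linear Z -> C1}) (v : {linear C1 -> C}), ses u v.
Proof.
move=> [inf sg ex] [inh sh exh] [_ sq exq].
have [|u uE] := @factor_surj _ _ _ _ g (q \o h) sg.
  by move=> y /ex[x <-] /=; apply/exq; exists x.
have [|v vE] := @factor_surj _ _ _ _ q h' sq.
  by move=> t /exq[x <-]; apply/exh; exists (f x).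
exists u, v; split.
- apply: linear_inj => z; have [y <-] := sg z; rewrite uE /= => /exq[x /inh <-].
  by apply/ex; exists x.
- by move=> c; have [t <-] := sh c; exists (q t); rewrite vE.
move=> c; have [t <-] := sq c; rewrite vE; split=> [/exh[y <-]|[z]].
  by exists (g y); rewrite uE.
have [y <-] := sg z; rewrite uE /= => e.
have /exq[x /= xE] : q (t - h y) = 0 by rewrite linearB e subrr.
by rewrite -(subrK (h y) t) -xE -linearD; apply/exh; exists (f x + y).
Qed.

(** The horseshoe lemma for coresolutions. The extension [e] of [a] to [Y] is a hypothesis; in the
    applications it comes from Ext-injectivity of [T]. *)
Lemma horseshoe X Y Z T T' C C' (f : {linear X -> Y}) (g : {linear Y -> Z})
  (a : {linear X -> T}) (a' : {linear T -> C}) (b : {linear Z -> T'}) (b' : {linear T' -> C'})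
  (e : {linear Y -> T}) : ses f g -> ses a a' -> ses b b' -> (forall x, e (f x) = a x) ->
  exists W (k : {linear Y -> (T * T')%type}) (q : {linear (T * T')%type -> W})
    (u : {linear C -> W}) (v : {linear W -> C'}), ses k q /\ ses u v.
Proof.
move=> [inf sg ex] [ina sa exa] [inb sb exb] eE.
pose k : {linear Y -> (T * T')%type} := pair_map e (b \o g).
have gf x : g (f x) = 0 by apply/ex; exists x.
have ink : injective k.
  apply: linear_inj => y [ey /= by0].
  have /ex[x xE] : g y = 0 by apply: inb; rewrite by0 linear0.
  by rewrite -xE; have -> : x = 0; [apply: ina; rewrite -eE xE ey linear0|rewrite linear0].
have [W [q hk]] := coker_ses ink; have [_ sq exq] := hk.
have [|u uE] := @factor_surj _ _ _ _ a' (q \o inl_map T T') sa.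
  move=> t /exa[x <-]; apply/exq; exists (f x).
  by rewrite /= eE gf linear0.
have [|v vE] := @factor_surj _ _ _ _ q (b' \o snd_map T T') sq.
  by move=> t /exq[y <-] /=; apply/exb; exists (g y).
exists W, k, q, u, v; split=> //; split.
- apply: linear_inj => c; have [t <-] := sa c; rewrite uE /= => /exq[y [ey by0]].
  have /ex[x xE] : g y = 0 by apply: inb; rewrite by0 linear0.
  by apply/exa; exists x; rewrite -eE xE ey.
- by move=> c; have [t <-] := sb c; exists (q (0, t)); rewrite vE.
move=> w; have [[t t'] <-] := sq w; rewrite vE /=; split=> [/exb[z]|[c]].
  have [y <-] := sg z => e'; exists (a' (t - e y)); rewrite uE /=; apply: subr0_eq; rewrite -linearB.
  apply/exq; exists (- y); rewrite /= !linearN /= e'.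
  by apply/pair_equal_spec; rewrite /= addrAC subrr !sub0r.
by have [s <-] := sa c; rewrite uE /= => /(congr1 v); rewrite !vE /= linear0 => /esym.
Qed.

Section Noetherian.
Hypothesis noe : noetherian A.

Lemma exti_shift C T C' (j : {linear C -> T}) (p : {linear T -> C'}) n M :
  ses j p -> ext_injective T -> pfin M -> exti n M C' -> exti n.+1 M C.
Proof.
move=> h hT; elim: n M => [|n IH] M hM hC k K f g hf.
  have hK : pfin K by apply: (pfin_left noe hf (pfin_free A k) hM).
  have /fgP[m [w sw]] := hK.1.
  by apply: (ext1_syzygy h hf (@projective_free A k) sw (hT _ hK) hC).
have hK : pfin K by apply: (pfin_left noe hf (pfin_free A k) hM).
exact: (IH K hK (hC _ _ _ _ hf)).
Qed.

Lemma exti_cores Q n C M : (forall X, Q X -> ext_injective X) -> cores Q n C ->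
  pfin M -> exti n M C.
Proof.
move=> hQ; elim: n C M => [|n IH] C M /=; first by move=> /hQ; apply.
move=> [X [C' [f [g [h hX hC']]]]] hM.
by apply: (exti_shift h (hQ _ hX) hM); apply: IH.
Qed.

(** Some finite projective dimension is known, and vanishing of Ext^(n+1) into the ring lowers it to
    [n]. For [n = 0], induction on the known dimension makes the syzygy [K] projective, hence a
    summand of a free module, so that Ext^1(M, K) = 0 and the presentation of [M] splits. *)
Lemma pdle_exti n (D : lmodType A -> Prop) :
  (forall M, D M -> pfin M) ->
  (forall k K M (f : {linear K -> free_mod A k}) (g : {linear free_mod A k -> M}),
     ses f g -> D M -> D K) ->
  (forall M, D M -> exti n M A^o) -> forall M, D M -> pdle n M.
Proof.
elim: n D => [|n IH] D Dp Ds De M hM.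
  have [_ [m hm]] := Dp _ hM; elim: m M hM hm => [|m IHm] M hM hm //.
  have [k [K [f [g [h hK]]]]] := pfin_cover noe (Dp _ hM).
  have DK := Ds _ _ _ _ _ h hM.
  have pK := pdle0 (IHm _ DK (pdle_syzygy h (@projective_free A k) hm)).
  have [i hi] := projective_fg_free pK hK.1.
  have hMK : ext1 M K by apply: (@ext1_in_add _ _ _ A^o); [apply/in_addP; exists i | apply: De].
  have [s sE] := ext1_lift idfun hMK h.
  by apply/pdle_proj/(@projective_retract _ M (free_mod A k)); [exists s, g|apply: projective_free].
(* The induction hypothesis is applied to another class of modules, the first syzygies of [D], for
   which the vanishing holds one degree lower. *)
pose D' K := exists k M (f : {linear K -> free_mod A k}) (g : {linear free_mod A k -> M}),
  ses f g /\ D M.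
have D'p K : D' K -> D K by move=> [k [N [f [g [h hN]]]]]; apply: Ds h hN.
have [k [K [f [g [h hK]]]]] := pfin_cover noe (Dp _ hM).
apply: (pdle_step h (@projective_free A k)); apply: (IH D').
- by move=> N /D'p/Dp.
- by move=> l L N f' g' h' /D'p hN; exists l, N, f', g'.
- by move=> N [l [X [f' [g' [h' hX]]]]]; apply: (De _ hX _ _ _ _ h').
by exists k, M, f, g.
Qed.

(** The length of a coresolution of the ring by Ext-injective modules bounds this number: shifting
    along it gives Ext^(n+1)(M, A) = 0 for all [M] in [pfin]. *)
Definition findim_le d : Prop := forall M, pfin M -> pdle d M.

Lemma findim_cores Q n : (forall X, Q X -> ext_injective X) -> cores Q n A^o -> findim_le n.
Proof.
move=> hQ hc; apply: pdle_exti => //; last by move=> M hM; apply: exti_cores hQ hc hM.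
by move=> k K M f g h hM; apply: (pfin_left noe h (pfin_free A k) hM).
Qed.

Section Embedding.
Variable T : lmodType A.
Hypotheses (hT : pfin T) (iT : ext_injective T).

Lemma ext_injective_in_add X : in_add T X -> ext_injective X.
Proof. by move=> h M hM; apply: ext1_in_add h (iT hM). Qed.

(** The first [n] steps of a coresolution in add(T); in contrast to [cores], the last cokernel is
    arbitrary. *)
Fixpoint cor n M : Prop :=
  if n is n'.+1 then exists X M' (f : {linear M -> X}) (g : {linear X -> M'}),
    [/\ ses f g, in_add T X & cor n' M']
  else True.

Lemma cor_pred n M : cor n.+1 M -> cor n M.
Proof.
elim: n M => [|n IH] M //= [X [M' [f [g [h hX hM']]]]].
by exists X, M', f, g; split=> //; apply: IH.
Qed.

Lemma cor_iso n M N : module_iso N M -> cor n M -> cor n N.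
Proof.
case: n => [|n] iMN //= [X [M' [f [g [h hX hM']]]]].
by have [f' h'] := ses_isol h iMN; exists X, M', f', g.
Qed.

Lemma cor_zero n M : zero_module M -> cor n M.
Proof.
elim: n M => [|n IH] M M0 //=; exists M, M, idfun, idfun; split=> //.
- split=> // [y|y]; first by exists y.
  by split=> _; [exists y | apply: M0].
- exact: in_add_zero.
exact: IH.
Qed.

Lemma cor_cores n s M : cores (in_add T) s M -> cor n M.
Proof.
elim: n s M => [|n IH] [|s] M //= h.
  exists M, (zero_mod A), idfun, (zero_map M (zero_mod A)); split=> //.
    split=> // [y|y]; first by exists 0; rewrite /=; apply/esym/zero_modP.
    by split=> // _; exists y.
  exact/cor_zero/zero_modP.
by case: h => [X [M' [f [g [h hX hM']]]]]; exists X, M', f, g; split=> //; apply: IH hM'.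
Qed.

Lemma cor_ext n X Y Z (f : {linear X -> Y}) (g : {linear Y -> Z}) :
  ses f g -> pfin Z -> cor n X -> cor n Z -> cor n Y.
Proof.
elim: n X Y Z f g => [|n IH] X Y Z f g h hZ //=.
move=> [T1 [C1 [a [a' [ha hT1 hC1]]]]] [T2 [C2 [b [b' [hb hT2 hC2]]]]].
have [e eE] := ext_injective_in_add hT1 hZ h a.
have [W [k [q [u [v [hk huv]]]]]] := horseshoe h ha hb eE.
exists (T1 * T2)%type, W, k, q; split=> //; first exact: in_add_prod.
apply: (IH _ _ _ _ _ huv) => //.
by apply: (pfin_right hb) => //; apply: pfin_in_add hT2 hT.
Qed.

(** The cokernel of [M -> T0] is an extension of [C] by the complement [N]. Induction on [n]
    therefore handles [N] before [M] gains its next step. *)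
Lemma cor_retract n M N : pfin (M * N)%type -> cor n (M * N)%type -> cor n M.
Proof.
elim: n M N => [|n IH] M N // hp hc.
have hN : cor n N.
  have iso := prod_isoC N M.
  apply: (IH _ M); first exact: pfin_iso iso hp.
  exact/cor_pred/(cor_iso iso).
have pN : pfin N by apply: pfin_retract hp; apply: retract_r.
move: hc => /= [T0 [C [h [h' [hh hT0 hC]]]]].
have inj1 : injective (h \o inl_map M N).
  by move=> x y /= e; have [i _ _] := hh; have [->] := i _ _ e.
have [C1 [q hq]] := coker_ses inj1.
exists T0, C1, (h \o inl_map M N), q; split=> //.
have [u [v huv]] := ses_comp_inj (ses_split_prod M N) hh hq.
apply: (cor_ext huv) => //; apply: (pfin_right hh hp); exact: pfin_in_add hT0 hT.
Qed.

(** The pushout of [X -> T1] along [f] is [T1 * Z], because [T1] is Ext-injective, and it is also an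
    extension of [C1] by [Y]; then [Z] is split off as a summand. *)
Lemma cor_coker n X Y Z (f : {linear X -> Y}) (g : {linear Y -> Z}) :
  ses f g -> pfin X -> pfin Y -> cor n.+1 X -> cor n Y -> cor n Z.
Proof.
move=> h hX hY [T1 [C1 [a [a' [ha hT1 hC1]]]]] cY.
have hZ := pfin_right h hX hY; have pT1 := pfin_in_add hT1 hT.
have [e eE] := ext_injective_in_add hT1 hZ h a.
have [inf sg ex] := h; have [ina sa exa] := ha.
pose k : {linear Y -> (T1 * Z)%type} := pair_map e g.
have [||q qE] := @factor_surj _ _ _ _ (prod_map (idfun : {linear T1 -> T1}) g) (a' \o (fst_map T1 Y \- (e \o snd_map T1 Y))).
- by move=> [t z]; have [y <-] := sg z; exists (t, y).
- move=> [t y] [/= -> /ex[x <-]]; rewrite eE sub0r linearN (ses_comp0 _ ha).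
  exact: oppr0.
have qE' t y : q (t, g y) = a' (t - e y) by have := qE (t, y).
have hk : ses k q.
  split.
  - apply: linear_inj => y [ey /ex[x xE]]; rewrite -xE.
    by have -> : x = 0; [apply: ina; rewrite -eE xE ey linear0 | rewrite linear0].
  - by move=> c; have [t <-] := sa c; exists (t, g 0); rewrite qE' linear0 subr0.
  move=> [t z]; have [y <-] := sg z; rewrite qE'; split=> [/exa[x xE]|[y' [<- e2]]].
    exists (y + f x); rewrite /= !linearD /= eE xE (ses_comp0 _ h) addr0.
    by rewrite addrC subrK.
  have /ex[x xE] : g (y' - y) = 0 by rewrite linearB /= e2 subrr.
  by rewrite -linearB -xE eE; apply/exa; exists x.
have pC1 := pfin_right ha hX pT1.
apply: (@cor_retract n Z T1); first exact: pfin_prod.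
apply: (cor_iso (prod_isoC Z T1)); exact: cor_ext hk pC1 cY hC1.
Qed.

(** The coresolution of the ring passes to free modules through extensions, to projectives as
    summands, and to the rest by induction on the dimension, a module being the cokernel of its
    syzygy in a free module. *)
Lemma cor_pfin n M s : cores (in_add T) s A^o -> pfin M -> cor n M.
Proof.
move=> hs; have hfree m k : cor m (free_mod A k).
  suff [] : cor m (free_mod A k) /\ pfin (free_mod A k) by [].
  apply: (@ffun_class _ (fun X => cor m X /\ pfin X)).
  - by move=> X Y iso [h1 h2]; split; [apply: cor_iso iso h1 | apply: pfin_iso iso h2].
  - by move=> X X0; split; [apply: cor_zero | apply: pfin_zero].
  - move=> X Y [h1 h2] [h3 h4]; split; last exact: pfin_prod.
    exact: (cor_ext (ses_split_prod X Y)).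
  split; first exact: cor_cores hs.
  exact: pfin_regular.
move=> hM; have [_ [d hd]] := hM; elim: d n M hM hd => [|d IH] n M hM hd.
  have [k /retract_iso[Z iso]] := projective_fg_free (pdle0 hd) hM.1.
  apply: (@cor_retract n M Z); first exact: pfin_iso iso (pfin_free A k).
  exact: cor_iso iso (hfree n k).
have [k [K [f [g [h hK]]]]] := pfin_cover noe hM.
apply: (cor_coker h) => //; first exact: pfin_free.
by apply: IH => //; apply: pdle_syzygy h (@projective_free A k) hd.
Qed.

End Embedding.

(** The working form of a strong tilting module; [strong_tiltingP] proves the equivalence over a
    noetherian ring. *)
Definition stilt T : Prop :=
  [/\ pfin T, ext_injective T & exists s, cores (in_add T) s A^o].

Lemma stilt_embed T M : stilt T -> pfin M ->
  exists X C (f : {linear M -> X}) (g : {linear X -> C}), [/\ ses f g, in_add T X & pfin C].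
Proof.
move=> [hT iT [s hs]] hM; have [X [C [f [g [h hX _]]]]] := cor_pfin hT iT 1 hs hM.
exists X, C, f, g; split=> //; apply: (pfin_right h hM); exact: pfin_in_add hX hT.
Qed.

Lemma stilt_findim T : stilt T -> exists d, findim_le d.
Proof.
move=> [hT iT [s hs]]; exists s; apply: findim_cores hs => X; exact: ext_injective_in_add.
Qed.

Definition ext_inj_upto j N : Prop := forall M, pfin M -> pdle j M -> ext1 M N.

(** Each cokernel in a coresolution by Ext-injectives gains one degree: Ext^1(M, N') is controlled
    by Ext^2(M, N), that is by Ext^1(K, N) for a syzygy [K] of [M]. *)
Lemma ext_inj_coker j N X N' (f : {linear N -> X}) (g : {linear X -> N'}) :
  ses f g -> (forall M, pfin M -> ext1 M X) -> ext_inj_upto j N -> ext_inj_upto j.+1 N'.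
Proof.
move=> h hX hN M hM hd; have [k [K [i [p [hi hK]]]]] := pfin_cover noe hM.
apply: (ext1_coker h hi (@projective_free A k)); last exact: hX.
by apply: hN => //; apply: pdle_syzygy hi (@projective_free A k) hd.
Qed.

(** Repeated embedding into [Q] stops: after [d] steps the cokernel is Ext-injective on all of
    [pfin], so its own embedding splits and it is a summand of a module in [Q]. *)
Lemma cores_embed Q d M : (forall X, Q X -> pfin X /\ ext_injective X) ->
  (forall X Y, retract X Y -> Q Y -> Q X) ->
  (forall N, pfin N -> exists X (f : {linear N -> X}), Q X /\ injective f) ->
  findim_le d -> pfin M -> cores Q d M.
Proof.
move=> hQ Qr emb hd; suff H n j N : (j + n = d)%N -> ext_inj_upto j N -> pfin N -> cores Q n N.
  by apply: (H d 0%N) => // X _ /pdle0/ext1_projective.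
elim: n j N => [|n IH] j N e hj hN; have [X [f [QX inf]]] := emb _ hN;
  have [pX iX] := hQ _ QX; have [C [g h]] := coker_ses inf; have pC := pfin_right h hN pX.
  have hC : ext1 C N by apply: hj => //; rewrite -e addn0 in hd; apply: hd.
  apply: (Qr _ _ _ QX); apply: (retract_trans (retract_l N C)).
  exact/module_iso_retract/(ext1_split hC h).
exists X, C, f, g; split=> //; apply: (IH j.+1) => //; first by rewrite addSnnS.
exact: ext_inj_coker h iX hj.
Qed.

(** Hom(M, N) is finitely generated over End(M); right add(T)-approximations are built from such
    generators. *)
Definition hom_fin : Prop := forall M N, finitely_generated M -> finitely_generated N ->
  exists m (u : 'I_m -> {linear M -> N}), forall v : {linear M -> N},
  exists c : 'I_m -> {linear M -> M}, forall x, v x = \sum_i u i (c i x).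

(** Injectivity is meant relative to finitely generated modules, which keeps all modules involved
    finitely generated. *)
Definition enough_inj : Prop := forall M, finitely_generated M ->
  exists (E : lmodType A) (f : {linear M -> E}), [/\ finitely_generated E, injective f &
    forall N, finitely_generated N -> ext1 N E].

Hypotheses (hom_f : hom_fin) (inj_e : enough_inj).

(** Generators [u i] of Hom(T, Z) over End(T) form one map [p] from T^m to [Z], through which every
    map from a module in [pfin] to [Z] factors. Surjectivity of [p] and Ext-injectivity of its
    kernel both follow from this factorization. *)
Lemma approx_ext_injective T Z : stilt T -> finitely_generated Z -> ext_injective Z ->
  exists Y X (j : {linear Y -> X}) (p : {linear X -> Z}),
  [/\ ses j p, pfin X, finitely_generated Y, ext_injective X & ext_injective Y].
Proof.
move=> sT fZ iZ; have [hT iT _] := sT.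
have [m [u hu]] := hom_f hT.1 fZ.
have lin : linear (fun x : {ffun 'I_m -> T} => \sum_i u i (x i)).
  move=> a x y; rewrite scaler_sumr -big_split; apply: eq_bigr => i _.
  by rewrite !ffunE linearP.
have [p pE] : exists p : {linear {ffun 'I_m -> T} -> Z}, forall x, p x = \sum_i u i (x i).
  by exists (mklin lin).
have lift1 (v : {linear T -> Z}) : exists w : {linear T -> {ffun 'I_m -> T}}, forall x, p (w x) = v x.
  have [c cE] := hu v.
  have linc : linear (fun x => [ffun i => c i x] : {ffun 'I_m -> T}).
    by move=> a x y; apply/ffunP => i; rewrite !ffunE linearP.
  exists (mklin linc) => x; rewrite cE pE; apply: eq_bigr => i _; by rewrite /= ffunE.
have liftn n (v : {linear {ffun 'I_n -> T} -> Z}) : exists w : {linear {ffun 'I_n -> T} -> {ffun 'I_m -> T}}, forall x, p (w x) = v x.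
  elim: n v => [|n IH] v.
    by exists (zero_map _ _) => x; rewrite (ffun0_zero x) !linear0.
  have [s [t [st ts]]] := module_iso_inv (ffunS_iso n T).
  have [w1 w1E] := lift1 (v \o t \o inl_map _ _).
  have [w2 w2E] := IH (v \o t \o inr_map _ _).
  exists (copair_map w1 w2 \o s) => x.
  transitivity (p (w1 (s x).1) + p (w2 (s x).2)); first exact: linearD.
  rewrite w1E w2E /= -!linearD -[in RHS](st x); congr (v (t _)).
  by case: (s x) => y z; apply/pair_equal_spec; rewrite /= addr0 add0r.
(* [M] embeds into add(T) with cokernel in [pfin]; since [Z] is Ext-injective, [v] extends to the
   larger module, where it lifts through the generators. *)
have lift M (v : {linear M -> Z}) : pfin M -> exists w : {linear M -> {ffun 'I_m -> T}}, forall x, p (w x) = v x.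
  move=> hM; have [X [C [f [g [h hX pC]]]]] := stilt_embed sT hM.
  have [v' vE] := iZ _ pC _ _ _ _ h v.
  have /in_addP[n [i [q iq]]] := hX.
  have [w wE] := liftn n (v' \o q).
  by exists (w \o i \o f) => x; rewrite /= wE /= iq vE.
(* Lifting the maps from the free module of rank one reaches every element of [Z]. *)
have sp : surj p.
  move=> z; have [w wE] := lift _ (comb (fun _ : 'I_1 => z)) (pfin_free A 1).
  exists (w [ffun j => (j == 0)%:R]); apply: (etrans (wE _)); exact: (comb_delta (fun _ : 'I_1 => z) 0).
have [Y [j h]] := ker_ses sp; have pT := pfin_ffun m hT.
have iTm : ext_injective {ffun 'I_m -> T} by move=> M hM; apply: ext1_ffun; apply: iT.
exists Y, {ffun 'I_m -> T}, j, p; split=> //; first by have [inj_j _ _] := h; apply: noe inj_j pT.1.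
(* An extension [v'] of [j \o v] induces a map [M -> Z]; subtracting a lift of that map moves [v']
   into the kernel [Y]. *)
move=> M hM; have [k [K [f [g [hf hK]]]]] := pfin_cover noe hM.
apply: (ext1_cover hf (@projective_free A k)) => v.
have [v' vE] := iTm _ hM _ _ _ _ hf (j \o v).
have [_ sg exf] := hf; have [inj_j _ exp] := h.
have [|r rE] := @factor_surj _ _ _ _ g (p \o v') sg.
  by move=> x /exf[y <-]; rewrite /= vE /= (ses_comp0 _ h).
have [w wE] := lift _ r hM.
have [|d dE] := @factor_inj _ _ _ _ j (v' \- (w \o g)) inj_j.
  by move=> x; apply/exp; rewrite /= linearB wE rE subrr.
exists d => x; apply: inj_j; rewrite dE /= vE (ses_comp0 _ hf) linear0.
by rewrite subr0.
Qed.

(** The Ext-injective case is reached by embedding into injectives: each cokernel gains a degree,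
    and after [d] steps [approx_ext_injective] applies. On the way back, [W] is an extension of [E]
    by [Y'], hence Ext-injective, and contains [L] with quotient [X']. *)
Lemma approximation T N : stilt T -> finitely_generated N ->
  exists Y X (j : {linear Y -> X}) (p : {linear X -> N}),
  [/\ ses j p, pfin X, finitely_generated Y & ext_injective Y].
Proof.
move=> sT fN; have [d hd] := stilt_findim sT.
suff H n j L : (j + n = d)%N -> ext_inj_upto j L -> finitely_generated L ->
    exists Y X (i : {linear Y -> X}) (p : {linear X -> L}),
    [/\ ses i p, pfin X, finitely_generated Y & ext_injective Y].
  by apply: (H d 0%N) => // X _ /pdle0/ext1_projective.
elim: n j L => [|n IH] j L e hj fL.
  have iL : ext_injective L by move=> M hM; apply: hj => //; rewrite -e addn0 in hd; apply: hd.
  have [Y [X [i [p [h pX fY _ iY]]]]] := approx_ext_injective sT fL iL.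
  by exists Y, X, i, p.
have [E [f [fE inf iE]]] := inj_e fL.
have iE' : ext_injective E by move=> M [fM _]; apply: iE.
have [L' [g h]] := coker_ses inf.
have fL' : finitely_generated L' by have [_ sg _] := h; apply: fg_surj sg fE.
have [|Y' [X' [i [p [hi pX' fY' iY']]]]] := IH j.+1 L' _ (ext_inj_coker h iE' hj) fL'.
  by rewrite addSnnS.
(* W = E *_{L'} X' *)
have [W [i' [p' [k [hW kE kj kinj]]]]] := pullback g hi.
have iW : ext_injective W by move=> M hM; apply: (ext1_mid hW); [case: hM | apply: iY' | apply: iE'].
have fW : finitely_generated W := fg_ext hW fY' fE.
have [injk surk] := kinj; have [_ sg ex] := h; have [_ sp exi] := hi.
have [|l lE] := @factor_inj _ _ _ _ _ (pair_map (zero_map L X') f) injk.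
  by move=> x; apply: surk; rewrite linear0 (ses_comp0 _ h).
have hL : ses l k.
  split.
  - by move=> x y e'; apply: inf; have := lE x; rewrite e' lE => -[].
  - move=> x; have [z zE] := sg (p x); have [w [wE _]] := surk x z (esym zE).
    by exists w.
  move=> w; split=> [kw|[x <-]]; last by have [] := lE x.
  have /ex[x xE] : g (p' w) = 0 by rewrite -kE kw linear0.
  by exists x; apply: injk; rewrite lE /= xE kw.
(* The kernel [U] of [X -> W -> X'] has finite projective dimension and maps onto [L] with the same
   kernel [Z] as [X -> W]. *)
have [Z [X [u [q [hq pX fZ _ iZ]]]]] := approx_ext_injective sT fW iW.
have skq : surj (k \o q).
  by have [_ sk _] := hL; have [_ sq _] := hq => x; have [w <-] := sk x; have [t <-] := sq w; exists t.
have [U [v hv]] := ker_ses skq.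
have [a [b [hab _]]] := ses_comp hL hq hv.
exists Z, U, a, b; split=> //; exact: (pfin_left noe hv).
Qed.

End Noetherian.
End Coresolutions.

(** * Comparison with projective resolutions and Ext groups *)

Section Resolutions.
Variable A : pzRingType.
Implicit Types C K L M N P T W X Y Z : lmodType A.

Lemma ext1_midl N M1 M2 M3 (f : {linear M1 -> M2}) (g : {linear M2 -> M3}) :
  ses f g -> ext1 M1 N -> ext1 M3 N -> ext1 M2 N.
Proof.
move=> h h1 h3 K P i p hi u; have [_ sg _] := h; have [_ sp _] := hi.
have sgp : surj (g \o p).
  by move=> z; have [y <-] := sg z; have [x <-] := sp y; exists x.
have [L [j hj]] := ker_ses sgp.
have [v [w [hvw vE]]] := ses_comp h hi hj.
have [a aE] := h1 _ _ _ _ hvw u; have [b bE] := h3 _ _ _ _ hj a.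
by exists b => x; rewrite -vE bE aE.
Qed.

Lemma ext1_isol M M' N : module_iso M M' -> ext1 M N -> ext1 M' N.
Proof.
move=> iso h K P f g hs u; have [g' h'] := ses_isor hs (module_isoC iso).
exact: (h _ _ _ _ h').
Qed.

Lemma ext1_prodl_inv M Z N : ext1 (M * Z)%type N -> ext1 M N.
Proof.
move=> h K P f g [inf sg ex] u.
have hs : ses (inl_map P Z \o f) (prod_map g (idfun : {linear Z -> Z})).
  split.
  - by move=> x y [] /inf.
  - by move=> [m z]; have [x <-] := sg m; exists (x, z).
  move=> [x z]; split=> [[/ex[y <-] /= ->]|[y [<- <-]]]; first by exists y.
  by apply/pair_equal_spec; split=> //; apply/ex; exists y.
have [v vE] := h _ _ _ _ hs u.
by exists (v \o inl_map P Z) => x; rewrite /= -vE.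
Qed.

Lemma ext1_retractl M M' N : retract M M' -> ext1 M' N -> ext1 M N.
Proof.
move=> /retract_iso[Z iso] h; apply: (@ext1_prodl_inv _ Z).
exact: ext1_isol (module_isoC iso) h.
Qed.

Section Shift.
Variables (M K : lmodType A) (R : projective_resolution M) (i : {linear K -> res_obj R 0}).
Hypothesis hi : ses i (res_aug R).
Variable q : {linear res_obj R 1 -> K}.
Hypothesis qE : forall x, i (q x) = res_diff R 0 x.

Lemma shift_surj : surj q.
Proof.
have [inj_i _ ex] := hi; move=> x.
have /(@res_exact0 _ _ R _)[y yE] : res_aug R (i x) = 0 by apply/ex; exists x.
by exists y; apply: inj_i; rewrite qE.
Qed.

Lemma shift_exact : exact_at (res_diff R 1) q.
Proof.
have [inj_i _ _] := hi; move=> x; split=> [e|[y <-]].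
  by apply/(@res_exact _ _ R 0 _); rewrite -qE e linear0.
by apply: inj_i; rewrite qE linear0; apply/(@res_exact _ _ R 0 _); exists y.
Qed.

Definition shift_resolution : projective_resolution K :=
  @ProjectiveResolution A K (fun n => res_obj R n.+1) q (fun n => res_diff R n.+1)
    (fun n => @res_projective _ _ R n.+1) shift_surj shift_exact (fun n => @res_exact _ _ R n.+1).
End Shift.

Lemma resolution_kernel M (R : projective_resolution M) :
  exists K (i : {linear K -> res_obj R 0}) (q : {linear res_obj R 1 -> K}),
    ses i (res_aug R) /\ forall x, i (q x) = res_diff R 0 x.
Proof.
have [K [i hi]] := ker_ses (@res_surj _ _ R); have [inj_i _ ex] := hi.
have [|q qE] := @factor_inj _ _ _ _ i (res_diff R 0) inj_i; last by exists K, i, q.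
by move=> x; apply/ex/(@res_exact0 _ _ R _); exists x.
Qed.

Lemma resolution_pdle n M (R : projective_resolution M) :
  (forall i, (n < i)%N -> zero_module (res_obj R i)) -> pdle n M.
Proof.
elim: n M R => [|n IH] M R R0; have [K [i [q [hi qE]]]] := resolution_kernel R.
  apply/pdle_proj/(projective_of_iso _ (@res_projective _ _ R 0))/module_isoC.
  apply: (@iso_of_bij _ _ _ (res_aug R)); last exact: res_surj.
  apply: linear_inj => x /(@res_exact0 _ _ R _)[y <-].
  by rewrite (R0 1%N _ y) // linear0.
apply: (pdle_step hi (@res_projective _ _ R 0)).
by apply: (IH _ (shift_resolution hi qE)) => j nj; apply: R0.
Qed.

Section Cons.
Variables (K P M : lmodType A) (f : {linear K -> P}) (g : {linear P -> M}).
Hypotheses (h : ses f g) (hP : projective P).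
Variable R : projective_resolution K.

Definition cons_obj n : lmodType A := if n is n'.+1 then res_obj R n' else P.
Definition cons_diff n : {linear cons_obj n.+1 -> cons_obj n} :=
  match n with 0 => f \o res_aug R : {linear _ -> _} | n'.+1 => res_diff R n' end.

Lemma cons_projective n : projective (cons_obj n).
Proof. by case: n => [|n] //=; apply: res_projective. Qed.
Lemma cons_surj : surj g. Proof. by case: h. Qed.
Lemma cons_exact0 : exact_at (cons_diff 0) g.
Proof.
have [_ _ ex] := h; move=> y; rewrite ex; split=> [[x <-]|[x <-]]; last by exists (res_aug R x).
by have [z <-] := @res_surj _ _ R x; exists z.
Qed.
Lemma cons_exact n : exact_at (cons_diff n.+1) (cons_diff n).
Proof.
case: n => [|n] /=; last exact: res_exact.
have [inf _ _] := h; move=> y; rewrite -(@res_exact0 _ _ R _) /=.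
by split=> [e|->]; [apply: inf; rewrite e linear0 | rewrite linear0].
Qed.

Definition cons_resolution : projective_resolution M :=
  @ProjectiveResolution A M cons_obj g cons_diff cons_projective cons_surj cons_exact0 cons_exact.
End Cons.

Lemma zero_resolution M : zero_module M -> exists R : projective_resolution M,
  forall n, zero_module (res_obj R n).
Proof.
move=> M0; have ex : exact_at (idfun : {linear M -> M}) (idfun : {linear M -> M}).
  by move=> y; split=> _; [exists y | apply: M0].
have sj : surj (idfun : {linear M -> M}) by move=> y; exists y.
by exists (@ProjectiveResolution A M (fun=> M) idfun (fun=> idfun) (fun=> projective_zero M0)
  sj ex (fun=> ex)).
Qed.

Lemma pdle_resolution n M : pdle n M -> exists R : projective_resolution M,
  forall i, (n < i)%N -> zero_module (res_obj R i).
Proof.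
elim=> [m N hN|m K P N f g h hP _ [R R0]]; last first.
  by exists (cons_resolution h hP R) => -[|i] // ; apply: R0.
have [R R0] := zero_resolution (@zero_modP A).
have h : ses (zero_map (zero_mod A) N) (idfun : {linear N -> N}).
  split=> [x y _|y|y] /=; first by rewrite (zero_modP x) (zero_modP y).
    by exists y.
  by split=> [->|[x <-]] //; exists 0.
by exists (cons_resolution h hN R) => -[|i] // _; apply: R0.
Qed.

Lemma finite_pdimP M : finite_pdim M <-> exists n, pdle n M.
Proof.
split=> [[n [R R0]]|[n /pdle_resolution[R R0]]]; last by exists n, R.
by exists n; apply: resolution_pdle R0.
Qed.

Lemma fin_pdim_modP M : fin_pdim_mod M <-> pfin M.
Proof. by split=> [] [fM /finite_pdimP hM]. Qed.

Lemma ext1_of_Ext M N : finite_pdim M -> Ext_eq0 1 M N -> ext1 M N.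
Proof.
move=> [_ [R _]] hE; have [K [i [q [hi qE]]]] := resolution_kernel R.
apply: (ext1_cover hi (@res_projective _ _ R 0)) => h.
have [|b bE] := hE R (h \o q).
  move=> x /=; have -> : q (res_diff R 1 x) = 0.
    by apply/(shift_exact hi qE); exists x.
  by rewrite linear0.
exists b => x; have [y <-] := shift_surj hi qE x.
by rewrite qE -bE.
Qed.

(* Syzygies in a resolution by arbitrary projectives need not be finitely generated; they are so up
   to projective summands. *)
Definition stably_pfin M := exists M0 Q, [/\ pfin M0, projective Q & retract M (M0 * Q)%type].

Lemma stably_pfin_ext1 M N : ext_injective N -> stably_pfin M -> ext1 M N.
Proof.
move=> hN [M0 [Q [h0 hQ hr]]]; apply: (ext1_retractl hr).
apply: (ext1_midl (ses_split_prod M0 Q)); [exact: hN | exact: ext1_projective].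
Qed.

(** The complement [Z] of [M] in [M0 * Q] is covered by the chosen cover of [M0 * Q]. Both
    presentations then end in the same module, and Schanuel embeds [K * L] as a summand of [K0] plus
    a projective. *)
Lemma stably_pfin_syzygy K P M (f : {linear K -> P}) (g : {linear P -> M}) : noetherian A ->
  ses f g -> projective P -> stably_pfin M -> stably_pfin K.
Proof.
move=> noe h hP [M0 [Q [h0 hQ /retract_iso[Z iso]]]].
have [k [K0 [f0 [g0 [hs0 pK0]]]]] := pfin_cover noe h0.
have hQ0 : ses (zero_map (zero_mod A) Q) (idfun : {linear Q -> Q}).
  split=> [x y _|y|y] /=; first by rewrite (zero_modP x) (zero_modP y).
    by exists y.
  by split=> [->|[x <-]] //; exists 0.
have hY := ses_prod hs0 hQ0.
have pR : projective (free_mod A k * Q)%type.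
  by apply: projective_prod => //; apply: projective_free.
have [u [v [uv vu]]] := module_iso_inv iso.
have sZ : surj (snd_map M Z \o v \o prod_map g0 idfun).
  move=> z; have [_ s _] := hY; have [x xE] := s (u (0, z)).
  by exists x; rewrite /= [X in v X]xE uv.
have [L [l hl]] := ker_ses sZ.
have hMZ := ses_prod h hl.
have [g' hMZ'] := ses_isor hMZ iso.
have isoK := schanuel hMZ' hY (projective_prod hP pR) pR.
exists (K0 * zero_mod A)%type, (P * (free_mod A k * Q))%type; split.
- by apply: pfin_prod => //; apply/pfin_zero/zero_modP.
- exact: projective_prod.
apply: retract_trans (module_iso_retract isoK).
exact: retract_trans (retract_l K L) (retract_l _ _).
Qed.

Lemma Ext_eq0_of M N i : noetherian A -> ext_injective N -> stably_pfin M -> Ext_eq0 i.+1 M N.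
Proof.
move=> noe hN; elim: i M => [|i IH] M hM R c hc; have [K [j [q [hj qE]]]] := resolution_kernel R.
  have [|h hE] := @factor_surj _ _ _ _ q c (shift_surj hj qE).
    by move=> x /(shift_exact hj qE)[y <-]; apply: hc.
  have [b bE] := stably_pfin_ext1 hN hM hj h.
  by exists b => x; rewrite -qE bE hE.
have hK := stably_pfin_syzygy noe hj (@res_projective _ _ R 0) hM.
by have [b bE] := IH K hK (shift_resolution hj qE) c hc; exists b.
Qed.

Lemma pfin_stably M : pfin M -> stably_pfin M.
Proof.
move=> hM; exists M, (zero_mod A); split=> //; first exact/projective_zero/zero_modP.
exact: retract_l.
Qed.

Lemma coresolution_cores T : tilting_coresolution T -> exists s, cores (in_add T) s A^o.
Proof.
move=> [s [X [eps [d [ie e0 ed hX X0]]]]]; exists s.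
suff H n j M (a : {linear M -> X j}) : injective a -> exact_at a (d j) -> (j + n = s)%N ->
    cores (in_add T) n M by apply: (H s 0%N _ eps).
elim: n j M a => [|n IH] j M a ia ea e.
  apply: in_add_iso (hX j _); last by rewrite -e leq_addr.
  apply: (iso_of_bij ia) => x; apply/ea.
  by apply: (X0 j.+1); rewrite -e addn0.
have [M' [q [b [sq ib bE]]]] := image_fact (d j).
exists (X j), M', a, q; split; last first.
- apply: (IH j.+1 M' b) => //; last by rewrite addSnnS.
  move=> y; rewrite ed; split=> [[x <-]|[x <-]]; first by exists (q x); rewrite bE.
  by have [z <-] := sq x; exists z; rewrite bE.
- by apply: hX; rewrite -e leq_addr.
split=> // x; rewrite -ea -bE; split=> [->|e']; first by rewrite linear0.
by apply: ib; rewrite e' linear0.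
Qed.

Lemma cores_coresolution T s M : cores (in_add T) s M ->
  exists (X : nat -> lmodType A) (eps : {linear M -> X 0})
         (d : forall j, {linear X j -> X j.+1}),
    [/\ injective eps, exact_at eps (d 0), forall j, exact_at (d j) (d j.+1),
        forall j, (j <= s)%N -> in_add T (X j) & forall j, (s < j)%N -> zero_module (X j)].
Proof.
elim: s M => [|s IH] M /=.
  move=> hM; pose X n : lmodType A := if n is n'.+1 then zero_mod A else M.
  exists X, idfun, (fun j => zero_map (X j) (X j.+1)); split=> //.
  - by move=> y; split=> // _; exists y.
  - by move=> j y; split=> // _; exists 0; rewrite (zero_modP y).
  - by case.
  by case=> // j _; apply: zero_modP.
move=> [X0 [M' [f [g [[inf sg ex] hX0 /IH[X [eps [d [ie e0 ed hX hz]]]]]]]]].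
pose X' n : lmodType A := if n is n'.+1 then X n' else X0.
pose d' n : {linear X' n -> X' n.+1} :=
  match n with 0 => eps \o g : {linear _ -> _} | n'.+1 => d n' end.
exists X', f, d'; split=> //.
- move=> y; rewrite -ex /=; split=> [e|->]; last by rewrite linear0.
  by apply: ie; rewrite e linear0.
- case=> [|j] //= y; rewrite e0; split=> [[x <-]|[x <-]]; last by exists (g x).
  by have [z <-] := sg x; exists z.
- by case=> // j; apply: hX.
by case=> // j; apply: hz.
Qed.

Lemma strong_tiltingP T : noetherian A -> strong_tilting T <-> stilt T.
Proof.
move=> noe; split=> [[[/fin_pdim_modP hT _ /coresolution_cores hc] hE]|[hT iT [s hs]]].
  split=> // M hM; apply: ext1_of_Ext; first by apply/finite_pdimP; case: hM.
  by apply: hE => //; apply/fin_pdim_modP.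
have hE M : pfin M -> forall i, (1 <= i)%N -> Ext_eq0 i M T.
  by move=> hM [|i] // _; apply: Ext_eq0_of => //; apply: pfin_stably.
split=> [|M /fin_pdim_modP]; last exact: hE.
split; first exact/fin_pdim_modP; first exact: hE.
have [X [eps [d hX]]] := cores_coresolution hs.
by exists s, X, eps, d.
Qed.

End Resolutions.

(** * Modules of finite length *)

Section Length.
Variable A : pzRingType.
Implicit Types V W K M N P : lmodType A.

Definition subP V (S S' : V -> Prop) : Prop := forall x, S x -> S' x.
Definition is0 V (x : V) : Prop := x = 0.
Definition full V (x : V) : Prop := True.

Lemma submod0 V : submodP (@is0 V).
Proof. by split=> // a x y -> ->; rewrite /is0 scaler0 addr0. Qed.

Lemma submod_full V : submodP (@full V).
Proof. by []. Qed.

Lemma submodI V (S S' : V -> Prop) : submodP S -> submodP S' -> submodP (fun x => S x /\ S' x).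
Proof. by move=> [h0 h] [h0' h']; split=> // a x y [? ?] [? ?]; split; [apply: h | apply: h']. Qed.

Definition addP V (S S' : V -> Prop) (x : V) : Prop := exists y z, [/\ S y, S' z & x = y + z].

Lemma submodD V (S S' : V -> Prop) : submodP S -> submodP S' -> submodP (addP S S').
Proof.
move=> [h0 h] [h0' h']; split; first by exists 0, 0; rewrite addr0.
move=> a _ _ [x [y [Sx Sy ->]]] [z [w [Sz Sw ->]]].
by exists (a *: x + z), (a *: y + w); split; [apply: h | apply: h' | rewrite scalerDr addrACA].
Qed.

Definition cyc V (x : V) (y : V) : Prop := exists a : A, y = a *: x.

Lemma submod_cyc V (x : V) : submodP (cyc x).
Proof.
split=> [|a _ _ [b ->] [c ->]]; first by exists 0; rewrite scale0r.
by exists (a * b + c); rewrite scalerDl scalerA.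
Qed.

Lemma cyc_refl V (x : V) : cyc x x.
Proof. by exists 1; rewrite scale1r. Qed.

Lemma submod_cycP V (S : V -> Prop) x : submodP S -> S x -> subP (cyc x) S.
Proof. by move=> hS Sx _ [a ->]; apply: submodPZ. Qed.

Definition imgP V W (f : {linear V -> W}) (S : V -> Prop) (y : W) : Prop := exists2 x, S x & f x = y.

Lemma submod_img V W (f : {linear V -> W}) (S : V -> Prop) : submodP S -> submodP (imgP f S).
Proof.
move=> [h0 h]; split; first by exists 0; rewrite ?linear0.
by move=> a _ _ [x Sx <-] [y Sy <-]; exists (a *: x + y); rewrite ?linearP //; apply: h.
Qed.

Lemma submod_preim V W (f : {linear V -> W}) (S : W -> Prop) :
  submodP S -> submodP (fun x => S (f x)).
Proof. by move=> [h0 h]; split=> [|a x y]; rewrite ?linear0 // linearP; apply: h. Qed.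

(* Strict chains of submodules between [P] and [Q] have at most [n] steps. *)
Fixpoint len_le V (P : V -> Prop) n (Q : V -> Prop) : Prop :=
  forall S, submodP S -> subP P S -> subP S Q -> (exists2 x, Q x & ~ S x) ->
  if n is n'.+1 then len_le P n' S else False.

Lemma len_leS V (P Q : V -> Prop) n : len_le P n Q -> len_le P n.+1 Q.
Proof.
elim: n Q => [|n IH] Q h S hS PS SQ hx; first by case: (h S hS PS SQ hx).
by apply: IH; apply: h.
Qed.

Lemma len_le_leq V (P Q : V -> Prop) n m : (n <= m)%N -> len_le P n Q -> len_le P m Q.
Proof. by move=> /subnK <- h; elim: (m - n)%N => // k IH; apply: len_leS. Qed.

Lemma len_le_sub V (P Q Q' : V -> Prop) n : subP Q' Q -> len_le P n Q -> len_le P n Q'.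
Proof.
move=> QQ'; case: n => [|n] /= h S hS PS SQ [x Qx nSx]; apply: (h S hS PS) => [y /SQ/QQ'//|];
  by exists x => //; apply: QQ'.
Qed.

Lemma len_le_base V (P P' Q : V -> Prop) n : subP P P' -> len_le P n Q -> len_le P' n Q.
Proof.
move=> PP'; elim: n Q => [|n IH] Q /= h S hS PS SQ hx.
  by apply: (h S) => // x /PP'/PS.
by apply: IH; apply: h => // x /PP'/PS.
Qed.

Lemma len_le_strict V (P P' Q : V -> Prop) n : submodP P -> subP P P' -> subP P' Q ->
  (exists2 x, P' x & ~ P x) -> len_le P n.+1 Q -> len_le P' n Q.
Proof.
move=> hP PP' P'Q [x P'x nPx]; elim: n Q P'Q => [|n IH] Q P'Q h S hS PS SQ hx.
  apply: (h S hS _ SQ hx P hP) => //; first by move=> y /PP'/PS.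
    by move=> y /PP'/PS.
  by exists x => //; apply: PS.
by apply: IH => //; apply: h => // y /PP'/PS.
Qed.

(** Each strict step in a chain is charged to one of the two bounds. If [S0] is properly contained
    in [S], then either [S0 + Q'] is smaller than [S + Q'] or, by the modular law, the intersection
    with [Q'] shrinks. *)
Lemma len_le_add V (P Q' : V -> Prop) n m S : submodP P -> submodP Q' -> submodP S -> subP P Q' -> subP P S ->
  len_le P n (fun x => S x /\ Q' x) -> len_le Q' m (addP S Q') -> len_le P (n + m) S.
Proof.
move=> hP hQ; move E: (n + m)%N => N; elim: N n m E S => [|N IH] n m E S hS PQ PS hn hm S0 hS0 PS0 S0S [x Sx nx];
  have [e|/contrapT[s [y [S0s Qy xE]]]] := pselect (~ addP S0 Q' x).
- move: E => /eqP; rewrite addn_eq0 => /andP[_ /eqP m0]; subst m.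
  apply: (hm (addP S0 Q')) => //; first exact: submodD.
  + by move=> z Qz; exists 0, z; rewrite add0r; split=> //; case: hS0.
  + by move=> _ [u [v [/S0S Su Qv ->]]]; exists u, v.
  by exists x => //; exists x, 0; rewrite addr0; split=> //; case: hQ.
- move: E => /eqP; rewrite addn_eq0 => /andP[/eqP n0 _]; subst n.
  have yE : y = x - s by rewrite xE addrAC subrr add0r.
  have Sy : S y by rewrite yE; apply: submodPB => //; apply: S0S.
  apply: (hn (fun x => S0 x /\ Q' x)) => //; first exact: submodI.
  + by move=> z Pz; split; [apply: PS0 | apply: PQ].
  + by move=> z [/S0S].
  exists y => // -[S0y _]; apply: nx; rewrite xE; exact: submodPD.
- case: m => [|m] in E hm *; last first.
    have {hm} hm : len_le Q' m (addP S0 Q').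
      apply: hm => //; first exact: submodD.
      * by move=> z Qz; exists 0, z; rewrite add0r; split=> //; case: hS0.
      * by move=> _ [u [v [/S0S Su Qv ->]]]; exists u, v.
      by exists x => //; exists x, 0; rewrite addr0; split=> //; case: hQ.
    apply: (IH n m) => //; first by move: E; rewrite addnS => -[].
    by apply: len_le_sub hn => z [/S0S].
  case: (hm (addP S0 Q')) => //; first exact: submodD.
  + by move=> z Qz; exists 0, z; rewrite add0r; split=> //; case: hS0.
  + by move=> _ [u [v [/S0S Su Qv ->]]]; exists u, v.
  by exists x => //; exists x, 0; rewrite addr0; split=> //; case: hQ.
have yE : y = x - s by rewrite xE addrAC subrr add0r.
have Sy : S y by rewrite yE; apply: submodPB => //; apply: S0S.
have hx : exists2 z, S z /\ Q' z & ~ (S0 z /\ Q' z).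
  by exists y => // -[S0y _]; apply: nx; rewrite xE; exact: submodPD.
have h1 : subP P (fun x => S0 x /\ Q' x) by move=> z Pz; split; [apply: PS0 | apply: PQ].
have h2 : subP (fun x => S0 x /\ Q' x) (fun x => S x /\ Q' x) by move=> z [/S0S].
case: n => [|n] in E hn *; first by case: (hn _ (submodI hS0 hQ) h1 h2 hx).
apply: (IH n m) => //; first by move: E; rewrite addSn => -[].
  exact: (hn _ (submodI hS0 hQ) h1 h2 hx).
by apply: len_le_sub hm => _ [u [v [/S0S Su Qv ->]]]; exists u, v.
Qed.
End Length.

Lemma nat_min (P : nat -> Prop) : (exists n, P n) -> exists2 n, P n & forall m, P m -> (n <= m)%N.
Proof.
move=> [n Pn]; have ex : exists n, `[< P n >] by exists n; apply/asboolP.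
exists (ex_minn ex); first by case: ex_minnP => m /asboolP.
by move=> m Pm; case: ex_minnP => k _; apply; apply/asboolP.
Qed.

Section FiniteLength.
Variable A : pzRingType.
Implicit Types V W K M N P : lmodType A.

Lemma len_le_img V W (f : {linear V -> W}) (P Q : V -> Prop) n : submodP Q -> subP P Q ->
  len_le P n Q -> len_le (imgP f P) n (imgP f Q).
Proof.
elim: n Q => [|n IH] Q hQ PQ h S hS PS SQ [_ [y Qy <-] nSy];
  have h1 : submodP (fun x => Q x /\ S (f x)) by apply: submodI => //; apply: submod_preim.
- apply: (h (fun x => Q x /\ S (f x))) => //.
  + by move=> x Px; split; [apply: PQ | apply: PS; exists x].
  + by move=> x [].
  by exists y => // -[].
have PQ' : subP P (fun x => Q x /\ S (f x)) by move=> x Px; split; [apply: PQ | apply: PS; exists x].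
apply: (@len_le_sub _ _ _ (imgP f (fun x => Q x /\ S (f x)))); last first.
  apply: IH => //; apply: h => //; first by move=> x [].
  by exists y => // -[].
by move=> z Sz; have [x Qx xE] := SQ z Sz; exists x => //; rewrite xE.
Qed.

Lemma len_le_of_img V W (f : {linear V -> W}) (P Q : V -> Prop) n :
  submodP Q -> (forall x, Q x -> f x = 0 -> P x) ->
  len_le (imgP f P) n (imgP f Q) -> len_le P n Q.
Proof.
elim: n Q => [|n IH] Q hQ kP h S hS PS SQ [y Qy nSy].
all: have h1 : subP (imgP f P) (imgP f S) by move=> _ [x /PS Sx <-]; exists x.
all: have h2 : subP (imgP f S) (imgP f Q) by move=> _ [x /SQ Sx <-]; exists x.
all: have h3 : exists2 x, imgP f Q x & ~ imgP f S x.
1,3: exists (f y); first (by exists y); move=> [x Sx xy]; apply: nSy; rewrite -(subrK x y);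
  apply: submodPD => //; apply/PS/kP; [by apply: submodPB => //; apply: SQ | by rewrite linearB xy subrr].
- exact: (h _ (submod_img f hS) h1 h2 h3).
apply: IH => // [x /SQ/kP //|]; exact: (h _ (submod_img f hS) h1 h2 h3).
Qed.

Definition finlen V : Prop := exists n, len_le (@is0 A V) n (@full A V).

Lemma finlen_sub K P (f : {linear K -> P}) : injective f -> finlen P -> finlen K.
Proof.
move=> inf [n h]; exists n; apply: (@len_le_of_img _ _ f) => //.
  by move=> x _ e; apply: inf; rewrite e linear0.
apply: len_le_sub (_ : len_le _ n (@full A P)) => //.
by apply: len_le_base h => x ->; exists 0; rewrite ?linear0.
Qed.

Lemma finlen_surj P M (g : {linear P -> M}) : surj g -> finlen P -> finlen M.
Proof.
move=> sg [n h]; exists n; have := len_le_img g (@submod_full A P) (fun _ _ => I) h.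
move=> h'; apply: len_le_sub (len_le_base _ h'); first by move=> y _; have [x <-] := sg y; exists x.
by move=> _ [x -> <-]; rewrite /is0 linear0.
Qed.

Lemma finlen_ses K P M (f : {linear K -> P}) (g : {linear P -> M}) :
  ses f g -> finlen K -> finlen M -> finlen P.
Proof.
move=> [inf sg ex] [n hn] [m hm]; exists (n + m)%N.
have hI : submodP (imgP f (@full A K)) by apply: submod_img.
apply: (@len_le_add _ _ _ (imgP f (@full A K))) => //; first exact: submod0.
- by move=> x ->; case: hI.
- have h := len_le_img f (@submod_full A K) (fun _ _ => I) hn.
  apply: len_le_sub (len_le_base _ h); first by move=> x [].
  by move=> _ [x -> <-]; rewrite /is0 linear0.
apply: (@len_le_of_img _ _ g); first exact: submodD.
  by move=> x _ /ex[y <-]; exists y.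
apply: len_le_sub (_ : len_le _ m (@full A M)) => //.
by apply: len_le_base hm => x ->; exists 0; rewrite ?linear0 //; case: hI.
Qed.

Lemma finlen_iso M N : module_iso M N -> finlen N -> finlen M.
Proof. by move=> [f bf]; apply: (@finlen_sub _ _ f); apply: bij_inj. Qed.

Lemma finlen_zero M : zero_module M -> finlen M.
Proof. by move=> M0; exists 0%N => S [S0 _] _ _ [x _ nS]; apply: nS; rewrite (M0 x). Qed.

Lemma finlen_prod M N : finlen M -> finlen N -> finlen (M * N)%type.
Proof. exact: finlen_ses (ses_split_prod M N). Qed.

Lemma finlen_ffun k M : finlen M -> finlen {ffun 'I_k -> M}.
Proof. apply: ffun_class; [exact: finlen_iso | exact: finlen_zero | exact: finlen_prod]. Qed.

Lemma finlen_fg M : finlen A^o -> finitely_generated M -> finlen M.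
Proof. by move=> hA /fgP[k [g sg]]; apply: (finlen_surj sg); apply: finlen_ffun. Qed.

Lemma min_submod V (F : (V -> Prop) -> Prop) : finlen V -> (forall S, F S -> submodP S) ->
  (exists S, F S) -> exists2 S, F S & forall S', F S' -> subP S' S -> subP S S'.
Proof.
move=> [n h] hF [S0 F0].
have [|m [S [FS hS]] hmin] := @nat_min (fun n => exists S, F S /\ len_le (@is0 A V) n S).
  by exists n, S0; split=> //; apply: len_le_sub h.
exists S => // S' F' S'S x Sx; apply: contrapT => nx.
have S'0 : subP (@is0 A V) S' by move=> y ->; case: (hF _ F').
have hx : exists2 x, S x & ~ S' x by exists x.
case: m => [|m] in hS hmin *; first exact: (hS _ (hF _ F') S'0 S'S hx).
have /hmin : exists S, F S /\ len_le (@is0 A V) m S by exists S'; split=> //; exact: (hS _ (hF _ F') S'0 S'S hx).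
by rewrite ltnn.
Qed.

Lemma max_submod V (F : (V -> Prop) -> Prop) : finlen V -> (forall S, F S -> submodP S) ->
  (exists S, F S) -> exists2 S, F S & forall S', F S' -> subP S S' -> subP S' S.
Proof.
move=> [n h] hF [S0 F0].
have [|m [S [FS hS]] hmin] := @nat_min (fun n => exists S, F S /\ len_le S n (@full A V)).
  exists n, S0; split=> //; apply: len_le_base h => x ->; by case: (hF _ F0).
exists S => // S' F' SS' x Sx; apply: contrapT => nx.
have hx : exists2 x, S' x & ~ S x by exists x.
case: m => [|m] in hS hmin *; first by apply: (hS S) => //; [exact: hF | exists x].
have /hmin : exists S, F S /\ len_le S m (@full A V).
  by exists S'; split=> //; apply: (len_le_strict (hF _ FS) SS' _ hx).
by rewrite ltnn.
Qed.

Lemma len_le_gen V (P Q : V -> Prop) n : submodP P -> submodP Q -> subP P Q -> len_le P n Q ->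
  exists k (v : 'I_k -> V), (forall i, Q (v i)) /\
    forall x, Q x -> exists c : 'I_k -> A, P (x - \sum_i c i *: v i).
Proof.
elim: n P => [|n IH] P hP hQ PQ h; have [QP|] := pselect (subP Q P).
1,3: by exists 0%N, (fun=> 0); split=> [[]|x Qx] //; exists (fun=> 0); rewrite big_ord0 subr0; apply: QP.
all: move=> /existsNP[x /not_implyP[Qx nPx]].
  by case: (h P) => //; exists x.
have P'Q : subP (addP P (cyc x)) Q.
  by move=> _ [y [_ [Py [a ->] ->]]]; apply: submodPD => //; [apply: PQ | apply: submodPZ].
have hP' := submodD hP (submod_cyc x).
have PP' : subP P (addP P (cyc x)).
  by move=> y Py; exists y, 0; rewrite addr0; split=> //; case: (submod_cyc x).
have [|k [v [Qv hv]]] := IH _ hP' hQ P'Q.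
  apply: (len_le_strict hP PP' P'Q _ h); exists x => //.
  by exists 0, x; rewrite add0r; split=> //; [case: hP | apply: cyc_refl].
exists k.+1, (fun i => if unlift ord0 i is Some j then v j else x); split.
  by move=> i; case: unlift.
move=> y /hv[c [p [_ [Pp [a ->] e]]]].
exists (fun i => if unlift ord0 i is Some j then c j else a).
rewrite big_ord_recl unlift_none /=.
under eq_bigr do rewrite liftK.
by rewrite opprD addrCA e addrCA addNr addr0.
Qed.

Lemma finlen_noetherian : finlen A^o -> noetherian A.
Proof.
move=> hA K P f inf /(finlen_fg hA)/(finlen_sub inf)[n h].
have [|k [v [_ hv]]] := len_le_gen (@submod0 A K) (@submod_full A K) _ h; first by [].
by exists k, v => x; have [c /subr0_eq->] := hv x I; exists c.
Qed.

Definition simple (S : lmodType A) : Prop := ~ zero_module S /\ forall x y : S, x <> 0 -> exists a : A, y = a *: x.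

Lemma simple_sub M : finlen M -> ~ zero_module M ->
  exists (S : lmodType A) (f : {linear S -> M}), simple S /\ injective f.
Proof.
move=> hM /existsNP[x0 nx0].
have [||Q [hQ [x Qx nx]] hmin] := @min_submod M (fun Q => submodP Q /\ exists2 x, Q x & x <> 0) hM.
- by move=> S [].
- by exists (@full A M); split; [apply: submod_full | exists x0].
have [S [i [inj_i iP]]] := ker_exists hQ; exists S, i; split=> //; split.
  by move=> S0; have /iP[y yE] := Qx; apply: nx; rewrite -yE (S0 y) linear0.
move=> y z ny; have Qy : Q (i y) by apply/iP; exists y.
have [] := hmin (cyc (i y)) _ (submod_cycP hQ Qy) (i z).
- split; first exact: submod_cyc.
  exists (i y); first exact: cyc_refl.
  by move=> e; apply: ny; apply: inj_i; rewrite e linear0.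
- by apply/iP; exists z.
by move=> a aE; exists a; apply: inj_i; rewrite aE linearZ.
Qed.

Lemma finlen_ind (C : lmodType A -> Prop) :
  (forall M, zero_module M -> C M) ->
  (forall (S : lmodType A) M N (f : {linear S -> M}) (g : {linear M -> N}), ses f g -> simple S ->
     finlen M -> C N -> C M) ->
  forall M, finlen M -> C M.
Proof.
move=> h0 hS M [n]; elim: n M => [|n IH] M h.
  apply: h0 => x; apply: contrapT => nx.
  by apply: (h (@is0 A M)) => //; [apply: submod0 | exists x].
have [M0|nM] := pselect (zero_module M); first exact: h0.
have hM : finlen M by exists n.+1.
have [S [f [sS inf]]] := simple_sub hM nM; have [N [g hs]] := coker_ses inf.
apply: (hS _ _ _ _ _ hs sS hM); apply: IH; have [_ sg ex] := hs.
have [/existsNP[x nx] _] := sS.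
have hI : submodP (imgP f (@full A S)) by apply: submod_img.
have h' : len_le (imgP f (@full A S)) n (@full A M).
  apply: (len_le_strict (@submod0 A M) _ _ _ h) => //; first by move=> y ->; case: hI.
  by exists (f x); [exists x | move=> e; apply: nx; apply: inf; rewrite e linear0].
have := len_le_img g (@submod_full A M) (fun _ _ => I) h'.
move=> h''; apply: len_le_sub (len_le_base _ h''); first by move=> y _; have [z <-] := sg y; exists z.
by move=> _ [_ [z _ <-] <-]; rewrite /is0; apply/ex; exists z.
Qed.

Lemma max_avoiding V (S0 : V -> Prop) x : submodP S0 -> ~ S0 x ->
  exists S, [/\ submodP S, subP S0 S, ~ S x &
    forall S', submodP S' -> subP S S' -> ~ S' x -> subP S' S].
Proof.
(* [Zorn_bigcup] also asks about the empty chain, whose union is empty; adjoining [S0] turns it into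
   a submodule. *)
move=> h0 nx; pose U (S : set V) : V -> Prop := fun y => S y \/ S0 y.
have [F hF totF|S [[hS nS] hmax]] := @Zorn_bigcup V (fun S => submodP (U S) /\ ~ U S x).
  split; last by move=> [[S FS Sx]|//]; have [_ []] := hF S FS; left.
  split; first by right; case: h0.
  have key S a y z : F S -> U S y -> U S z -> U (\bigcup_(X in F) X)%classic (a *: y + z).
    move=> FS Sy Sz; have [[_ hS] _] := hF S FS.
    by have [Sx|S0x] := hS a y z Sy Sz; [left; exists S | right].
  move=> a y z [[S FS Sy]|Sy] [[S' FS' Sz]|Sz].
  - have [SS'|S'S] := totF _ _ FS FS'; first by apply: (key S') => //; left => //; apply: SS'.
    by apply: (key S) => //; left => //; apply: S'S.
  - by apply: (key S) => //; [left | right].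
  - by apply: (key S') => //; [right | left].
  by right; case: h0 => _; apply.
exists (U S); split=> //; first by move=> y; right.
move=> S' hS' SS' nS' y Sy; apply: contrapT => nUy.
apply: (hmax S'); first split=> [z Sz|sub]; first by apply: SS'; left.
  by apply: nUy; left; apply: sub.
suff -> : U S' = S' by [].
apply/funext => z; apply/propext; split=> [[//|S0z]|Sz]; last by left.
by apply: SS'; right.
Qed.

End FiniteLength.

(** * Artin algebras *)

Lemma submodP_left_ideal (R : pzRingType) (S : R^o -> Prop) : submodP S <-> left_ideal S.
Proof.
split=> [hS|[S0 SD SM]].
  split; first by case: hS.
    by move=> x y Sx Sy; apply: (submodPD (M := R^o)).
  by move=> a x Sx; apply: (submodPZ (M := R^o) a hS Sx).
by split=> // a x y Sx Sy; apply: SD => //; apply: SM.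
Qed.

Lemma artinian_min (R : pzRingType) (F : (R^o -> Prop) -> Prop) : left_artinian R ->
  (forall S, F S -> submodP S) -> (exists S, F S) ->
  exists2 S, F S & forall S', F S' -> subP S' S -> subP S S'.
Proof.
move=> hR hF [S0 F0]; apply: contrapT => no.
have step (S : {S | F S}) : exists S' : {S | F S},
    subP (sval S') (sval S) /\ ~ subP (sval S) (sval S').
  case: S => S FS /=; apply: contrapT => no'; apply: no; exists S => // S' FS' S'S.
  by apply: contrapT => nSS'; apply: no'; exists (exist _ S' FS').
have [next hnext] := choice step.
pose I n := sval (iter n next (exist _ S0 F0)).
have [||n hn] := hR I.
- by move=> n; apply/submodP_left_ideal/hF; exact: (svalP (iter n next (exist _ S0 F0))).
- by move=> n x; rewrite /I /=; have [h _] := hnext (iter n next (exist _ S0 F0)); apply: h.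
have [_] := hnext (iter n next (exist _ S0 F0)); apply => x Ix.
by apply/(hn n.+1 (leqnSn n) x).
Qed.

Section MaximalIdeals.
Variable R : pzRingType.

Lemma maximal_left_ideal_exists (I : R -> Prop) : left_ideal I -> ~ I 1 ->
  exists M, maximal_left_ideal M /\ forall x, I x -> M x.
Proof.
move=> /submodP_left_ideal hI nI1; have [M [hM IM nM1 mM]] := max_avoiding hI nI1.
exists M; split=> //; split=> //; first exact/submodP_left_ideal.
by move=> I' /submodP_left_ideal hI' MI' nI' x I'x; apply: (mM I').
Qed.

Lemma maximal_left_ideal_inv (M : R -> Prop) a : maximal_left_ideal M -> ~ M a ->
  exists b, M (1 - b * a).
Proof.
move=> [/submodP_left_ideal hM nM1 mM] na; apply: contrapT => no.
apply: na; apply: (mM (@addP R R^o M (@cyc R R^o a))).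
- exact/submodP_left_ideal/submodD/submod_cyc.
- by move=> x Mx; exists x, 0; rewrite addr0; split=> //; case: (submod_cyc (a : R^o)).
- by move=> [x [_ [Mx [b ->] e]]]; apply: no; exists b; rewrite e addrK.
by exists 0, a; rewrite add0r; split=> //; [case: hM | apply: cyc_refl].
Qed.
End MaximalIdeals.

(** * Commutative artinian rings have finite length *)

Section Hopkins.
Variable R : comPzRingType.
Hypothesis hR : left_artinian R.

(** The product ideal M S, as the intersection of all ideals that contain the products. *)
Let mulP (M S : R^o -> Prop) (z : R^o) : Prop :=
  forall N : R^o -> Prop, submodP N -> (forall a s : R, M a -> S s -> N (a * s)) -> N z.

Let submod_mul M S : submodP (mulP M S).
Proof.
split=> [N [N0 _] _ //|a x y hx hy N hN hMS]; case: (hN) => _; apply; [exact: hx | exact: hy].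
Qed.

Let mulP_in (M S : R^o -> Prop) (a s : R) : M a -> S s -> mulP M S (a * s).
Proof. by move=> Ma Ss N hN; apply. Qed.

(** The minimal ideal [S] of finite colength is shown to be zero. It satisfies M S = S for every
    maximal ideal [M], which contradicts the choice of an element [x] with x S nonzero and R x
    minimal. *)
Theorem hopkins : finlen R^o.
Proof.
have [||S [hS [n hn]] hmin] := @artinian_min R
  (fun S => submodP S /\ exists n, len_le S n (@full R R^o)) hR.
- by move=> S [].
- exists (@full R R^o); split; first exact: submod_full.
  by exists 0%N => S hS sS _ [x _ nx]; apply: nx; apply: sS.
(* [S] has no simple quotient: its kernel would be a smaller ideal of finite colength. *)
have no_max S' : submodP S' -> subP S' S -> len_le S' 1 S -> subP S S'.
  move=> hS' S'S h1; apply: hmin => //; split=> //; exists (1 + n)%N.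
  apply: (len_le_add hS' hS) => //; first by apply: len_le_sub h1 => x [].
  exact: len_le_sub hn.
(* S / M S is a vector space over R / M. If it were nonzero, the ideal [S1], maximal among those
   that contain M S and avoid [x], would cut out a hyperplane. *)
have maxS M : maximal_left_ideal M -> subP S (mulP M S).
  move=> hM x Sx; apply: contrapT => nx.
  have [S1 [hS1 MS1 nS1x max1]] := max_avoiding (submod_mul M S) nx.
  pose S' y := S1 y /\ S y.
  have hS' : submodP S' by apply: submodI.
  have [] := no_max S' hS' _ _ x Sx; last by [].
    by move=> y [].
  move=> S2 hS2 S'2 S2S [z Sz nz] S3 hS3 S'3 S32 [y S2y ny].
  have key w : S w -> ~ S' w -> exists a, S' (x - a * w).
    move=> Sw nw; apply: contrapT => no; apply: nw; split=> //.
    apply: (max1 (addP S1 (cyc w))); first exact/submodD/submod_cyc.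
    - by move=> u Su; exists u, 0; rewrite addr0; split=> //; case: (submod_cyc w).
    - move=> [u [_ [Su [a ->] e]]]; apply: no; exists a.
      rewrite {1}e addrK; split=> //; have -> : u = x - a *: w by rewrite e addrK.
      by apply: submodPB => //; apply: (submodPZ (M := R^o)).
    by exists 0, w; rewrite add0r; split=> //; [case: hS1 | apply: cyc_refl].
  have S3x u : S u -> ~ S' u -> (forall v, S' v -> S3 v) -> S3 u -> S3 x.
    move=> Su nu h Su3; have [a ha] := key u Su nu.
    rewrite -(subrK (a * u) x); apply: (submodPD (M := R^o)) => //; first exact: h.
    exact: (submodPZ (M := R^o)).
  have unit_a w a : ~ S' w -> S w -> S' (x - a * w) -> exists b, S' (w - b * x).
    move=> nw Sw ha; have nMa : ~ M a.
      move=> Ma; apply: nS1x; rewrite -(subrK (a * w) x); apply: (submodPD (M := R^o)) => //.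
        by case: ha.
      by apply: MS1; apply: mulP_in.
    have [b hb] := maximal_left_ideal_inv hM nMa; exists b.
    have -> : w - b * x = (1 - b * a) * w - b * (x - a * w).
      rewrite mulrBl mul1r mulrBr !mulrA opprB addrA subrK.
      by [].
    apply: (submodPB (M := R^o)) => //; last exact: (submodPZ (M := R^o)).
    split; first by apply: MS1; apply: mulP_in.
    exact: (submodPZ (M := R^o)).
  have nS'y : ~ S' y by move=> /S'3.
  have S2x : S2 x.
    have [a ha] := key y (S2S _ S2y) nS'y.
    rewrite -(subrK (a * y) x); apply: (submodPD (M := R^o)) => //; first exact: S'2.
    exact: (submodPZ (M := R^o)).
  apply: nz; have [/S'2 //|nz'] := pselect (S' z).
  have [a ha] := key z Sz nz'; have [b hb] := unit_a z a nz' Sz ha.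
  rewrite -(subrK (b * x) z); apply: (submodPD (M := R^o)) => //; first exact: S'2.
  exact: (submodPZ (M := R^o)).
suff S0 : subP S (@is0 R R^o).
  by exists n; apply: len_le_base hn.
move=> s Ss; apply: contrapT => ns.
have [||_ [x [-> [s1 Ss1 nxs]]] hmin2] := @artinian_min R
  (fun K => exists x : R, K = cyc (x : R^o) /\ exists2 s, S s & x * s <> 0) hR.
- by move=> _ [x [-> _]]; apply: submod_cyc.
- by exists (cyc (1 : R^o)), 1; split=> //; exists s => //; rewrite mul1r.
have hann : left_ideal (fun r : R => r * x = 0).
  split=> [|r t|a r]; first by rewrite mul0r.
    by move=> e e'; rewrite mulrDl e e' addr0.
  by move=> e; rewrite -mulrA e mulr0.
have [|M [hM annM]] := maximal_left_ideal_exists hann.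
  by rewrite mul1r => x0; apply: nxs; rewrite x0 mul0r.
have [m [Mm [s2 Ss2 nms]]] : exists m, M m /\ exists2 s, S s & x * (m * s) <> 0.
  apply: contrapT => no; apply: nxs.
  apply: (maxS M hM s1 Ss1 (fun z => x * z = 0)).
    split=> [|a u v e e']; first by rewrite mulr0.
    by rewrite mulrDr e' /GRing.scale /= mulrCA e mulr0 addr0.
  by move=> a t Ma St; apply: contrapT => nt; apply: no; exists a; split=> //; exists t.
(* Since x M S = x S is nonzero, some [m] in [M] has m x S nonzero. By minimality [x = r * m * x],
   so [1 - r * m] annihilates [x] and lies in [M], which forces 1 into [M]. *)
have [] := hmin2 (cyc (m * x : R^o)) _ _ x (cyc_refl (x : R^o)).
- by exists (m * x); split=> //; exists s2 => //; rewrite -mulrA mulrCA.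
- by move=> _ [a ->]; exists (a * m); rewrite /GRing.scale /= mulrA.
move=> r rE; have [/submodP_left_ideal hM' nM1 _] := hM; apply: nM1.
rewrite -(subrK (r * m) 1); apply: (submodPD (M := R^o)) => //; last exact: (submodPZ (M := R^o)).
by apply: annM; rewrite mulrBl mul1r -mulrA [X in X - _]rE subrr.
Qed.

End Hopkins.

(** * Restriction of scalars to the base ring *)

Section Restriction.
Variables (R A : pzRingType) (f : {rmorphism R -> A}).

Definition res_type of {rmorphism R -> A} := fun M : lmodType A => (M : Type).
Variable M : lmodType A.
Local Notation res := (res_type f M).
HB.instance Definition _ := GRing.Zmodule.on res.
Definition res_scale (r : R) (x : res) : res := f r *: (x : M).
Lemma res_scaleA a b x : res_scale a (res_scale b x) = res_scale (a * b) x.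
Proof. by rewrite /res_scale rmorphM scalerA. Qed.
Lemma res_scale1 : left_id 1 res_scale.
Proof. by move=> x; rewrite /res_scale rmorph1 scale1r. Qed.
Lemma res_scaleDr : right_distributive res_scale +%R.
Proof. by move=> a x y; rewrite /res_scale scalerDr. Qed.
Lemma res_scaleDl x : {morph res_scale^~ x : a b / a + b}.
Proof. by move=> a b; rewrite /res_scale rmorphD scalerDl. Qed.
HB.instance Definition _ := GRing.Zmodule_isLmodule.Build R res
  res_scaleA res_scale1 res_scaleDr res_scaleDl.
End Restriction.

Definition res (R A : pzRingType) (f : {rmorphism R -> A}) (M : lmodType A) : lmodType R := res_type f M.

Lemma resE (R A : pzRingType) (f : {rmorphism R -> A}) (M : lmodType A) (r : R) (x : M) :
  r *: (x : res f M) = f r *: x.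
Proof. by []. Qed.

Section RestrictionTheory.
Variables (R A : pzRingType) (f : {rmorphism R -> A}).

Lemma res_submod (M : lmodType A) (S : M -> Prop) : submodP S -> submodP (S : res f M -> Prop).
Proof. by move=> [h0 h]; split=> // a x y; apply: h. Qed.

Lemma res_len (M : lmodType A) n (P Q : M -> Prop) :
  len_le (P : res f M -> Prop) n (Q : res f M -> Prop) -> len_le P n Q.
Proof.
elim: n Q => [|n IH] Q h S hS PS SQ hx; first by apply: (h S) => //; apply: res_submod.
by apply: IH; apply: h => //; apply: res_submod.
Qed.

Lemma res_finlen (M : lmodType A) : finlen (res f M) -> finlen M.
Proof. by move=> [n h]; exists n; apply: res_len h. Qed.

Definition res_map (M N : lmodType A) (g : {linear M -> N}) : {linear res f M -> res f N}.
Proof. by refine (@mklin R (res f M) (res f N) g _) => a x y; rewrite /= !resE linearP. Defined.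

Lemma res_fg (M : lmodType A) : finitely_generated (res f A^o) -> finitely_generated M ->
  finitely_generated (res f M).
Proof.
move=> hA /fgP[k [g sg]]; apply: (@fg_surj _ _ _ (res_map g)) => //.
have : finitely_generated {ffun 'I_k -> res f A^o} by apply: fg_ffun.
apply: fg_surj (_ : surj (@mklin R {ffun 'I_k -> res f A^o} (res f (free_mod A k)) idfun _)).
  by move=> a x y; apply/ffunP => i; rewrite !ffunE.
by move=> H y; exists y.
Qed.
End RestrictionTheory.

Section ArtinAlgebra.
Variables (A : pzRingType) (R : comPzRingType) (f : {rmorphism R -> A}).
Hypotheses (hR : left_artinian R) (cf : forall r a, f r * a = a * f r).
Hypothesis gf : exists (n : nat) (v : 'I_n -> A), forall a, exists c : 'I_n -> R, a = \sum_i f (c i) * v i.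
Implicit Types M N T W : lmodType A.

Lemma res_fg_ring : finitely_generated (res f A^o).
Proof. by have [n [v hv]] := gf; exists n, v. Qed.

Lemma res_finlen_fg M : finitely_generated M -> finlen (res f M).
Proof.
move=> fM; apply: finlen_fg; first exact: hopkins.
exact: (res_fg res_fg_ring fM).
Qed.

Definition scal M (r : R) : {linear M -> M}.
Proof.
by refine (@mklin A M M (fun x => f r *: x) _) => a x y; rewrite scalerDr !scalerA cf.
Defined.

Lemma scalE M r x : scal M r x = f r *: x. Proof. by []. Qed.

(** A map is determined by its values on [k] generators of [M], so Hom_A(M, N) is an [R]-submodule
    of N^k, which has finite length over [R]. *)
Lemma hom_gen M N : finitely_generated M -> finitely_generated N ->
  exists m (u : 'I_m -> {linear M -> N}), forall v : {linear M -> N},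
  exists c : 'I_m -> R, forall x, v x = \sum_i f (c i) *: u i x.
Proof.
move=> [k [w hw]] fN; pose V := res f {ffun 'I_k -> N}.
pose Q (z : V) := exists v : {linear M -> N}, forall i, (z : {ffun 'I_k -> N}) i = v (w i).
have hQ : submodP Q.
  split; first by exists (zero_map M N) => i; rewrite ffunE.
  move=> a x y [u uE] [v vE]; exists ((scal N a \o u) \+ v) => i.
  by rewrite resE !ffunE uE vE.
have [n hn] : finlen V by apply: res_finlen_fg; apply: fg_ffun.
have [|m [z [Qz hz]]] := len_le_gen (@submod0 _ V) hQ _ (len_le_sub (fun _ _ => I) hn).
  by move=> x ->; case: hQ.
have [u uE] := choice Qz; exists m, u => v.
have [|c cE] := hz [ffun i => v (w i)]; first by exists v => i; rewrite ffunE.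
exists c => x; have [d ->] := hw x; rewrite linear_sum.
under eq_bigr => i _.
  rewrite linearZ /=.
  have -> : v (w i) = \sum_j f (c j) *: u j (w i).
    move/subr0_eq/ffunP/(_ i): cE; rewrite ffunE => ->.
    by rewrite sum_ffunE; apply: eq_bigr => j _; rewrite resE ffunE uE.
  over.
rewrite /=; under [RHS]eq_bigr => j _ do rewrite linear_sum scaler_sumr.
rewrite [RHS]exchange_big; apply: eq_bigr => i _ /=; rewrite scaler_sumr.
by apply: eq_bigr => j _; rewrite linearZ /= !scalerA cf.
Qed.

Lemma artin_hom_fin : hom_fin A.
Proof.
move=> M N fM fN; have [m [u hu]] := hom_gen fM fN; exists m, u => v.
have [c cE] := hu v; exists (fun i => scal M (c i)) => x.
by rewrite cE; apply: eq_bigr => i _; rewrite scalE linearZ.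
Qed.

Lemma artin_endring T : finitely_generated T -> artin_algebra (endring T).
Proof.
move=> fT; pose g (r : R) : endring T := scal T r.
have gadd : {morph g : x y / x - y}.
  by move=> x y; apply: endring_ext => z; rewrite /endring_fun /= rmorphB scalerBl.
have gmul : monoid_morphism g.
  split; first by apply: endring_ext => z; rewrite /endring_fun /= rmorph1 scale1r.
  by move=> x y; apply: endring_ext => z; rewrite /endring_fun /= rmorphM scalerA.
pose G : {rmorphism R -> endring T} := HB.pack g (GRing.isZmodMorphism.Build _ _ g gadd)
  (GRing.isMonoidMorphism.Build _ _ g gmul).
exists R, G; split=> //.
  by move=> r a; apply: endring_ext => z; rewrite /endring_fun /= linearZ.
have [m [u hu]] := hom_gen fT fT; exists m, u => v; have [c cE] := hu v; exists c.
apply: endring_ext => x; rewrite {1}/endring_fun cE.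
elim/big_rec2 : _ => // i y z _ ->.
by [].
Qed.

(** * Injective envelopes of simple modules *)

Section Envelope.
Variable S : lmodType A.
Hypotheses (fS : finitely_generated S) (sS : simple S).

Definition essential M (j : {linear S -> M}) : Prop :=
  injective j /\ forall x, x <> 0 -> exists a s, a *: x = j s /\ j s <> 0.

Definition annP M (I : A^o -> Prop) (x : M) : Prop := forall a : A, I a -> a *: x = 0.

Lemma submod_annP M (I : A^o -> Prop) : submodP (annP (M := M) I : res f M -> Prop).
Proof.
split=> [a _|r x y hx hy a Ia]; first by rewrite scaler0.
by rewrite resE scalerDr scalerA -cf -scalerA hx // hy // scaler0 addr0.
Qed.

Definition act_map M (u : A) : {linear res f M -> res f M}.
Proof.
refine (@mklin R (res f M) (res f M) (fun x => u *: (x : M)) _) => r x y.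
by rewrite !resE scalerDr !scalerA cf.
Defined.

Lemma artin_finlen_regular : finlen A^o.
Proof. exact: (res_finlen (res_finlen_fg (@fg_regular A))). Qed.

(** Induction on the colength of [I]. If [I'] is minimal over [I] and [u] lies in [I'] but not in
    [I], multiplication by [u] on the annihilator of [I] has the annihilator of [I'] as its kernel,
    and essentiality puts its image inside the copy of [S]. Each step thus costs at most [b], a
    bound for the length of [S]; at [I = 0] the annihilator is all of [M]. *)
Lemma annP_len b M (j : {linear S -> M}) n (I : A^o -> Prop) : essential j ->
  len_le (@is0 R (res f S)) b (@full R (res f S)) ->
  submodP I -> len_le I n (@full A A^o) ->
  len_le (@is0 R (res f M)) (n * b) (annP (M := M) I : res f M -> Prop).
Proof.
move=> [inj_j ess] hb hI hn.
have full0 (J : A^o -> Prop) : (forall u, J u) -> len_le (@is0 R (res f M)) 0 (annP (M := M) J).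
  move=> fJ Q hQ _ QI [x Ix nQ]; apply: nQ.
  by rewrite -(scale1r (x : M)) Ix //; case: hQ.
elim: n I hI hn => [|n IH] I hI hn.
  by apply: full0 => u; apply: contrapT => nIu; apply: (hn I) => //; exists u.
have [fullI|/existsNP[u0 nIu0]] := pselect (forall u, I u).
  by apply: (len_le_leq (leq0n _)); apply: full0.
have [||I' [hI' II' [u I'u nIu]] hmin] := @min_submod A A^o
    (fun I' => [/\ submodP I', subP I I' & exists2 u, I' u & ~ I u]) artin_finlen_regular.
- by move=> Q [].
- by exists (@full A A^o); split=> //; exists u0.
have gen v : I' v -> ~ I v -> exists (a : A) i, I i /\ u = i + a * v.
  move=> I'v nIv; have [|x|i [_ [Ii [a ->] ->]]] := hmin (addP I (cyc v)) _ _ u I'u.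
  - split; first exact/submodD/submod_cyc.
      by move=> x Ix; exists x, 0; rewrite addr0; split=> //; case: (submod_cyc v).
    by exists v => //; exists 0, v; rewrite add0r; split=> //; [case: hI | apply: cyc_refl].
  - by move=> [y [_ [Iy [a ->] ->]]]; apply: submodPD => //; [apply: II' | apply: submodPZ].
  by exists a, i.
have hn' : len_le I' n (@full A A^o) by apply: (len_le_strict hI II' _ _ hn) => //; exists u.
rewrite mulSn addnC; have sann Q := @submod_annP M Q.
have I'sub : subP (annP (M := M) I') (annP I) by move=> x hx a /II'; apply: hx.
apply: (@len_le_add _ (res f M) _ (annP I')) => //.
- exact: submod0.
- by move=> x -> a _; rewrite scaler0.
- by move=> x -> a _; rewrite scaler0.
- by apply: len_le_sub (IH _ hI' hn') => x [].
apply: (@len_le_of_img _ _ _ (act_map M u)); first exact: submodD.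
  move=> _ [x [y [hx hy ->]]] e a I'a.
  have [|nIa] := pselect (I a).
    by move=> Ia; rewrite scalerDr hx // add0r; apply: hy.
  have hxy : annP I (x + y : M) by move=> c Ic; rewrite scalerDr hx // I'sub // addr0.
  have [c [i [Ii aE]]] : exists (c : A) i, I i /\ a = i + c * u.
    have [|z|i [_ [Ii [c ->] ->]]] := hmin (addP I (cyc u)) _ _ a I'a.
    - split; first exact/submodD/submod_cyc.
        by move=> z Iz; exists z, 0; rewrite addr0; split=> //; case: (submod_cyc u).
      by exists u => //; exists 0, u; rewrite add0r; split=> //; [case: hI | apply: cyc_refl].
    - by move=> [w [_ [Iw [c ->] ->]]]; apply: submodPD => //; [apply: II' | apply: submodPZ].
    by exists c, i.
  by rewrite aE scalerDl hxy // add0r -scalerA [u *: _]e scaler0.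
have h := len_le_img (res_map f j) (@submod_full _ (res f S)) (fun _ _ => Logic.I) hb.
apply: len_le_sub (len_le_base _ h); last first.
  by move=> _ [x -> <-]; exists 0 => [a _|]; rewrite ?scaler0 // !linear0.
move=> _ [_ [x [y [hx hy ->]]] <-].
have hxy : annP I (x + y : M) by move=> c Ic; rewrite scalerDr hx // I'sub // addr0.
move: (x + y : M) hxy => {hx hy x y} z hz.
have [z0|nz] := pselect ((u : A) *: z = 0).
  by exists 0 => //; rewrite /= z0 linear0.
(* Some multiple [a u z] is nonzero in [S], so [a * u] is not in [I] and generates [I'] modulo [I].
   Hence [u] is a multiple of [a * u] modulo [I], and [u z] lies in [S] as well. *)
have [a [s [asE ns]]] := ess _ nz.
have I'au : I' (a * u) by apply: (submodPZ (M := A^o)).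
have nIau : ~ I (a * u) by move=> /hz; rewrite -scalerA asE.
have [c [i [Ii uE]]] := gen _ I'au nIau.
exists (c *: s) => //=; rewrite linearZ /= -asE.
have e : (u : A) *: z = ((i : A) + c * (a * (u : A))) *: z by rewrite -[(i : A) + _]uE.
by rewrite [RHS]e scalerDl (hz _ Ii) add0r !scalerA mulrA.
Qed.

Lemma essential_bound : exists B, forall M (j : {linear S -> M}), essential j ->
  len_le (@is0 R (res f M)) B (@full R (res f M)).
Proof.
have [b hb] := res_finlen_fg fS; have [n hn] := artin_finlen_regular.
exists (n * b)%N => M j hj; apply: len_le_sub (annP_len hj hb (@submod0 A A^o) hn).
by move=> x _ a ->; rewrite scale0r.
Qed.

(** The lengths of essential extensions of [S] are bounded, and [E] is one for which the least bound
    cannot be lowered. A proper essential extension of [E] would be longer. *)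
Lemma simple_envelope : exists (E : lmodType A) (j : {linear S -> E}),
  [/\ finitely_generated E, essential j & forall N (i : {linear E -> N}),
    finitely_generated N -> essential (i \o j) -> injective i -> surj i].
Proof.
have [|n hn hmin] := @nat_min (fun n => forall M (j : {linear S -> M}), finitely_generated M ->
    essential j -> len_le (@is0 R (res f M)) n (@full R (res f M))).
  by have [B hB] := essential_bound; exists B => M j _; apply: hB.
have essS : essential (idfun : {linear S -> S}).
  by split=> // x nx; exists 1, x; rewrite scale1r.
case: n hn hmin => [|n] hn hmin.
  have [/existsNP[x nx] _] := sS; case: (hn S _ fS essS (@is0 R (res f S))) => //.
    exact: submod0.
  by exists x.
have /existsNP[E /existsNP[j /not_implyP[fE /not_implyP[hj nE]]]] : ~ forall M (j : {linear S -> M}),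
    finitely_generated M -> essential j -> len_le (@is0 R (res f M)) n (@full R (res f M)).
  by move=> /hmin; rewrite ltnn.
exists E, j; split=> // N i fN hij inj_i y; apply: contrapT => ny; apply: nE.
have hI : submodP (imgP (res_map f i) (@full R (res f E))) by apply: submod_img.
apply: (@len_le_of_img _ _ _ (res_map f i)) => //.
  by move=> x _ e; apply: inj_i; rewrite linear0.
apply: len_le_base (_ : len_le (@is0 R (res f N)) n _); first by move=> x ->; exists 0; rewrite ?linear0.
apply: (hn N _ fN hij) => //; first by move=> x ->; case: hI.
by exists y => // -[x _ xy]; apply: ny; exists x.
Qed.

(** An embedding of [E] into [N] splits: if [L] is a maximal submodule of [N] that meets [E] in 0,
    then N / L is an essential extension of [E], hence equal to it. Pushouts turn this splitting
    into the extension of maps. *)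
Lemma simple_injective : exists (E : lmodType A) (j : {linear S -> E}),
  [/\ finitely_generated E, injective j & forall N, finitely_generated N -> ext1 N E].
Proof.
have [E [j [fE hj hmax]]] := simple_envelope; have [inj_j ess] := hj.
exists E, j; split=> //.
have retr N (i : {linear E -> N}) : finitely_generated N -> injective i ->
    exists r : {linear N -> E}, forall x, r (i x) = x.
  move=> fN inj_i; have fl : finlen N := finlen_fg artin_finlen_regular fN.
  have [||L [hL LE] Lmax] := @max_submod A N
    (fun L => submodP L /\ forall x, L (i x) -> x = 0) fl.
  - by move=> L [].
  - exists (@is0 A N); split; first exact: submod0.
    by move=> x e; apply: inj_i; rewrite e linear0.
  have [Q [p [sp pE]]] := coker_exists hL.
  have inj_pi : injective (p \o i) by apply: linear_inj => x /= /pE/LE.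
  have fQ : finitely_generated Q := fg_surj sp fN.
  have spi : surj (p \o i).
    apply: hmax => //; split; first by move=> x y /inj_pi/inj_j.
    move=> q; have [x <-] := sp q => nq.
    have nLx : ~ L x by move=> /pE.
    (* By maximality of [L], the larger submodule generated by [L] and [x] meets [E]. *)
    have [e [l [a [Ll [eE ne]]]]] : exists e l a, L l /\ (i e = l + a *: x /\ e <> 0).
      apply: contrapT => no; apply: nLx; apply: (Lmax (addP L (cyc x))).
      - split; first exact/submodD/submod_cyc.
        move=> e [l [_ [Ll [a ->] eE]]]; apply: contrapT => ne.
        by apply: no; exists e, l, a.
      - by move=> l Ll; exists l, 0; rewrite addr0; split=> //; case: (submod_cyc x).
      by exists 0, x; rewrite add0r; split=> //; [case: hL | apply: cyc_refl].
    have [b [s [bE ns]]] := ess _ ne.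
    exists (b * a), s; split; last by move=> /= e0; apply: ns; apply: inj_pi; rewrite /= e0 !linear0.
    have pl : p l = 0 by apply/pE.
    by rewrite /= -bE -scalerA !linearZ /= eE linearD pl add0r linearZ.
  have [|g gE] := @factor_inj _ _ _ _ (p \o i) p inj_pi; first by move=> x; apply: spi.
  by exists g => x; apply: inj_pi; rewrite gE.
move=> N /fgP[k [g sg]]; have [K [u hu]] := ker_ses sg.
apply: (ext1_cover hu (@projective_free A k)) => h.
have [W [i [q [v [hW vE _ _]]]]] := pushout h hu.
have fN : finitely_generated N := fg_surj sg (fg_free A k).
have [inj_i _ _] := hW.
have [r rE] := retr _ i (fg_ext hW fE fN) inj_i.
by exists (r \o v) => x; rewrite /= vE rE.
Qed.
End Envelope.

Lemma artin_enough_inj : enough_inj A.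
Proof.
move=> M fM; have fl : finlen M := finlen_fg artin_finlen_regular fM.
move: fM; apply: (finlen_ind (C := fun M => finitely_generated M -> exists (E : lmodType A) (j : {linear M -> E}),
  [/\ finitely_generated E, injective j & forall N, finitely_generated N -> ext1 N E])) fl => {M}.
- move=> M M0 fM; exists M, idfun; split=> // N _; exact: ext1_zero.
move=> S M N u g h sS _ IH fM; have [inj_u sg ex] := h.
have fN := fg_surj sg fM.
have fS : finitely_generated S by apply: (finlen_noetherian artin_finlen_regular inj_u fM).
have [E1 [j1 [fE1 inj1 iE1]]] := simple_injective fS sS.
have [E2 [j2 [fE2 inj2 iE2]]] := IH fN.
have [k kE] := iE1 _ fN _ _ _ _ h j1.
exists (E1 * E2)%type, (pair_map k (j2 \o g)); split.
- exact: fg_prod.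
- apply: linear_inj => x [k0 /= e].
  have /ex[s sE] : g x = 0 by apply: inj2; rewrite e linear0.
  by rewrite -sE; have -> : s = 0; [apply: inj1; rewrite -kE sE k0 linear0 | rewrite linear0].
by move=> L fL; apply: ext1_prodr; [apply: iE1 | apply: iE2].
Qed.

End ArtinAlgebra.

Section ArtinTheory.
Variable A : pzRingType.
Hypothesis hA : artin_algebra A.

Lemma artin_finlen : finlen A^o.
Proof. by have [R [f [hR cf gf]]] := hA; apply: artin_finlen_regular hR gf. Qed.

Lemma artin_noetherian : noetherian A.
Proof. exact: finlen_noetherian artin_finlen. Qed.

Lemma fg_finlen (M : lmodType A) : finitely_generated M -> finlen M.
Proof. exact: finlen_fg artin_finlen. Qed.

Lemma hom_fin_artin : hom_fin A.
Proof. by have [R [f [hR cf gf]]] := hA; apply: artin_hom_fin hR cf gf. Qed.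

Lemma enough_inj_artin : enough_inj A.
Proof. by have [R [f [hR cf gf]]] := hA; apply: artin_enough_inj hR cf gf. Qed.

Lemma endring_artin (T : lmodType A) : finitely_generated T -> artin_algebra (endring T).
Proof. by have [R [f [hR cf gf]]] := hA; apply: artin_endring hR cf gf T. Qed.

End ArtinTheory.

(** * Endomorphism rings and basic modules *)

(** Fitting's lemma as a property of a ring: [x ^+ n.+1 * w] is an idempotent that commutes with the
    power, which is invertible on its part and zero on the complementary one. *)
Definition strongly_pi_regular (E : pzRingType) : Prop := forall x : E, exists n (w : E),
  x ^+ n.+1 * w * x ^+ n.+1 = x ^+ n.+1 /\ x ^+ n.+1 * w = w * x ^+ n.+1.

Section Fitting.
Variable A : pzRingType.
Implicit Types K M N W X Y Z : lmodType A.

Lemma endring_mulE M (g h : endring M) x : endring_fun (g * h) x = endring_fun g (endring_fun h x).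
Proof. by []. Qed.

Lemma endring_addE M (g h : endring M) x : endring_fun (g + h) x = endring_fun g x + endring_fun h x.
Proof. by []. Qed.

Lemma endring_oppE M (g : endring M) x : endring_fun (- g) x = - endring_fun g x.
Proof. by []. Qed.

Lemma endring_0E M x : endring_fun (0 : endring M) x = 0.
Proof. by []. Qed.

Definition endring_of M (g : {linear M -> M}) : endring M := g.

Lemma endring_ofE M (g : {linear M -> M}) x : endring_fun (endring_of g) x = g x.
Proof. by []. Qed.

Lemma endringP M (g h : endring M) : (forall x, endring_fun g x = endring_fun h x) -> g = h.
Proof. exact: endring_ext. Qed.

(** The images and the kernels of the powers of [g] stabilize; from the exponent [N] on, [M] is the
    direct sum of the image and the kernel. *)
Lemma fitting M : finlen M -> strongly_pi_regular (endring M).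
Proof.
move=> fM g; pose G n : {linear M -> M} := endring_fun (g ^+ n).
have GD n m x : G (n + m)%N x = G n (G m x) by rewrite /G exprD.
have [||_ [n ->] himg] := @min_submod A M (fun S => exists n, S = imgP (G n) (@full A M)) fM.
- by move=> _ [n ->]; apply: submod_img.
- by exists (imgP (G 0%N) (@full A M)), 0%N.
have [||_ [m ->] hker] := @max_submod A M (fun S => exists n, S = fun x => G n x = 0) fM.
- by move=> _ [k ->]; apply: kerP.
- by exists (fun x => G 0%N x = 0), 0%N.
have imgN k l x : (n <= k)%N -> exists y, G k x = G l y.
  move=> nk; have [|||y _ e] := himg (imgP (G (n + l)%N) (@full A M)) _ _ (G k x).
  - by exists (n + l)%N.
  - by move=> _ [y _ <-]; rewrite GD; exists (G l y).
  - by exists (G (k - n)%N x) => //; rewrite -GD subnKC.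
  by exists (G n y); rewrite -GD addnC.
have kerN k l x : (m <= k)%N -> G (k + l)%N x = 0 -> G k x = 0.
  move=> mk h; suff e : G m x = 0 by rewrite -(subnK mk) GD e linear0.
  apply: (hker (fun x => G (k + l)%N x = 0)) => //; first by exists (k + l)%N.
  by move=> y e; rewrite addnC -(subnK mk) addnA GD e linear0.
pose N := (n + m).+1.
have nN : (n <= N)%N by rewrite /N leqW // leq_addr.
have mN : (m <= N)%N by rewrite /N leqW // leq_addl.
have inter x y : x = G N y -> G N x = 0 -> x = 0.
  by move=> -> e; rewrite (kerN N N) // GD.
(* [w] projects onto the image of g^N and there inverts g^N. *)
have [|x z z' [[y zE] e] [[y' zE'] e']|a x x' z z' [[y zE] e] [[y' zE'] e']|w wE] :=
  @linear_graph A M M (fun x z => (exists y, z = G N y) /\ G N (x - G N z) = 0).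
- move=> x; have [y yE] := imgN N (N + N)%N x nN; have [y' yE'] := imgN N (N + N)%N y nN.
  exists (G N y'); split; first by exists y'.
  by rewrite linearB -(GD N N y') -yE' -(GD N N y) -yE subrr.
- apply: subr0_eq; apply: (inter _ (y - y')); first by rewrite linearB zE zE'.
  have : G N (G N (z - z')) = 0.
    move: e e'; rewrite !linearB /= => /subr0_eq <- /subr0_eq <-.
    by rewrite subrr.
  by rewrite -GD => /(kerN N N _ mN).
- split; first by exists (a *: y + y'); rewrite linearP zE zE'.
  rewrite linearP opprD addrACA -scalerBr linearP e e' scaler0 addr0 //.
exists (n + m)%N, (endring_of w); rewrite -/N; split; apply: endringP => x.
  rewrite !endring_mulE -/(G N) endring_ofE; have [[y wy] e] := wE (G N x).
  apply/esym/subr0_eq; apply: (inter _ (x - w (G N x))) => //.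
  by rewrite linearB.
rewrite !endring_mulE -/(G N) !endring_ofE; have [[y wy] e] := wE x.
have [[y' wy'] e'] := wE (G N x).
apply: subr0_eq; apply: (inter _ (w x - y')); first by rewrite linearB wy'.
have : G N (G N (G N (w x) - w (G N x))) = 0.
  rewrite !linearB /=; move: e e'; rewrite !linearB /= => /subr0_eq e /subr0_eq <-.
  by rewrite -e subrr.
by rewrite -GD => /(kerN N N _ mN).
Qed.

Lemma idem_retract M (u : {linear M -> M}) : (forall x, u (u x) = u x) ->
  exists N (i : {linear N -> M}) (p : {linear M -> N}),
  (forall x, p (i x) = x) /\ forall x, i (p x) = u x.
Proof.
move=> uu; have [N [p [i [sp inj_i pE]]]] := image_fact u; exists N, i, p; split=> // x.
by have [y <-] := sp x; apply: inj_i; rewrite !pE uu.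
Qed.

Lemma spr_idem (E : pzRingType) (x w : E) n : x ^+ n.+1 * w * x ^+ n.+1 = x ^+ n.+1 ->
  x ^+ n.+1 * w = w * x ^+ n.+1 -> (x ^+ n.+1 * w) * (x ^+ n.+1 * w) = x ^+ n.+1 * w.
Proof. by move=> e _; rewrite mulrA e. Qed.

Lemma nilpotent_inv (E : pzRingType) (x : E) n : x ^+ n = 0 ->
  exists v, v * (1 - x) = 1 /\ (1 - x) * v = 1.
Proof.
move=> xn; exists (\sum_(i < n) x ^+ i).
have h m : (\sum_(i < m) x ^+ i) * (1 - x) = 1 - x ^+ m /\ (1 - x) * (\sum_(i < m) x ^+ i) = 1 - x ^+ m.
  elim: m => [|m [IH1 IH2]]; first by rewrite big_ord0 mul0r mulr0 expr0 subrr.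
  rewrite big_ord_recr /=; split.
    by rewrite mulrDl IH1 mulrBr mulr1 -exprSr addrA subrK.
  by rewrite mulrDr IH2 [(1 - x) * x ^+ m]mulrBl mul1r -exprS addrA subrK.
by have [-> ->] := h n; rewrite xn subr0.
Qed.

Definition no_common X Y : Prop :=
  forall N, retract N X -> retract N Y -> zero_module N.

(** The Fitting idempotent of [p \o q] factors through [Y], so its image would be a common direct
    summand. *)
Lemma no_common_nilpotent Z Y (p : {linear Y -> Z}) (q : {linear Z -> Y}) :
  finlen Z -> no_common Z Y -> exists n, endring_of (p \o q) ^+ n = 0.
Proof.
move=> fZ nc; pose g := endring_of (p \o q); have [n [w [e c]]] := fitting fZ g.
exists n.+1; have uu := spr_idem e c; set u := g ^+ n.+1 * w in uu.
have [|N [i [r [ri ir]]]] := @idem_retract Z (endring_fun u).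
  by move=> x; rewrite -endring_mulE uu.
have N0 : zero_module N.
  apply: nc; first by exists i, r.
  exists (q \o endring_fun (g ^+ n * w) \o i), (r \o p) => x /=.
  have -> : p (q (endring_fun (g ^+ n * w) (i x))) = endring_fun u (i x).
    by rewrite /u exprS -mulrA.
  by rewrite -ir ri ri.
have u0 : u = 0 by apply: endringP => x; rewrite -ir (N0 (r x)) linear0.
by rewrite -e -/u u0 mul0r.
Qed.

Definition invertible M (s : {linear M -> M}) : Prop :=
  exists v : {linear M -> M}, (forall x, v (s x) = x) /\ (forall x, s (v x) = x).

(* Jacobson-radical argument: maps Z -> Y -> Z lie in the radical of End(Z) when Z and Y have no
   common direct summand. *)
Lemma no_common_invertible Z Y k (p : 'I_k -> {linear Y -> Z}) (q : 'I_k -> {linear Z -> Y})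
  (s : {linear Z -> Z}) : finlen Z -> no_common Z Y ->
  (forall x, x = s x + \sum_i p i (q i x)) -> invertible s.
Proof.
move=> fZ nc; elim: k p q s => [|k IH] p q s h.
  by exists idfun; split=> x /=; have := h x; rewrite big_ord0 addr0 => <-.
have [|v [vt tv]] := IH (fun i => p (lift ord0 i)) (fun i => q (lift ord0 i)) (s \+ (p ord0 \o q ord0)).
  by move=> x; rewrite {1}(h x) big_ord_recl /= addrA.
pose p' : {linear Y -> Z} := v \o p ord0.
have [n gn] := no_common_nilpotent p' (q ord0) fZ nc.
have [w [w1 w2]] := nilpotent_inv gn.
have sE x : s x = (s x + p ord0 (q ord0 x)) - p ord0 (q ord0 x) by rewrite addrK.
have key x : v (s x) = endring_fun (1 - endring_of (p' \o q ord0)) x.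
  by rewrite sE linearB (vt x).
exists (endring_fun w \o v); split=> x /=.
  by rewrite key -endring_mulE w1.
have inj_v : injective v by apply: (can_inj tv).
by apply: inj_v; rewrite key -endring_mulE w2.
Qed.

(** The form of [basic_module] that speaks of all summands instead of indecomposable ones; for
    modules of finite length both amount to [no_matrix_units] of the endomorphism ring. *)
Definition basicm M : Prop := forall N, retract (N * N)%type M -> zero_module N.

Lemma len_proper K X (i : {linear K -> X}) n : injective i -> ~ surj i ->
  len_le (@is0 A X) n (@full A X) ->
  if n is n'.+1 then len_le (@is0 A K) n' (@full A K) else False.
Proof.
move=> inj_i /existsNP[x nx] h.
have hI : submodP (imgP i (@full A K)) by apply: submod_img.
have h0 : subP (@is0 A X) (imgP i (@full A K)) by move=> y ->; case: hI.
have hx : exists2 x, full x & ~ imgP i (@full A K) x.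
  by exists x => // -[y _ yx]; apply: nx; exists y.
case: n h => [|n] h; have := h _ hI h0 (fun _ _ => I) hx => // h'.
apply: (@len_le_of_img _ _ _ i) => //; first by move=> y _ e; apply: inj_i; rewrite linear0.
by apply: len_le_base h' => y ->; exists 0; rewrite ?linear0.
Qed.

Lemma retract_lr X Y M : module_iso (X * Y)%type M -> retract X M /\ retract Y M.
Proof.
move=> /module_iso_retract h; split; apply: retract_trans h.
  exact: retract_l.
exact: retract_r.
Qed.

Lemma prod_isoA X Y Z : module_iso ((X * Y) * Z)%type (X * (Y * Z))%type.
Proof.
exists (pair_map (fst_map X Y \o fst_map _ Z) (pair_map (snd_map X Y \o fst_map _ Z) (snd_map _ Z))).
by exists (fun x => ((x.1, x.2.1), x.2.2)) => [[[x y] z]|[x [y z]]].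
Qed.

Lemma prod_iso X Y X' Y' : module_iso X X' -> module_iso Y Y' ->
  module_iso (X * Y)%type (X' * Y')%type.
Proof.
move=> /module_iso_inv[f [g [fg gf]]] /module_iso_inv[h [k [hk kh]]].
exists (prod_map f h); exists (fun x => (g x.1, k x.2)) => -[x y] /=; first by rewrite fg hk.
by rewrite gf kh.
Qed.

Lemma module_iso_refl X : module_iso X X.
Proof. by exists idfun; exists id. Qed.

Lemma ffun_components X Y k (u : {linear {ffun 'I_k -> X} -> Y}) :
  exists v : 'I_k -> {linear X -> Y}, forall z, u z = \sum_l v l (z l).
Proof.
have delta_lin j : linear (fun y : X => [ffun l => if l == j then y else 0] : {ffun 'I_k -> X}).
  by move=> c x y; apply/ffunP => l; rewrite !ffunE; case: eqP => //; rewrite scaler0 addr0.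
exists (fun j => u \o mklin (delta_lin j)) => z.
transitivity (u (\sum_j mklin (delta_lin j) (z j))); last by rewrite linear_sum.
congr (u _); apply/ffunP => l; rewrite sum_ffunE (bigD1 l) //= ffunE eqxx big1 ?addr0 // => j jl.
by rewrite ffunE eq_sym (negbTE jl).
Qed.

Lemma ffun_eval X Y k (u : {linear Y -> {ffun 'I_k -> X}}) :
  exists v : 'I_k -> {linear Y -> X}, forall y l, u y l = v l y.
Proof.
have ev_lin l : linear (fun y => u y l) by move=> c x y; rewrite linearP !ffunE.
by exists (fun l => mklin (ev_lin l)).
Qed.

Lemma in_add_split X Y W Z : module_iso (X * Y)%type W -> in_add W Z ->
  exists k (p : 'I_k -> {linear X -> Z}) (q : 'I_k -> {linear Z -> X})
    (p' : 'I_k -> {linear Y -> Z}) (q' : 'I_k -> {linear Z -> Y}),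
  forall x, x = \sum_j p j (q j x) + \sum_j p' j (q' j x).
Proof.
move=> /module_iso_inv[f [g [fg gf]]] /in_addP[k [i [p ip]]].
have [v vE] := ffun_components p; have [w wE] := ffun_eval i.
exists k, (fun j => v j \o f \o inl_map X Y), (fun j => fst_map X Y \o g \o w j).
exists (fun j => v j \o f \o inr_map X Y), (fun j => snd_map X Y \o g \o w j) => x.
rewrite -big_split -[LHS]ip vE; apply: eq_bigr => j _ /=.
rewrite -!linearD wE -[w j x in LHS]gf; congr (v j (f _)).
by case: (g _) => y z; apply/pair_equal_spec; rewrite /= addr0 add0r.
Qed.

Lemma sum_linear X Z k (p : 'I_k -> {linear X -> Z}) (q : 'I_k -> {linear Z -> X}) :
  linear (fun x => \sum_j p j (q j x)).
Proof.
move=> c x y; rewrite scaler_sumr -big_split; apply: eq_bigr => j _.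
by rewrite linearP linearP.
Qed.

(** A substitute for Krull-Schmidt. Split off a common summand [X] with complements [Z] in [W] and
    [Z'] in [W'], the length bound of [Z] being least, so that nothing common is left. The identity
    of [Z] is a sum of maps through [X] and through [Z']; the second part is radical, so the first
    is invertible. As [W] is basic, [Z] has no summand in common with [X] either, so the first part
    is radical too and [Z = 0]. *)
Lemma basic_retract W W' : finlen W -> basicm W -> in_add W' W -> retract W W'.
Proof.
move=> fW bW hW.
have [|n [X [Z [Z' [iW iW' hn]]]] hmin] := @nat_min (fun n => exists X Z Z',
    [/\ module_iso (X * Z)%type W, module_iso (X * Z')%type W' & len_le (@is0 A Z) n (@full A Z)]).
  have [n hn] := fW; have z0 Y : module_iso (zero_mod A * Y)%type Y.
    exists (snd_map _ _); exists (fun y => (0, y)) => // -[x y] /=.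
    by congr pair; rewrite (zero_modP x).
  by exists n, (zero_mod A), W, W'; split.
have [rX rZ] := retract_lr iW.
have fZ : finlen Z by have [a [b ba]] := rZ; apply: (finlen_sub (can_inj ba)).
have nc : no_common Z Z'.
  move=> N /retract_iso[Z1 i1] /retract_iso[Z1' i1'].
  apply: contrapT => nN.
  have [u [v [uv vu]]] := module_iso_inv i1.
  have inj1 : injective (u \o inr_map N Z1) by move=> x y /= /(congr1 v); rewrite !uv => -[].
  have ns : ~ surj (u \o inr_map N Z1).
    move=> s; apply: nN => x; have [y] := s (u (x, 0)).
    by move=> /(congr1 v); rewrite /= !uv => -[].
  have := len_proper inj1 ns hn; case: n hn hmin => // n hn hmin hn'.
  have /hmin : exists X Z Z', [/\ module_iso (X * Z)%type W, module_iso (X * Z')%type W' &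
      len_le (@is0 A Z) n (@full A Z)].
    exists (X * N)%type, Z1, Z1'; split=> //.
      apply: module_iso_trans iW; apply: module_iso_trans (prod_isoA _ _ _) _.
      exact: prod_iso (module_iso_refl X) i1.
    apply: module_iso_trans iW'; apply: module_iso_trans (prod_isoA _ _ _) _.
    exact: prod_iso (module_iso_refl X) i1'.
  by rewrite ltnn.
have [k [P1 [Q1 [P2 [Q2 sum12]]]]] := in_add_split iW' (in_add_retract rZ hW).
have [v [vs sv]] := @no_common_invertible Z Z' k P2 Q2 (mklin (sum_linear P1 Q1)) fZ nc sum12.
suff Z0 : zero_module Z.
  have [rX' _] := retract_lr iW'; apply: retract_trans rX'.
  have [u [w [uw wu]]] := module_iso_inv iW.
  exists (fst_map X Z \o w), (u \o inl_map X Z) => x /=.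
  by rewrite -[RHS]wu; congr (u _); case: (w x) => y z; rewrite (Z0 z).
have nc' : no_common Z X.
  move=> N rN rN'; apply: bW; apply: retract_trans (module_iso_retract iW).
  exact: retract_prod.
have [|t [ts st]] := @no_common_invertible Z X k (fun j => v \o P1 j) Q1 (zero_map Z Z) fZ nc'.
  by move=> x; rewrite /= add0r -[LHS]vs /= linear_sum.
by move=> x; rewrite -(ts x) /= linear0.
Qed.

(* Nonzero such [a], [b] would be the matrix units e_12, e_21 of a 2 x 2 matrix ring. *)
Definition no_matrix_units (E : pzRingType) : Prop :=
  forall a b : E, a * b * a = a -> b * a * b = b -> a * a = 0 -> b * b = 0 -> a = 0.

(** This moves basicness from modules to rings, in a form that passes to corners and to converse
    rings. *)
Lemma basicm_nmu M : basicm M <-> no_matrix_units (endring M).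
Proof.
split=> [bM a b aba bab aa bb|h N [i [p ip]]].
  have baba : (b * a) * (b * a) = b * a by rewrite mulrA bab.
  have [|N [i [p [ip pi]]]] := @idem_retract M (endring_fun (b * a)).
    by move=> x; rewrite -endring_mulE baba.
  have iE x : i x = endring_fun (b * a) (i x) by rewrite -pi ip.
  have pE x : p x = p (endring_fun (b * a) x) by rewrite -pi ip.
  have N0 : zero_module N.
    apply: bM.
    exists (copair_map i (endring_fun a \o i)), (pair_map p (p \o endring_fun b)) => -[x y] /=.
    rewrite !linearD ip; congr pair.
      rewrite [X in _ + X]pE -endring_mulE -mulrA aa mulr0 endring_0E linear0 addr0 //.
    rewrite {1}iE -endring_mulE mulrA bb mul0r endring_0E linear0 add0r.
    by rewrite -endring_mulE -iE ip.
  have ba0 : b * a = 0 by apply: endringP => x; rewrite -pi (N0 (p x)) linear0.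
  by rewrite -aba -mulrA ba0 mulr0.
pose s1 : {linear (N * N)%type -> (N * N)%type} := inr_map N N \o fst_map N N.
pose s2 : {linear (N * N)%type -> (N * N)%type} := inl_map N N \o snd_map N N.
have a0 : endring_of (i \o s1 \o p) = 0.
  apply: (h _ (endring_of (i \o s2 \o p))); apply: endringP => x;
    rewrite !endring_mulE !endring_ofE /= !ip //=.
  - by rewrite -[RHS](linear0 i).
  - by rewrite -[RHS](linear0 i).
move=> x; have := congr1 (fun g => (p (endring_fun g (i (x, 0)))).2) a0.
by rewrite endring_ofE endring_0E linear0 /= !ip.
Qed.

Lemma indecomposable_summand N : finlen N -> ~ zero_module N ->
  exists X, indecomposable X /\ retract X N.
Proof.
move=> [n0 h0] nN.
have [|n [X [nX rX hX]] hmin] := @nat_min (fun n => exists X,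
    [/\ ~ zero_module X, retract X N & len_le (@is0 A X) n (@full A X)]).
  by exists n0, N; split=> //; apply: retract_refl.
exists X; split=> //; split=> // Y Z iso.
have [Z0|nZ] := pselect (zero_module Z); first by right.
left; apply: contrapT => nY.
have [u [v [uv vu]]] := module_iso_inv iso.
have inj1 : injective (v \o inl_map Y Z) by move=> x y /= /(congr1 u); rewrite !vu => -[].
have ns : ~ surj (v \o inl_map Y Z).
  move=> s; apply: nZ => x; have [y] := s (v (0, x)).
  by move=> /(congr1 u); rewrite /= !vu => -[].
have := len_proper inj1 ns hX; case: n hX hmin => // n hX hmin hn'.
have /hmin : exists X, [/\ ~ zero_module X, retract X N & len_le (@is0 A X) n (@full A X)].
  exists Y; split=> //; apply: retract_trans rX.
  by have [] := retract_lr (module_isoC iso).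
by rewrite ltnn.
Qed.

Lemma basic_moduleP M : finlen M -> basic_module M <-> no_matrix_units (endring M).
Proof.
move=> fM; rewrite -basicm_nmu; split=> [bM N rN|bM X [nX iX] [Y iso]]; last first.
  by apply: nX; apply: bM; have [] := retract_lr (module_isoC iso).
apply: contrapT => nN.
have fN : finlen N.
  have [a [b ba]] := retract_trans (retract_l N N) rN; exact: (finlen_sub (can_inj ba)).
have [X [iX rX]] := indecomposable_summand fN nN.
have /retract_iso[Y iso] : retract (X * X)%type M by apply: retract_trans rN; apply: retract_prod.
by apply: (bM X iX); exists Y; apply: module_isoC.
Qed.

End Fitting.

Section RingFitting.
Variable E : pzRingType.

Definition rmul (x : E) : {linear E^o -> E^o}.
Proof.
by refine (@mklin E E^o E^o (fun y => (y : E) * x) _) => a y z; rewrite mulrDl -mulrA.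
Defined.

Lemma endring_regular (g : endring E^o) (y : E) : endring_fun g y = y * (endring_fun g 1 : E).
Proof. by rewrite -[y in LHS]mulr1 -[_ * 1]/(y *: (1 : E^o)) linearZ. Qed.

Lemma rmulX x n (y : E) : endring_fun (endring_of (rmul x) ^+ n) y = y * x ^+ n.
Proof.
elim: n y => [|n IH] y; first by rewrite !expr0 mulr1.
by rewrite exprSr endring_mulE IH endring_ofE /= -mulrA -exprS.
Qed.

Lemma spr_ring : finlen E^o -> strongly_pi_regular E.
Proof.
move=> /fitting h x; have [n [w [e c]]] := h (endring_of (rmul x)).
exists n, (endring_fun w 1); split.
  have e' := congr1 (fun g => endring_fun g (1 : E^o)) e; cbv beta in e'.
  rewrite !endring_mulE !rmulX !mul1r in e'; rewrite -[RHS]e'.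
  by rewrite [endring_fun w (x ^+ _)]endring_regular.
have c' := congr1 (fun g => endring_fun g (1 : E^o)) c; cbv beta in c'.
by rewrite !endring_mulE !rmulX mul1r [endring_fun w (x ^+ _)]endring_regular in c'; rewrite c'.
Qed.

Lemma jacobson_left_inv (x : E) : jacobson x -> exists v, v * (1 - x) = 1.
Proof.
move=> Jx; apply: contrapT => no.
have hI : left_ideal (fun y => exists v, y = v * (1 - x)).
  split=> [|_ _ [v ->] [w ->]|a _ [v ->]]; first by exists 0; rewrite mul0r.
    by exists (v + w); rewrite mulrDl.
  by exists (a * v); rewrite mulrA.
have [|M [hM IM]] := maximal_left_ideal_exists hI; first by move=> [v e]; apply: no; exists v.
have [[_ MD _] nM1 _] := hM; apply: nM1; rewrite -(subrK x 1); apply: MD; last exact: Jx.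
by apply: IM; exists 1; rewrite mul1r.
Qed.

(** The square-zero element [b] vanishes in every division ring, hence lies in the radical. Then
    [1 - a * b] has a left inverse, and [a * b * a = a] gives [a = 0]. *)
Lemma basic_nmu : basic_ring E -> no_matrix_units E.
Proof.
move=> [n [D [f [hD _ hJ]]]] a b aba bab aa bb.
have sq i (x : D i) : x * x = 0 -> x = 0.
  move=> xx; apply: contrapT => nx; have [_ hinv] := hD i; have [y [_ yx]] := hinv _ nx.
  by apply: nx; rewrite -(mul1r x) -yx -mulrA xx mulr0.
have Jb : jacobson b by apply/hJ => i; apply: sq; rewrite -rmorphM bb rmorph0.
have [_ _ JM] := jacobson_left_ideal E.
have [v vE] := jacobson_left_inv (JM a _ Jb).
by rewrite -[a]mul1r -vE -mulrA mulrBl mul1r aba subrr mulr0.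
Qed.

End RingFitting.

(** * Rings without matrix units are basic *)

Section Basic.
Variable E : pzRingType.
Hypotheses (fE : finlen E^o) (nmu : no_matrix_units E).

(** Take [E u] minimal among the left ideals of such idempotents. The Fitting idempotent [v] of [g]
    is then 0 or [u], because one of [v] and [u - v] still acts nontrivially on [Q]; this is the
    locality of the corner u E u. *)
Lemma primitive_idempotent (Q : lmodType E) (w : E) : w * w = w -> (exists s : Q, w *: s <> 0) ->
  exists u : E, [/\ u * u = u, w * u = u, u * w = u, exists s : Q, u *: s <> 0 &
    forall g, u * g = g -> g * u = g -> (exists n, g ^+ n = 0) \/
      exists h, [/\ u * h = h, h * u = h, g * h = u & h * g = u]].
Proof.
move=> ww wQ.
have [||_ [u [-> uu wu uw uQ]] hmin] := @min_submod E E^o (fun S => exists u : E,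
    [/\ S = cyc (u : E^o), u * u = u, w * u = u, u * w = u & exists s : Q, u *: s <> 0]) fE.
- by move=> _ [u [-> _ _ _ _]]; apply: submod_cyc.
- by exists (cyc (w : E^o)), w.
exists u; split=> // g ug gu.
have [n [w0 [e c]]] := spr_ring fE g.
have vv := spr_idem e c; set N := n.+1 in e c vv.
have gS : g ^+ N = g * g ^+ n by rewrite exprS.
have gSr : g ^+ N = g ^+ n * g by rewrite exprSr.
have uv : u * (g ^+ N * w0) = g ^+ N * w0 by rewrite mulrA gS mulrA ug.
have vu : (g ^+ N * w0) * u = g ^+ N * w0 by rewrite c -mulrA gSr -[_ * g * u]mulrA gu.
have key v : v * v = v -> u * v = v -> v * u = v -> (exists s : Q, v *: s <> 0) -> v = u.
  move=> v2 uv' vu' vQ.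
  have [||a aE] := hmin (cyc (v : E^o)) _ _ u (cyc_refl (u : E^o)).
  - by exists v; split=> //; [rewrite -uv' mulrA wu | rewrite -vu' -mulrA uw].
  - by move=> _ [a ->]; exists (a * v); rewrite /GRing.scale /= -mulrA vu'.
  by rewrite -uv' aE /GRing.scale /= -mulrA v2.
have [v0|vu0] : g ^+ N * w0 = 0 \/ g ^+ N * w0 = u.
- have [vQ|nvQ] := pselect (exists s : Q, (g ^+ N * w0) *: s <> 0); first by right; apply: key.
  left; have e' : u - g ^+ N * w0 = u.
    apply: key.
    + by rewrite mulrBr !mulrBl uu uv vu vv subrr subr0.
    + by rewrite mulrBr uu uv.
    + by rewrite mulrBl uu vu.
    have [s us] := uQ; exists s; rewrite scalerBl.
    have -> : (g ^+ N * w0) *: s = 0 by apply: contrapT => ns; apply: nvQ; exists s.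
    by rewrite subr0.
  by apply/eqP; rewrite -oppr_eq0; apply/eqP; rewrite -[LHS](addKr u) e' addNr.
- by left; exists N; rewrite -e v0 mul0r.
right; pose r := u * (g ^+ n * w0) * u; pose l := u * (w0 * g ^+ n) * u.
have gr : g * r = u by rewrite /r !mulrA gu -gS vu0 uu.
have lg : l * g = u by rewrite /l -mulrA ug -mulrA -mulrA -gSr -c vu0 uu.
have lr : l = r.
  have lu : l * u = l by rewrite /l -!mulrA uu.
  have ur : u * r = r by rewrite /r !mulrA uu.
  by rewrite -lu -gr mulrA lg ur.
exists r; split=> //; last by rewrite -lr.
  by rewrite /r !mulrA uu.
by rewrite /r -!mulrA uu.
Qed.

Lemma nilp_no_rinv (u g h : E) n : u * u = u -> g * u = g -> g ^+ n = 0 -> g * h = u -> u = 0.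
Proof.
move=> uu gu gn gh.
have key m : g ^+ m * u = 0 -> u = 0.
  elim: m => [|m IH]; first by rewrite expr0 mul1r.
  move=> e; apply: IH; have := congr1 (fun x => x * h) e.
  by rewrite mul0r exprSr -[_ * g * u]mulrA gu -mulrA gh.
by apply: (key n); rewrite gn mul0r.
Qed.

(** On the simple module [Q], the quotient of [E] by [M], a primitive idempotent [u] acts as the
    identity, since a second one orthogonal to it would produce matrix units. The claim can then be
    checked in the local ring u E u, where [u * x * u] is nilpotent because [x] kills the class of
    1. *)
Lemma maximal_two_sided (M : E -> Prop) x y : maximal_left_ideal M -> M x -> M (x * y).
Proof.
move=> hM Mx; have [/submodP_left_ideal sM nM1 _] := hM.
have [Q [p [sp pE]]] := coker_exists sM.
have pa (a z : E) : p (a * z) = a *: p z by rewrite -[a * z]/(a *: (z : E^o)) linearZ.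
have simpleQ (s t : Q) : s <> 0 -> exists a, t = a *: s.
  have [z <-] := sp s; have [z' <-] := sp t => nz.
  have nMz : ~ M z by move=> /pE.
  have [b Mb] := maximal_left_ideal_inv hM nMz.
  exists (z' * b); apply: subr0_eq; rewrite -pa -linearB; apply/pE.
  have -> : z' - z' * b * z = z' * (1 - b * z) by rewrite mulrBr mulr1 mulrA.
  exact: (submodPZ (M := E^o)).
have nmul0 (g : E) (s : Q) n : g *: s = s -> g ^+ n = 0 -> s = 0.
  move=> gs gn; have : g ^+ n *: s = s.
    by elim: n {gn} => [|n IH]; rewrite ?expr0 ?scale1r // exprS -scalerA IH.
  by rewrite gn scale0r.
have [||u [uu _ _ [s0 us0] hu]] := @primitive_idempotent Q 1.
- exact: mulr1.
- by exists (p 1); rewrite scale1r => /pE.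
(* Otherwise [1 - u] contains a primitive idempotent [u2] orthogonal to [u]. Simplicity of [Q] gives
   [c] and [d] between the two such that [d * c] fixes a nonzero vector and so is not nilpotent. *)
have corner0 (s : Q) : (1 - u) *: s = 0.
  apply: contrapT => ns.
  have ff : (1 - u) * (1 - u) = 1 - u by rewrite mulrBl mul1r mulrBr mulr1 uu subrr subr0.
  have [|u2 [u22 wu2 u2w [t ut] hu2]] := @primitive_idempotent Q (1 - u) ff; first by exists s.
  have uu2 : u * u2 = 0 by rewrite -wu2 mulrA mulrBr mulr1 uu subrr mul0r.
  have u2u : u2 * u = 0 by rewrite -u2w -mulrA mulrBl mul1r uu subrr mulr0.
  have [c0 c0E] := simpleQ (u *: s0) (u2 *: t) us0.
  have [d0 d0E] := simpleQ (u2 *: t) (u *: s0) ut.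
  pose c := u2 * c0 * u; pose d := u * d0 * u2.
  have cE : c *: (u *: s0) = u2 *: t.
    by rewrite scalerA /c -mulrA uu -!scalerA -c0E scalerA u22.
  have dE : d *: (u2 *: t) = u *: s0.
    by rewrite scalerA /d -mulrA u22 -!scalerA -d0E scalerA uu.
  have udc : u * (d * c) = d * c by rewrite /d !mulrA uu.
  have dcu : d * c * u = d * c by rewrite /c -!mulrA uu.
  have [[n dcn]|[h [uh hu' gh hg]]] := hu (d * c) udc dcu.
    by apply: us0; apply: (nmul0 (d * c) _ n) => //; rewrite -scalerA cE dE.
  have cu : c * u = c by rewrite /c -mulrA uu.
  have u2c : u2 * c = c by rewrite /c !mulrA u22.
  have ud : u * d = d by rewrite /d !mulrA uu.
  have du2 : d * u2 = d by rewrite /d -mulrA u22.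
  (* With [h] the inverse of [d * c] in u E u, the elements [c * h] and [d] are matrix units. *)
  have ch0 : c * h = 0.
    apply: (nmu (b := d)).
    - by rewrite -[c * h * d * _]mulrA [d * (c * h)]mulrA gh -mulrA hu'.
    - by rewrite mulrA gh ud.
    - have hc : h * c = 0 by rewrite -hu' -u2c mulrA -[h * u * u2]mulrA uu2 mulr0 mul0r.
      by rewrite -mulrA [h * (c * h)]mulrA hc mul0r mulr0.
    by rewrite -{1}du2 -{2}ud -mulrA [u2 * _]mulrA u2u mul0r mulr0.
  have u0 : u = 0 by rewrite -gh -mulrA ch0 mulr0.
  by apply: us0; rewrite u0 scale0r.
have us (s : Q) : u *: s = s by apply/esym/subr0_eq; rewrite -{1}(scale1r s) -scalerBl corner0.
have nu : u <> 0 by move=> u0; apply: us0; rewrite u0 scale0r.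
apply/pE; rewrite -[x * y]mulr1 pa -scalerA -pa mulr1.
have px : x *: p 1 = 0 by rewrite -pa mulr1; apply/pE.
pose s := p 1.
have [g gD] : exists g, g = u * x * u by exists (u * x * u).
have [h hD] : exists h, h = u * y * u by exists (u * y * u).
have gE (t : Q) : g *: t = x *: t by rewrite gD -!scalerA !us.
have hE (t : Q) : h *: t = y *: t by rewrite hD -!scalerA !us.
have pyE : p y = y *: s by rewrite -pa mulr1.
rewrite pyE -[x *: _]gE -[y *: _]hE.
have ug : u * g = g by rewrite gD !mulrA uu.
have gu : g * u = g by rewrite gD -!mulrA uu.
have uh : u * h = h by rewrite hD !mulrA uu.
have hu' : h * u = h by rewrite hD -!mulrA uu.
have ns : s <> 0 by move=> /pE.
have [[n gn]|[k [_ _ _ kg]]] := hu g ug gu; last first.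
  by case: ns; rewrite -(us s) -kg -scalerA gE px scaler0.
apply: contrapT => nt.
have [c0 c0E] := simpleQ _ s nt.
have [c cD] : exists c, c = u * c0 * u by exists (u * c0 * u).
have uc : u * c = c by rewrite cD !mulrA uu.
have cu : c * u = c by rewrite cD -!mulrA uu.
have cE : (c * g * h) *: s = s by rewrite cD -!scalerA (us (g *: _)) -c0E us.
(* [c * g * h] fixes [s], so it is invertible in u E u; then [c] is invertible by locality, and the
   nilpotent [g] would have a right inverse. *)
have [||[m cm]|[k [uk ku ck kc]]] := hu (c * g * h).
- by rewrite !mulrA uc.
- by rewrite -mulrA hu'.
- exact/ns/(nmul0 _ _ _ cE cm).
have [[m cm]|[c' [uc' c'u cc' c'c]]] := hu c uc cu.
  by apply: nu; apply: (nilp_no_rinv (h := g * h * k) uu cu cm); rewrite !mulrA.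
apply: nu; apply: (nilp_no_rinv (h := h * k * c) uu gu gn).
have e : c * (g * (h * k * c)) = c by rewrite !mulrA ck uc.
transitivity (c' * (c * (g * (h * k * c)))); last by rewrite e c'c.
by rewrite [RHS]mulrA c'c [RHS]mulrA ug.
Qed.

Section Quotient.
Variables (M : E -> Prop) (Q : lmodType E) (p : {linear E^o -> Q}).
Hypotheses (hM : maximal_left_ideal M) (sp : surj p) (pE : forall x, p x = 0 <-> M x).

Let pa (a z : E) : p (a * z) = a *: p z.
Proof. by rewrite -[a * z]/(a *: (z : E^o)) linearZ. Qed.

Lemma quot_rmul_exists (x : E) : exists h : {linear Q -> Q}, forall y : E, h (p y) = p (y * x).
Proof.
have [|h hE] := @factor_surj _ _ _ _ p (p \o rmul x) sp.
  by move=> y /pE My; apply/pE; apply: maximal_two_sided.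
by exists h => y; rewrite hE.
Qed.

(** Right multiplications act on [Q] because [M] is two-sided; they compose in the opposite order,
    whence the converse ring. *)
Lemma quot_morphism : exists f : {rmorphism E -> (endring Q)^c},
  (forall x y : E, endring_fun (f x) (p y) = p (y * x)).
Proof.
have [h hE] := choice quot_rmul_exists; pose f (x : E) : (endring Q)^c := h x.
have fE' x (y : E) : endring_fun (f x) (p y) = p (y * x) by apply: hE.
have ext (g g' : endring Q) : (forall y : E, endring_fun g (p y) = endring_fun g' (p y)) -> g = g'.
  by move=> e; apply: endringP => q; have [y <-] := sp q.
have gadd : {morph f : x y / x - y}.
  move=> x y; apply: ext => z.
  rewrite -[RHS]/(endring_fun (f x) (p z) - endring_fun (f y) (p z)) !fE'.
  by rewrite mulrBr linearB.
have gmul : monoid_morphism f.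
  split; first by apply: ext => z; rewrite fE' mulr1.
  by move=> x y; apply: ext => z; rewrite fE' mulrA -[RHS]/(endring_fun (f y) (endring_fun (f x) _)) !fE'.
pose G : {rmorphism E -> (endring Q)^c} := HB.pack f (GRing.isZmodMorphism.Build _ _ f gadd)
  (GRing.isMonoidMorphism.Build _ _ f gmul).
by exists G.
Qed.

Lemma quot_division (f : {rmorphism E -> (endring Q)^c}) :
  (forall x y : E, endring_fun (f x) (p y) = p (y * x)) ->
  [/\ division_ring (endring Q)^c, forall d, exists x, f x = d & forall x, f x = 0 <-> M x].
Proof.
move=> fE'; have [[_ _ MM] nM1 _] := hM.
have ext (g g' : endring Q) : (forall y : E, endring_fun g (p y) = endring_fun g' (p y)) -> g = g'.
  by move=> e; apply: endringP => q; have [y <-] := sp q.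
have f0 x : f x = 0 <-> M x.
  split=> [e|Mx]; last by apply: ext => y; rewrite fE'; apply/pE; apply: MM.
  have := fE' x 1; rewrite e mul1r => /esym e'; apply/pE; exact: e'.
have fs d : exists x, f x = d.
  have [z zE] := sp (endring_fun d (p 1)); exists z; apply: ext => y.
  rewrite fE' -[X in endring_fun d (p X)]mulr1 !pa linearZ /=.
  by rewrite -zE.
split=> //; split.
  by move=> e; apply: nM1; apply/f0; rewrite rmorph1.
move=> d; have [x <-] := fs d => nx.
have inv y : ~ M y -> exists b, f b * f y = 1.
  move=> ny; have [b Mb] := maximal_left_ideal_inv hM ny; exists b.
  by move/f0: Mb; rewrite rmorphB rmorph1 rmorphM => /subr0_eq.
have [|b bx] := inv x; first by move/f0.
have [|c cb] := inv b.
  move/f0=> b0; apply: nM1; apply/f0; rewrite rmorph1 -bx b0.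
  exact: mul0r.
have cx : f c = f x by rewrite -[LHS]mulr1 -bx mulrA cb mul1r.
by exists (f b); rewrite bx -{1}cx cb.
Qed.
End Quotient.

(** Finite length makes the radical a finite intersection of maximal left ideals. These are
    two-sided with division rings as quotients, and the Chinese remainder theorem applies. *)
Lemma nmu_basic : basic_ring E.
Proof.
pose F n (M : 'I_n -> E -> Prop) := forall i, maximal_left_ideal (M i).
have [||_ [n [M [MM ->]]] hmin] := @min_submod E E^o (fun S => exists n (M : 'I_n -> E -> Prop),
    F n M /\ S = fun x => forall i, M i x) fE.
- move=> _ [n [M [MM ->]]]; split=> [i|a x y hx hy i].
    by have [/submodP_left_ideal[]] := MM i.
  by have [/submodP_left_ideal[_ h] _ _] := MM i; apply: h; [apply: hx | apply: hy].
- by exists (fun=> forall i : 'I_0, True), 0%N, (fun=> fun=> True); split=> [[]|].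
have MJ x : (forall i, M i x) -> jacobson x.
  move=> hx N hN; pose M' (i : 'I_n.+1) := if unlift ord0 i is Some j then M j else N.
  have h : forall i, M' i x.
    apply: (hmin (fun x => forall i, M' i x)) => //.
      by exists n.+1, M'; split=> // i; rewrite /M'; case: unlift.
    by move=> y hy i; have := hy (lift ord0 i); rewrite /M' liftK.
  by have := h ord0; rewrite /M' unlift_none.
(* With the least possible number of ideals the family is irredundant: for each index some element
   lies in all the other ideals but not in this one. Such elements give the idempotents of the
   product modulo the radical. *)
clear hmin; have [|k [{}M [{}MM {}MJ]] kmin] := @nat_min (fun n => exists M : 'I_n -> E -> Prop,
    F n M /\ forall x, (forall i, M i x) -> jacobson x); first by exists n, M.
have irr i : exists e, ~ M i e /\ forall j, j != i -> M j e.
  apply: contrapT => no; case: k i M MM MJ kmin no => [[]//|k] i M MM MJ kmin no.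
  have /kmin : exists M : 'I_k -> E -> Prop, F k M /\ forall x, (forall i, M i x) -> jacobson x.
    exists (fun j => M (lift i j)); split=> [j|x hx]; first exact: MM.
    apply: MJ => j; have [l ->|->] := unliftP i j; first exact: hx.
    apply: contrapT => nx; apply: no; exists x; split=> // l; rewrite eq_sym => /unlift_some[m -> _].
    exact: hx.
  by rewrite ltnn.
have /choice[Q hQ] (i : 'I_k) : exists Q : lmodType E, exists p : {linear E^o -> Q},
    surj p /\ forall x, p x = 0 <-> M i x.
  by have [/submodP_left_ideal sM _ _] := MM i; apply: coker_exists.
have hf (i : 'I_k) : exists f : {rmorphism E -> (endring (Q i))^c},
    [/\ division_ring (endring (Q i))^c, forall d, exists x, f x = d & forall x, f x = 0 <-> M i x].
  have [p [sp pE]] := hQ i; have [f fE'] := quot_morphism (MM i) sp pE.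
  by exists f; apply: quot_division (MM i) sp pE f fE'.
pose f i := sval (cid (hf i)); pose fP i := svalP (cid (hf i)).
exists k, (fun i => (endring (Q i))^c : pzRingType), f; split.
- by move=> i; have [] := fP i.
- move=> y.
  have /choice[e heij] i : exists e, f i e = 1 /\ forall j, j != i -> f j e = 0.
    have [e [ne he]] := irr i; have [b Mb] := maximal_left_ideal_inv (MM i) ne.
    exists (b * e); split.
      by have [_ _ f0] := fP i; move/f0: Mb; rewrite rmorphB rmorph1 => /subr0_eq.
    move=> j ji; have [_ _ f0] := fP j; apply/f0; have [[_ _ h] _ _] := MM j; apply: h; exact: he.
  have /choice[z zE] i : exists z, f i z = y i by have [_ h _] := fP i.
  exists (\sum_i e i * z i) => i; rewrite rmorph_sum (bigD1 i) //= rmorphM (heij i).1 mul1r zE big1 ?addr0 //.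
  by move=> j ji; rewrite rmorphM (heij j).2 ?mul0r // eq_sym.
move=> a; split=> [fa|Ja i]; last by have [_ _ f0] := fP i; apply/f0; apply: Ja.
by apply: MJ => i; have [_ _ f0] := fP i; apply/f0; apply: fa.
Qed.

End Basic.

(** * Corners *)

(* [theta] identifies the ring [B] with the corner [e A e]; its unit [1] goes to [e]. *)
Record is_corner (A B : pzRingType) (e : A) (theta : B -> A) : Prop := IsCorner {
  corner_idem : e * e = e;
  cornerB : {morph theta : x y / x - y};
  cornerM : {morph theta : x y / x * y};
  corner1 : theta 1 = e;
  corner_inj : injective theta;
  corner_surj : forall a, exists b, theta b = e * a * e }.

Section CornerModule.
Variables (A B : pzRingType) (e : A) (theta : B -> A) (hc : is_corner e theta).

Lemma corner0 : theta 0 = 0.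
Proof. by rewrite -[0 in LHS](subrr 0) (cornerB hc) subrr. Qed.

Lemma cornerD : {morph theta : x y / x + y}.
Proof.
move=> x y; rewrite -[y in LHS]opprK (cornerB hc) -[- y]add0r (cornerB hc) corner0.
by rewrite sub0r opprK.
Qed.

Lemma corner_l b : e * theta b = theta b.
Proof. by rewrite -(corner1 hc) -(cornerM hc) mul1r. Qed.

Lemma corner_r b : theta b * e = theta b.
Proof. by rewrite -(corner1 hc) -(cornerM hc) mulr1. Qed.

Variable M : lmodType A.
Definition fix_pred : {pred M} := fun x => `[< e *: x = x >].

Lemma fix_closed : GRing.zmod_closed fix_pred.
Proof.
split; first by apply/asboolP; rewrite scaler0.
by move=> x y /asboolP ex /asboolP ey; apply/asboolP; rewrite scalerBr ex ey.
Qed.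

(** The subgroup e M, as the elements fixed by [e]; the parameter [h] determines the action of
    [B]. *)
Record fixm (h : is_corner e theta) := Fixm { fixm_val : M; _ : fixm_val \in fix_pred }.
Local Notation fixM := (fixm hc).
HB.instance Definition _ := [isSub for @fixm_val hc].
HB.instance Definition _ := [Choice of fixM by <:].
HB.instance Definition _ := GRing.isZmodClosed.Build M fix_pred fix_closed.
HB.instance Definition _ := [SubChoice_isSubZmodule of fixM by <:].

Lemma fixm_scaleP b (x : fixM) : theta b *: fixm_val x \in fix_pred.
Proof. by apply/asboolP; rewrite scalerA corner_l. Qed.

Definition fixm_scale b (x : fixM) : fixM := Fixm hc (fixm_scaleP b x).

Lemma fixm_eP (x : fixM) : e *: val x = val x.
Proof. by case: x => x /= /asboolP. Qed.

Lemma fixm_scaleA a b x : fixm_scale a (fixm_scale b x) = fixm_scale (a * b) x.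
Proof. by apply: val_inj; rewrite /= scalerA (cornerM hc). Qed.
Lemma fixm_scale1 : left_id 1 fixm_scale.
Proof. by move=> x; apply: val_inj; rewrite /= (corner1 hc) fixm_eP. Qed.
Lemma fixm_scaleDr : right_distributive fixm_scale +%R.
Proof. by move=> a x y; apply: val_inj; rewrite /= scalerDr. Qed.
Lemma fixm_scaleDl x : {morph fixm_scale^~ x : a b / a + b}.
Proof. by move=> a b; apply: val_inj; rewrite /= cornerD scalerDl. Qed.
HB.instance Definition _ := GRing.Zmodule_isLmodule.Build B fixM
  fixm_scaleA fixm_scale1 fixm_scaleDr fixm_scaleDl.

End CornerModule.

Definition Fm (A B : pzRingType) (e : A) (theta : B -> A) (hc : is_corner e theta) (M : lmodType A) :
  lmodType B := fixm M hc.

Section CornerFunctor.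
Variables (A B : pzRingType) (e : A) (theta : B -> A) (hc : is_corner e theta).
Implicit Types K M N P T X Y : lmodType A.
Local Notation F := (Fm hc).

Definition fval M (x : F M) : M := \val (x : fixm M hc).

Lemma fval_inj M : injective (@fval M).
Proof. exact: val_inj. Qed.

Lemma fvalP M (x : F M) : e *: fval x = fval x.
Proof. exact: fixm_eP. Qed.

Lemma fvalZ M b (x : F M) : fval (b *: x) = theta b *: fval x.
Proof. by []. Qed.

Lemma fvalD M (x y : F M) : fval (x + y) = fval x + fval y.
Proof. by []. Qed.

Lemma fval0 M : fval (0 : F M) = 0.
Proof. by []. Qed.

Lemma fval_lin M b (x y : F M) : fval (b *: x + y) = theta b *: fval x + fval y.
Proof. by []. Qed.

Lemma fval_sum M k (G : 'I_k -> F M) : fval (\sum_i G i) = \sum_i fval (G i).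
Proof. by elim/big_rec2 : _ => // i x y _ <-. Qed.

Lemma fval_ex M (x : M) : e *: x = x -> exists y : F M, fval y = x.
Proof.
move=> ex; have h : x \in @fix_pred A e M by apply/asboolP.
by exists (Fixm hc h).
Qed.

Lemma fval_e M (x : M) : exists y : F M, fval y = e *: x.
Proof. by apply: fval_ex; rewrite scalerA (corner_idem hc). Qed.

Lemma Fmap_exists M N (f : {linear M -> N}) :
  exists g : {linear F M -> F N}, forall x, fval (g x) = f (fval x).
Proof.
apply: (@linear_graph B (F M) (F N) (fun x y => fval y = f (fval x))).
- by move=> x; apply: fval_ex; rewrite -linearZ /= fvalP.
- by move=> x y y' e1 e2; apply: fval_inj; rewrite e1 e2.
by move=> a x x' y y' e1 e2; rewrite !fval_lin linearP e1 e2.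
Qed.

Definition Fmap M N (f : {linear M -> N}) : {linear F M -> F N} := sval (cid (Fmap_exists f)).

Lemma FmapE M N (f : {linear M -> N}) x : fval (Fmap f x) = f (fval x).
Proof. exact: (svalP (cid (Fmap_exists f))). Qed.

Lemma F_ses K P M (f : {linear K -> P}) (g : {linear P -> M}) : ses f g -> ses (Fmap f) (Fmap g).
Proof.
move=> [inf sg ex]; split.
- by move=> x y xy; apply/fval_inj/inf; rewrite -!FmapE xy.
- move=> y; have [x xE] := sg (fval y); have [z zE] := fval_e x.
  by exists z; apply: fval_inj; rewrite FmapE zE linearZ /= xE fvalP.
move=> y; split=> [gy|[x <-]]; last first.
  by apply: fval_inj; rewrite !FmapE; apply/ex; exists (fval x).
have /ex[x xE] : g (fval y) = 0 by rewrite -FmapE gy.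
have [z zE] : exists z : F K, fval z = x by apply: fval_ex; apply: inf; rewrite linearZ /= xE fvalP.
by exists z; apply: fval_inj; rewrite FmapE zE.
Qed.

Lemma F_retract X Y : retract X Y -> retract (F X) (F Y).
Proof.
move=> [i [p ip]]; exists (Fmap i), (Fmap p) => x.
by apply: fval_inj; rewrite !FmapE ip.
Qed.

Lemma F_iso X Y : module_iso X Y -> module_iso (F X) (F Y).
Proof.
move=> /module_iso_inv[f [g [fg gf]]]; exists (Fmap f); exists (Fmap g) => x;
  by apply: fval_inj; rewrite !FmapE ?fg ?gf.
Qed.

Lemma F_prod X Y : module_iso (F (X * Y)%type) (F X * F Y)%type.
Proof.
apply: (@iso_of_bij _ _ _ (pair_map (Fmap (fst_map X Y)) (Fmap (snd_map X Y)))).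
  move=> x y [/(congr1 (@fval _)) + /(congr1 (@fval _))]; rewrite !FmapE /= => e1 e2.
  by apply: fval_inj; case: (fval x) (fval y) e1 e2 => a b [c d] /= -> ->.
move=> [x y]; have [|z zE] := @fval_ex (X * Y)%type (fval x, fval y).
  by apply/pair_equal_spec; split; apply: fvalP.
by exists z => /=; congr pair; apply: fval_inj; rewrite FmapE zE.
Qed.

Lemma F_zero X : zero_module X -> zero_module (F X).
Proof. by move=> X0 x; apply: fval_inj; rewrite (X0 (fval x)). Qed.

Lemma F_ffun k X : module_iso (F {ffun 'I_k -> X}) {ffun 'I_k -> F X}.
Proof.
elim: k => [|k IH].
  apply: (@iso_of_bij _ _ _ (zero_map _ _)) => x.
    by move=> y _; rewrite (F_zero (@ffun0_zero _ X) x) [RHS](F_zero (@ffun0_zero _ X)).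
  by exists 0; rewrite [RHS]ffun0_zero.
apply: (module_iso_trans (F_iso (ffunS_iso k X))).
apply: (module_iso_trans (F_prod _ _)).
apply: (module_iso_trans _ (module_isoC (ffunS_iso k (F X)))).
exact: prod_iso (module_iso_refl _) IH.
Qed.

Lemma corner_algebra : artin_algebra A -> exists (R : comPzRingType) (f : {rmorphism R -> A})
    (g : {rmorphism R -> B}),
  [/\ left_artinian R, forall r a, f r * a = a * f r,
      exists (n : nat) (v : 'I_n -> A), forall a, exists c : 'I_n -> R, a = \sum_i f (c i) * v i &
      forall r, theta (g r) = f r * e].
Proof.
move=> [R [f [hR cf [n [v hv]]]]]; exists R, f.
have /choice[g gE] r : exists b, theta b = f r * e.
  have [b bE] := corner_surj hc (f r); exists b; rewrite bE -cf -mulrA.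
  by rewrite (corner_idem hc).
have gadd : {morph g : x y / x - y}.
  by move=> x y; apply: (corner_inj hc); rewrite (cornerB hc) !gE rmorphB mulrBl.
have gmul : monoid_morphism g.
  split; first by apply: (corner_inj hc); rewrite gE rmorph1 mul1r (corner1 hc).
  move=> x y; apply: (corner_inj hc); rewrite (cornerM hc) !gE rmorphM.
  by rewrite [RHS]mulrA -[f x * e * f y]mulrA -(cf y e) mulrA -[RHS]mulrA (corner_idem hc).
pose G : {rmorphism R -> B} := HB.pack g (GRing.isZmodMorphism.Build _ _ g gadd)
  (GRing.isMonoidMorphism.Build _ _ g gmul).
by exists G; split=> //; exists n, v.
Qed.

Lemma fg_F M : artin_algebra A -> finitely_generated M -> finitely_generated (F M).
Proof.
move=> /corner_algebra[R [f [g [hR cf gf gE]]]] fM.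
have [n [w hw]] := res_fg (res_fg_ring gf) fM.
have /choice[z zE] i := fval_e (w i : M).
exists n, z => x; have [c cE] := hw (fval x); exists (fun i => g (c i)).
apply: fval_inj; rewrite -fvalP cE scaler_sumr fval_sum; apply: eq_bigr => i _.
by rewrite -[c i *: w i]/(f (c i) *: (w i : M)) fvalZ zE gE !scalerA -mulrA (corner_idem hc) cf.
Qed.

Lemma corner_algebra_fg (R : comPzRingType) (f : {rmorphism R -> A}) (g : {rmorphism R -> B}) :
  (forall r a, f r * a = a * f r) ->
  (exists (n : nat) (v : 'I_n -> A), forall a, exists c : 'I_n -> R, a = \sum_i f (c i) * v i) ->
  (forall r, theta (g r) = f r * e) ->
  (forall r b, g r * b = b * g r) /\
  exists (n : nat) (v : 'I_n -> B), forall b, exists c : 'I_n -> R, b = \sum_i g (c i) * v i.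
Proof.
move=> cf [n [v hv]] gE; split.
  move=> r a; apply: (corner_inj hc); rewrite !(cornerM hc) gE.
  by rewrite -mulrA (corner_l hc) mulrA -cf -mulrA (corner_r hc).
have /choice[w wE] i := corner_surj hc (v i).
exists n, w => a; have [c cE] := hv (theta a); exists c; apply: (corner_inj hc).
have theta_sum k (G : 'I_k -> B) : theta (\sum_i G i) = \sum_i theta (G i).
  elim/big_rec2 : _ => [|i x y _ <-]; first exact: (corner0 hc).
  exact: (cornerD hc).
rewrite -[LHS](corner_r hc) -[X in X * e](corner_l hc) cE mulr_sumr mulr_suml theta_sum.
apply: eq_bigr => i _; rewrite (cornerM hc) gE wE.
by rewrite -!mulrA [e * (e * _)]mulrA (corner_idem hc) !mulrA -cf.
Qed.

Lemma artin_corner : artin_algebra A -> artin_algebra B.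
Proof.
move=> /corner_algebra[R [f [g [hR cf gf gE]]]]; exists R, g.
by have [] := corner_algebra_fg cf gf gE.
Qed.

Lemma nmu_corner : no_matrix_units A -> no_matrix_units B.
Proof.
move=> h a b e1 e2 e3 e4; apply: (corner_inj hc); rewrite (corner0 hc).
by apply: (h _ (theta b)); rewrite -!(cornerM hc) ?e1 ?e2 ?e3 ?e4 ?(corner0 hc).
Qed.

Definition killed M : Prop := forall x : M, e *: x = 0.
(** The premise says that [e] kills the whole submodule generated by [x]. *)
Definition torsion_free M : Prop := forall x : M, (forall a, (e * a) *: x = 0) -> x = 0.

Lemma killed_sub K P (f : {linear K -> P}) : injective f -> killed P -> killed K.
Proof. by move=> inf kP x; apply: inf; rewrite linearZ linear0 /= kP. Qed.

Lemma killed_surj P M (g : {linear P -> M}) : surj g -> killed P -> killed M.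
Proof. by move=> sg kP y; have [x <-] := sg y; rewrite -linearZ kP linear0. Qed.

Lemma killed_pfin M : (forall S, simple S -> killed S -> pfin S) -> finlen M -> killed M -> pfin M.
Proof.
move=> hS fM; apply: (finlen_ind (C := fun M => killed M -> pfin M)) fM => {M}.
  by move=> M M0 _; apply: pfin_zero.
move=> S M N f g h sS fM IH kM; have [inf sg _] := h.
apply: (pfin_mid h); last exact: IH (killed_surj sg kM).
exact: hS (killed_sub inf kM).
Qed.

Section Artin.
Hypothesis hA : artin_algebra A.
Let noe := artin_noetherian hA.
Hypothesis C1 : forall M, finitely_generated M -> killed M -> pfin M.

Lemma simple_fg (S : lmodType A) : simple S -> finitely_generated S.
Proof.
move=> [/existsNP[x nx] hS]; exists 1%N, (fun=> x) => y; have [a ->] := hS x y nx.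
by exists (fun=> a); rewrite big_ord1.
Qed.

Lemma simple_quotients_bound X : finlen X -> killed X ->
  exists c, forall (S : lmodType A) (g : {linear X -> S}), simple S -> surj g -> pdle c S.
Proof.
move=> fX; move: X fX; apply: finlen_ind.
  move=> X X0 _; exists 0%N => S g [nS _] sg; case: nS => y.
  by have [x <-] := sg y; rewrite (X0 x) linear0.
move=> S1 X N f g h sS1 fX IH kX; have [inf sg ex] := h.
have [c hc1] := IH (killed_surj sg kX).
have [_ [c1 hc2]] := C1 (simple_fg sS1) (killed_sub inf kX).
exists (c + c1)%N => S u sS su.
have [u0|/existsNP[x nx]] := pselect (forall x, u (f x) = 0).
  have [|v vE] := @factor_surj _ _ _ _ g u sg; first by move=> x /ex[y <-].
  apply: (pdle_leq (leq_addr _ _)); apply: (hc1 S v) => // y.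
  by have [x <-] := su y; exists (g x).
apply: (pdle_leq (leq_addl _ _)); apply: pdle_iso hc2.
apply: (@iso_of_bij _ _ _ (u \o f)).
  apply: linear_inj => y uy; apply: contrapT => ny.
  have [_ hS1] := sS1; have [a aE] := hS1 y x ny.
  by apply: nx; rewrite aE !linearZ /= [u _]uy scaler0.
move=> y; have [_ hS] := sS; have [a ->] := hS _ y nx.
by exists (a *: x); rewrite !linearZ.
Qed.

(** A simple module killed by [e] is a quotient of A / A e A, which has finite length and so only
    finitely many simple quotients up to isomorphism; the bound passes to extensions. *)
Lemma killed_bound : exists c, forall M, finitely_generated M -> killed M -> pdle c M.
Proof.
pose I (x : A^o) := forall N : A^o -> Prop, submodP N -> (forall a b : A, N (a * e * b)) -> N x.
have hI : submodP I.
  split=> [N [N0 _] _ //|a x y hx hy N hN h]; case: (hN) => _; apply; [exact: hx | exact: hy].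
have [K0 [p [sp pE]]] := coker_exists hI.
have kK0 : killed K0.
  move=> x; have [y <-] := sp x; rewrite -linearZ; apply/pE => N _ h.
  by have := h 1 y; rewrite mul1r.
have [c hc1] := simple_quotients_bound (fg_finlen hA (fg_surj sp (@fg_regular A))) kK0.
exists c => M fM; apply: (finlen_ind (C := fun M => killed M -> pdle c M)) (fg_finlen hA fM) => {M fM}.
  by move=> M M0 _; apply: pdle_zero.
move=> S M N f g h sS fM IH kM.
have [inf sg _] := h; apply: (pdle_mid h); last by apply: IH; apply: killed_surj sg kM.
have kS := killed_sub inf kM.
have [/existsNP[s ns] hS] := sS.
have lin : linear (fun a : A^o => (a : A) *: s : S) by move=> a x y; rewrite scalerDl scalerA.
have [|v vE] := @factor_surj _ _ _ _ p (mklin lin) sp.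
  move=> x /pE hx; apply: (hx (fun x => mklin lin x = 0)); first exact: kerP.
  by move=> a b; rewrite /= -!scalerA kS scaler0.
apply: (hc1 S v sS) => y; have [a ->] := hS s y ns.
by exists (p a); rewrite vE.
Qed.

(* The module (A e)^k, whose image under F is B^k. *)
Lemma Pe_exists k : exists (P : lmodType A) (d : 'I_k -> P) (h : {linear free_mod B k -> F P}),
  [/\ projective P, finitely_generated P, bijective h,
      forall b : free_mod B k, fval (h b) = \sum_i theta (b i : B) *: d i &
      forall M (m : 'I_k -> F M), exists g : {linear P -> M}, forall i, g (d i) = fval (m i)].
Proof.
pose S (v : free_mod A k) := forall i, (v i : A) * e = v i.
have hS : submodP S.
  split=> [i|a v w hv hw i]; first by rewrite ffunE mul0r.
  by rewrite !ffunE mulrDl -mulrA hv hw.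
have [P [j [inj_j jE]]] := ker_exists hS.
have q_lin : linear (fun v : free_mod A k => [ffun i => (v i : A) * e] : free_mod A k).
  by move=> a v w; apply/ffunP => i; rewrite !ffunE mulrDl -mulrA.
have [|r rE] := @factor_inj _ _ _ _ j (mklin q_lin) inj_j.
  by move=> v; apply/jE => i; rewrite /= ffunE -mulrA (corner_idem hc).
have rj x : r (j x) = x.
  apply: inj_j; rewrite rE; apply/ffunP => i; rewrite /= ffunE.
  by have /jE : exists y, j y = j x by exists x.
have pP : projective P by apply: (@projective_retract _ P (free_mod A k)); [exists j, r | apply: projective_free].
pose d i := r [ffun l => (l == i)%:R].
have jd i l : j (d i) l = (l == i)%:R * e :> A by rewrite /d rE /= !ffunE.
have jsum (c : 'I_k -> A) l : j (\sum_i c i *: d i) l = c l * e :> A.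
  rewrite linear_sum sum_ffunE (bigD1 l) //= big1 => [|i il].
    by rewrite addr0 linearZ !ffunE jd eqxx mul1r.
  by rewrite linearZ !ffunE jd eq_sym (negbTE il) mul0r /GRing.scale /= mulr0.
have [|||h hE] := @linear_graph B (free_mod B k) (F P)
    (fun b x => fval x = \sum_i theta (b i : B) *: d i).
- move=> b; apply: fval_ex; rewrite scaler_sumr; apply: eq_bigr => i _.
  by rewrite scalerA (corner_l hc).
- by move=> b x y e1 e2; apply: fval_inj; rewrite e1 e2.
- move=> a b b' x x' e1 e2; rewrite fval_lin e1 e2 scaler_sumr -big_split.
  by apply: eq_bigr => i _; rewrite !ffunE /= (cornerD hc) (cornerM hc) scalerDl scalerA.
exists P, d, h; split=> //.
- apply: fg_surj (fg_free A k); move=> y; exists (j y); exact: rj.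
- have inj_h : injective h.
    apply: linear_inj => b hb; apply/ffunP => i; rewrite ffunE; apply: (corner_inj hc).
    rewrite (corner0 hc) -(corner_r hc) -[LHS](jsum (fun i => theta (b i : B))) -hE hb fval0.
    by rewrite linear0 ffunE.
  have sh : surj h.
    move=> x; have jx i : (j (fval x) i : A) * e = j (fval x) i.
      by move: i; apply/jE; exists (fval x).
    have ejx i : e * (j (fval x) i : A) = j (fval x) i.
      by rewrite -[in RHS](fvalP x) linearZ ffunE.
    have /choice[b bE] i : exists b, theta b = j (fval x) i.
      by have [b bE] := corner_surj hc (j (fval x) i); exists b; rewrite bE ejx jx.
    exists [ffun i => b i]; apply: fval_inj; rewrite hE; apply: inj_j; apply/ffunP => l.
    by rewrite jsum ffunE bE jx.
  have [g hg] := choice sh; exists g => // x; exact: inj_h.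
move=> M m; exists (comb (fun i => fval (m i)) \o j) => i.
rewrite -[LHS]/(comb (fun i => fval (m i)) (j (d i))) combE (bigD1 i) //= jd eqxx mul1r fvalP big1 ?addr0 // => l li.
by rewrite jd (negbTE li) mul0r scale0r.
Qed.
End Artin.
End CornerFunctor.

(** * The corner functor: dimensions, density and fullness *)

Section CornerTheory.
Variables (A B : pzRingType) (e : A) (theta : B -> A) (hc : is_corner e theta).
Implicit Types K M P T X Y : lmodType A.
Local Notation F := (Fm hc).
Hypothesis hA : artin_algebra A.
Let noe := artin_noetherian hA.
Let hB := artin_corner hc hA.
Let noeB := artin_noetherian hB.
Hypothesis C1 : forall M, finitely_generated M -> killed e M -> pfin M.

Lemma F_pdle p n M : pdle p (F A^o) -> finitely_generated M -> pdle n M -> pdle (n + p) (F M).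
Proof.
move=> hp; elim: n M => [|n IH] M fM hM.
  have [k hr] := projective_fg_free (pdle0 hM) fM.
  apply: (pdle_ret (F_retract hc hr)); apply: (pdle_iso (module_isoC (F_ffun hc k A^o))).
  apply: (ffun_class (C := pdle p)) => //.
  - by move=> X Y /module_isoC; apply: pdle_iso.
  - by move=> X; apply: pdle_zero.
  by move=> X Y; apply: pdle_prod.
have /fgP[k [g sg]] := fM; have [K [f h]] := ker_ses sg.
have hF := F_ses hc h; have [inf _ _] := h.
apply: (pdle_right hF).
  by apply: IH; [apply: noe inf (fg_free A k) | apply: pdle_syzygy h (@projective_free A k) hM].
apply: (pdle_iso (module_isoC (F_ffun hc k A^o))).
apply: (ffun_class (C := pdle (n + p).+1)).
- by move=> X Y /module_isoC; apply: pdle_iso.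
- by move=> X; apply: pdle_zero.
- by move=> X Y; apply: pdle_prod.
by apply: pdle_leq hp; rewrite leqW // leq_addl.
Qed.

Lemma F_pfin M : (exists p, pdle p (F A^o)) -> pfin M -> pfin (F M).
Proof.
move=> [p hp] [fM [n hn]]; split; first exact: fg_F.
by exists (n + p)%N; apply: F_pdle.
Qed.

(** The image of [u] contains e M, so the cokernel is killed by [e] and its dimension is at most
    [c]. *)
Lemma pdle_of_image c n P M (u : {linear P -> M}) :
  (forall M, finitely_generated M -> killed e M -> pdle c M) -> finitely_generated M ->
  (forall y, exists x, u x = e *: y) ->
  (forall K (i : {linear K -> P}), (forall x, u x = 0 <-> exists y, i y = x) -> injective i -> pdle (n + c) K) ->
  pdle (n + c).+1 P -> pdle (n + c).+1 M.
Proof.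
move=> hc1 fM cu hK hP; have [I [q [j [sq inj_j jE]]]] := image_fact u.
have [K [i hi]] := ker_ses sq; have [C [r hr]] := coker_ses inj_j.
have [ini _ exi] := hi; have [_ sr exr] := hr.
apply: (pdle_mid hr).
  apply: (pdle_right hi) => //; apply: (hK K i) => // x.
  by rewrite -exi -jE; split=> [e0|->]; [apply: inj_j; rewrite e0 linear0 | rewrite linear0].
apply: (@pdle_leq _ c); first by rewrite leqW // leq_addl.
apply: hc1; first exact: fg_surj sr fM.
move=> x; have [y <-] := sr x; rewrite -linearZ; apply/exr.
by have [z <-] := cu y; exists (q z); rewrite jE.
Qed.

Lemma F_exact K P M (i : {linear K -> P}) (u : {linear P -> M}) : injective i ->
  (forall x, u x = 0 <-> exists y, i y = x) -> (forall y, exists x, u x = e *: y) ->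
  ses (Fmap hc i) (Fmap hc u).
Proof.
move=> inj_i iE cu; split.
- by move=> x y xy; apply: fval_inj; apply: inj_i; rewrite -!FmapE xy.
- move=> y; have [x xE] := cu (fval y); have [z zE] := fval_e hc x.
  by exists z; apply: fval_inj; rewrite FmapE zE linearZ /= xE !fvalP.
move=> y; split=> [uy|[x <-]]; last first.
  by apply: fval_inj; rewrite !FmapE; apply/iE; exists (fval x).
have /iE[x xE] : u (fval y) = 0 by rewrite -FmapE uy.
have [z zE] : exists z : F K, fval z = x.
  by apply: (fval_ex hc); apply: inj_i; rewrite linearZ /= xE fvalP.
by exists z; apply: fval_inj; rewrite FmapE zE.
Qed.

Lemma F_cover M : finitely_generated M -> exists k K P (i : {linear K -> P}) (u : {linear P -> M}),
  [/\ projective P /\ finitely_generated P, module_iso (free_mod B k) (F P), injective i,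
      forall x, u x = 0 <-> exists y, i y = x & forall y, exists x, u x = e *: y].
Proof.
move=> fM; have /fgP[k [g sg]] := fg_F hc hA fM.
have [P [d [h [pP fP bh hE hu]]]] := Pe_exists hc k.
have [u uE] := hu M (fun i => g [ffun j => (j == i)%:R]).
have gu b : fval (g b) = u (fval (h b)).
  rewrite hE linear_sum {1}(free_delta b) linear_sum fval_sum.
  by apply: eq_bigr => i _; rewrite linearZ fvalZ linearZ /= uE.
have [K [i [inj_i iE]]] := ker_exists (kerP u).
exists k, K, P, i, u; split=> //; first by exists h.
move=> y; have [z zE] := fval_e hc y.
by have [b bE] := sg z; exists (fval (h b)); rewrite -gu bE zE.
Qed.

Lemma F_back : exists c, forall n M, finitely_generated M -> pdle n (F M) -> pdle (n + c) M.
Proof.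
have [c hc1] := killed_bound hA C1; exists c.+1.
(* If F M is free, the map from (A e)^k to [M] has kernel and cokernel killed by [e]. The kernel has
   dimension at most [c] and sits one syzygy down, whence the constant [c.+1]. *)
have base M k : module_iso (free_mod B k) (F M) -> finitely_generated M -> pdle c.+1 M.
  move=> /module_iso_inv[g [g' [g'g gg']]] fM; have [P [d [h [pP fP bh hE hu]]]] := Pe_exists hc k.
  have [u uE] := hu M (fun i => g [ffun j => (j == i)%:R]).
  have gu b : fval (g b) = u (fval (h b)).
    rewrite hE linear_sum {1}(free_delta b) linear_sum fval_sum.
    by apply: eq_bigr => i _; rewrite linearZ fvalZ linearZ /= uE.
  apply: (@pdle_of_image c 0 P M u) => //; last exact: pdle_proj.
    move=> y; have [z zE] := fval_e hc y.
    by exists (fval (h (g' z))); rewrite -gu gg' zE.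
  move=> K i iE inj_i; apply: hc1; first exact: noe inj_i fP.
  move=> x; have [z zE] := fval_e hc (i x); have [h' _ hh] := bh.
  have z0 : h' z = 0.
    rewrite -[LHS]g'g (_ : g (h' z) = 0) ?linear0 //.
    by apply: fval_inj; rewrite gu hh zE -linearZ; apply/iE; exists (e *: x).
  by apply: inj_i; rewrite linear0 linearZ /= -zE -(hh z) z0 linear0.
elim=> [|n IH] M fM hM; have [k [K [P [i [u [[pP fP] isoP inj_i iE cu]]]]]] := F_cover fM;
  have hF := F_exact inj_i iE cu; have fK := noe inj_i fP.
  (* F M is only projective here, but F (M * K) is the free module F P, since F K is a complement of
     F M in it. *)
  rewrite add0n; apply: (@pdle_summand _ _ M K); apply: (base _ k); last exact: fg_prod.
  apply: (module_iso_trans isoP); apply: module_isoC.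
  apply: (module_iso_trans (F_prod hc M K)); apply: (module_iso_trans (prod_isoC _ _)).
  exact: projective_iso hF (pdle0 hM).
have pFP : projective (F P) by apply: projective_of_iso (module_isoC isoP) (@projective_free _ k).
have hK : pdle (n + c.+1) K by apply: IH => //; apply: pdle_syzygy hF pFP hM.
rewrite addnS addSn -addnS; have [c' [c'E c'1]] : exists c', (n + c.+1 = n.+1 + c)%N /\ (c' = c)%N.
  by exists c; rewrite addnS addSn.
rewrite c'E in hK *; apply: (@pdle_of_image c n.+1 P M u) => //; last exact: pdle_proj.
move=> K' i' iE' inj_i'; apply: pdle_iso hK.
have [|a aE] := @factor_inj _ _ _ _ i' i inj_i'; first by move=> x; apply/iE'/iE; exists x.
apply: (@iso_of_bij _ _ _ a); first by move=> x y xy; apply: inj_i; rewrite -!aE xy.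
move=> y; have /iE'/iE[x xE] : exists z, i' z = i' y by exists y.
by exists x; apply: inj_i'; rewrite aE.
Qed.

Lemma pfin_F M : finitely_generated M -> pfin (F M) -> pfin M.
Proof.
by move=> fM [_ [n hn]]; split=> //; have [c hF] := F_back; exists (n + c)%N; apply: hF.
Qed.

(** [M] is a quotient of (A e)^k, whose image under F is the free module covering [N]. *)
Lemma F_dense (N : lmodType B) : finitely_generated N ->
  exists K P M (i : {linear K -> P}) (u : {linear P -> M}),
  [/\ ses i u, projective (F P), finitely_generated P, torsion_free e M & module_iso (F M) N].
Proof.
move=> /fgP[k [q sq]]; have [P [d [h [pP fP bh hE hu]]]] := Pe_exists hc k.
have [h' hh' h'h] := bh.
(* The largest submodule of [P] whose image under F is contained in the kernel of [q], transported
   by [h]; its maximality is what makes the quotient torsion-free. *)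
pose S (v : P) := forall a : A, exists b, fval (h b) = (e * a) *: v /\ q b = 0.
have hS : submodP S.
  split=> [a|c v w hv hw a]; first by exists 0; rewrite !linear0 scaler0.
  have [b [bE qb]] := hv (a * c); have [b' [bE' qb']] := hw a.
  exists (b + b'); rewrite !linearD fvalD bE bE' qb qb' addr0; split=> //.
  by rewrite scalerDr scalerA mulrA.
have [M [p [sp pE]]] := coker_exists hS; have [K [i hi]] := ker_ses sp.
exists K, P, M, i, p; split=> //.
- by apply: projective_of_iso (@projective_free _ k); apply: module_isoC; exists h.
- move=> x; have [v <-] := sp x => hx; apply/pE => a.
  have /pE/(_ 1)[b [bE qb]] : p ((e * a) *: v) = 0 by rewrite linearZ; apply: hx.
  by exists b; split=> //; rewrite bE scalerA mulr1 mulrA (corner_idem hc).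
pose r : {linear free_mod B k -> F M} := Fmap hc p \o h.
have rE b : fval (r b) = p (fval (h b)) by rewrite /r /= FmapE.
have sr : surj r.
  move=> x; have [v vE] := sp (fval x); have [z zE] := fval_e hc v.
  exists (h' z); apply: fval_inj; rewrite rE h'h zE linearZ /= vE; exact: fvalP.
have kr b : r b = 0 <-> q b = 0.
  split=> [rb|qb].
    have /pE/(_ 1)[b' [bE' qb']] : p (fval (h b)) = 0 by rewrite -rE rb.
    suff -> : b = b' by [].
    apply: (can_inj hh'); apply: fval_inj; rewrite bE' mulr1; exact/esym/fvalP.
  apply: fval_inj; rewrite rE; apply/pE => a.
  have [c cE] := corner_surj hc a; exists (c *: b); rewrite !linearZ /= qb scaler0; split=> //.
  by rewrite fvalZ cE -scalerA fvalP.
have [|f fE] := @factor_surj _ _ _ _ r q sr; first by move=> b /kr.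
apply: (@iso_of_bij _ _ _ f).
  by apply: linear_inj => x; have [b <-] := sr x; rewrite fE => /kr.
by move=> y; have [b <-] := sq y; exists (r b); rewrite fE.
Qed.

Section FullyFaithful.
Variable T : lmodType A.
Hypotheses (tf : torsion_free e T) (iT : ext_injective T).

Lemma F_faithful M (f g : {linear M -> T}) : (forall x, e *: x = x -> f x = g x) ->
  forall x, f x = g x.
Proof.
move=> h x; apply: subr0_eq; apply: tf => a.
rewrite scalerBr -!linearZ /= -h ?subrr //.
by rewrite scalerA mulrA (corner_idem hc).
Qed.

(** The submodule [G] of [M * T] generated by the graph of [phi] is the graph of a map [f] on a
    submodule of [M] that contains e M. The rest of [M] is killed by [e], and Ext-injectivity of [T]
    extends [f]. *)
Lemma F_full M (phi : {linear F M -> F T}) : finitely_generated M ->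
  exists f : {linear M -> T}, forall x, fval (phi x) = f (fval x).
Proof.
move=> fM; pose G (z : (M * T)%type) := forall N : (M * T)%type -> Prop, submodP N ->
  (forall x, N (fval x, fval (phi x))) -> N z.
have hG : submodP G.
  split=> [N [N0 _] _ //|a z w hz hw N hN h]; case: (hN) => _; apply; [exact: hz | exact: hw].
have Ggen x : G (fval x, fval (phi x)) by move=> N _; apply.
(* Multiplication by [e * a] takes [G] into the graph of [phi]. So if (0, t) is in [G], every
   [(e * a) *: t] vanishes, and [t = 0] as [T] is torsion-free. *)
have Gtor z : G z -> forall a, exists y : F M, (e * a) *: z.1 = fval y /\ (e * a) *: z.2 = fval (phi y).
  move=> Gz; apply: (Gz (fun z => forall a,
    exists y : F M, (e * a) *: z.1 = fval y /\ (e * a) *: z.2 = fval (phi y))).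
    split=> [a|c z1 z2 h1 h2 a]; first by exists 0; rewrite /= !scaler0 linear0.
    have [y1 [e1 e1']] := h1 (a * c); have [y2 [e2 e2']] := h2 a; exists (y1 + y2).
    by rewrite [phi _]linearD !fvalD /= !scalerDr !scalerA -mulrA e1 e1' e2 e2'.
  move=> x a; have [b bE] := corner_surj hc a; exists (b *: x).
  by rewrite linearZ !fvalZ /= bE -!scalerA !fvalP.
pose I x := exists t, G (x, t).
have hI : submodP I.
  split; first by exists 0; case: hG.
  move=> a x y [t ht] [s hs]; exists (a *: t + s).
  by have [_ h] := hG; apply: (h a (x, t) (y, s)).
have [K [i [inj_i iE]]] := ker_exists hI.
have [|||f fE] := @linear_graph A K T (fun x t => G (i x, t)).
- by move=> x; have /iE : exists y, i y = i x by exists x.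
- move=> x t t' h h'; apply: subr0_eq; apply: tf => a.
  have Gd : G (0, t - t').
    have [_ hh] := hG; have := hh (-1) _ _ h' h.
    by congr G; apply/pair_equal_spec; rewrite /= !scaleN1r addNr addrC.
  have [y [e1 ->]] := Gtor _ Gd a.
  have -> : y = 0 by apply: fval_inj; rewrite -e1 scaler0.
  by rewrite linear0.
- move=> a x x' t t' h h'; rewrite linearP; have [_ hh] := hG; exact: hh h h'.
have [C [p hp]] := coker_ses inj_i; have [_ sp exp] := hp.
have pC : pfin C.
  apply: C1; first exact: fg_surj sp fM.
  move=> x; have [y <-] := sp x; rewrite -linearZ; apply/exp/iE.
  have [z zE] := fval_e hc y; exists (fval (phi z)); rewrite -zE; exact: Ggen.
have [g gE] := iT pC hp f; exists g => x.
have /iE[y yE] : I (fval x) by exists (fval (phi x)); apply: Ggen.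
have G1 := fE y; rewrite yE in G1; have G2 := Ggen x.
rewrite -yE gE; apply: subr0_eq; apply: tf => a.
have Gd : G (0, fval (phi x) - f y).
  have [_ hh] := hG; have := hh (-1) _ _ G1 G2.
  by congr G; apply/pair_equal_spec; rewrite /= !scaleN1r addNr addrC.
have [w [e1 ->]] := Gtor _ Gd a.
have -> : w = 0 by apply: fval_inj; rewrite -e1 scaler0.
by rewrite linear0.
Qed.
End FullyFaithful.

End CornerTheory.

(** * Transfer of strong tilting modules *)

Lemma linear_ext (A : pzRingType) (M N : lmodType A) (f g : {linear M -> N}) : f =1 g -> f = g.
Proof.
case: f => f [[hf1] [hf2]]; case: g => g [[hg1] [hg2]] /= /funext eq_fg.
subst g; congr (GRing.Linear.Pack (GRing.Linear.Class _ _)).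
  by congr (GRing.isNmodMorphism.Axioms_ _); apply: Prop_irrelevance.
by congr (GRing.isScalable.Axioms_ _); apply: Prop_irrelevance.
Qed.

Definition homset (A : pzRingType) (M N : lmodType A) : Type := {linear M -> N}.
HB.instance Definition _ (A : pzRingType) (M N : lmodType A) := gen_eqMixin (homset M N).
HB.instance Definition _ (A : pzRingType) (M N : lmodType A) := gen_choiceMixin (homset M N).

Section HomSet.
Variables (A : pzRingType) (M N : lmodType A).
Implicit Types f g h : homset M N.
Definition homset_fun f : {linear M -> N} := f.
Definition homset_zero : homset M N := zero_map M N.
Definition homset_opp f : homset M N := (\- homset_fun f).
Definition homset_add f g : homset M N := (homset_fun f \+ homset_fun g).
Lemma homset_ext f g : homset_fun f =1 homset_fun g -> f = g.
Proof. exact: linear_ext. Qed.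
Lemma homset_addA : associative homset_add.
Proof. by move=> f g h; apply: homset_ext => x /=; rewrite addrA. Qed.
Lemma homset_addC : commutative homset_add.
Proof. by move=> f g; apply: homset_ext => x /=; rewrite addrC. Qed.
Lemma homset_add0 : left_id homset_zero homset_add.
Proof. by move=> f; apply: homset_ext => x /=; rewrite add0r. Qed.
Lemma homset_addN : left_inverse homset_zero homset_opp homset_add.
Proof. by move=> f; apply: homset_ext => x /=; rewrite addNr. Qed.
HB.instance Definition _ := GRing.isZmodule.Build (homset M N)
  homset_addA homset_addC homset_add0 homset_addN.
End HomSet.

(* Hom_A(M, T) as a left module over a ring D acting on T through [rho]. *)
Section HomModule.
Variables (A D : pzRingType) (T : lmodType A) (rho : {rmorphism D -> endring T}) (M : lmodType A).
Definition homm_type of {rmorphism D -> endring T} := fun M : lmodType A => homset M T.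
Local Notation homm := (homm_type rho M).
HB.instance Definition _ := GRing.Zmodule.on homm.
Definition homm_scale (d : D) (f : homm) : homm :=
  (endring_fun (rho d) \o homset_fun f : {linear M -> T}).
Lemma homm_scaleA a b x : homm_scale a (homm_scale b x) = homm_scale (a * b) x.
Proof. by apply: homset_ext => y; rewrite /homm_scale rmorphM. Qed.
Lemma homm_scale1 : left_id 1 homm_scale.
Proof. by move=> x; apply: homset_ext => y; rewrite /homm_scale rmorph1. Qed.
Lemma homm_scaleDr : right_distributive homm_scale +%R.
Proof. by move=> a x y; apply: homset_ext => z; rewrite /homm_scale /= linearD. Qed.
Lemma homm_scaleDl x : {morph homm_scale^~ x : a b / a + b}.
Proof. by move=> a b; apply: homset_ext => z; rewrite /homm_scale rmorphD. Qed.
HB.instance Definition _ := GRing.Zmodule_isLmodule.Build D homm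
  homm_scaleA homm_scale1 homm_scaleDr homm_scaleDl.
End HomModule.

Section HomModuleTheory.
Variables (A D : pzRingType) (T : lmodType A) (rho : {rmorphism D -> endring T}).
Implicit Types K L M N X Y Z : lmodType A.

Definition homm M : lmodType D := homm_type rho M.
Definition hval M (f : homm M) : {linear M -> T} := f.
Definition hmk M (f : {linear M -> T}) : homm M := f.

Lemma hvalZ M d (f : homm M) x : hval (d *: f) x = endring_fun (rho d) (hval f x).
Proof. by []. Qed.
Lemma hvalD M (f g : homm M) x : hval (f + g) x = hval f x + hval g x.
Proof. by []. Qed.
Lemma hval0 M x : hval (0 : homm M) x = 0.
Proof. by []. Qed.
Lemma hmkE M (f : {linear M -> T}) x : hval (hmk f) x = f x.
Proof. by []. Qed.
Lemma hval_ext M (f g : homm M) : (forall x, hval f x = hval g x) -> f = g.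
Proof. exact: homset_ext. Qed.

Definition Hmap M N (u : {linear M -> N}) : {linear homm N -> homm M}.
Proof.
refine (@mklin D (homm N) (homm M) (fun f => hmk (hval f \o u)) _) => a f g.
by apply: hval_ext => x; rewrite hmkE hvalD hvalZ.
Defined.

Arguments Hmap : simpl never.

Lemma HmapE M N (u : {linear M -> N}) f x : hval (Hmap u f) x = hval f (u x).
Proof. by []. Qed.

Lemma H_ses X Y Z (u : {linear X -> Y}) (v : {linear Y -> Z}) :
  ses u v -> ext1 Z T -> ses (Hmap v) (Hmap u).
Proof.
move=> h hZ; have [inu sv ex] := h; split.
- move=> f g fg; apply: hval_ext => z; have [y <-] := sv z.
  by rewrite -!HmapE fg.
- move=> f; have [g gE] := hZ _ _ _ _ h (hval f); exists (hmk g).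
  by apply: hval_ext => x; rewrite HmapE hmkE gE.
move=> f; split=> [uf|[g <-]].
  have [|g gE] := @factor_surj _ _ _ _ v (hval f) sv.
    by move=> y /ex[x <-]; rewrite -HmapE uf.
  by exists (hmk g); apply: hval_ext => y; rewrite HmapE hmkE gE.
apply: hval_ext => x; rewrite !HmapE hval0.
have -> : v (u x) = 0 by apply/ex; exists x.
by rewrite linear0.
Qed.

Lemma H_retract X Y : retract X Y -> retract (homm X) (homm Y).
Proof.
move=> [i [p ip]]; exists (Hmap p), (Hmap i) => f.
by apply: hval_ext => x; rewrite !HmapE ip.
Qed.

Lemma H_prod X Y : module_iso (homm (X * Y)%type) (homm X * homm Y)%type.
Proof.
exists (pair_map (Hmap (inl_map X Y)) (Hmap (inr_map X Y))).
exists (fun fg => hmk (copair_map (hval fg.1) (hval fg.2))) => [f|[f g]].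
  apply: hval_ext => -[x y]; rewrite -[LHS]/(hval f (x, 0) + hval f (0, y)) -linearD; congr (hval f _).
  by apply/pair_equal_spec; rewrite /= addr0 add0r.
by rewrite /=; congr pair; apply: hval_ext => x; rewrite HmapE hmkE /= linear0 ?addr0 ?add0r.
Qed.

Hypothesis rho_bij : bijective rho.

Lemma H_regular : module_iso D^o (homm T).
Proof.
have [r rho_r r_rho] := rho_bij.
have lin : linear (fun d : D^o => hmk (endring_fun (rho d)) : homm T).
  move=> a x y; apply: hval_ext => t; rewrite hmkE hvalD hvalZ !hmkE rmorphD.
  by rewrite -[a *: x]/(a * (x : D)) rmorphM.
by exists (mklin lin); exists r => f; rewrite /= ?rho_r //; apply: hval_ext => x; rewrite hmkE r_rho.
Qed.

Lemma H_projective X : in_add T X -> projective (homm X).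
Proof.
move=> /in_addP[n h]; apply: (projective_retract (H_retract h)).
apply: (ffun_class (C := fun X => projective (homm X))) => [Y Z iso hZ|Y Y0|Y Z hY hZ|].
- exact: projective_retract (H_retract (module_iso_retract iso)) hZ.
- by apply: projective_zero => f; apply: hval_ext => x; rewrite (Y0 x) !linear0.
- by apply: projective_of_iso (H_prod _ _) _; apply: projective_prod.
apply: projective_of_iso (module_isoC H_regular) _.
exact: projective_of_iso (ffun1_iso D^o) (@projective_free D 1).
Qed.

(** Hom(-, T) turns a coresolution in add(T) into a projective resolution over [D]; it stays exact
    because all the cokernels are in [pfin]. *)
Lemma H_pdle n M : pfin T -> ext_injective T -> pfin M -> cores (in_add T) n M -> pdle n (homm M).
Proof.
move=> pT iT; elim: n M => [|n IH] M pM; first by move=> h; apply/pdle_proj/H_projective.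
move=> [X [M' [f [g [h hX hM']]]]].
have pM' : pfin M' by apply: (pfin_right h) => //; apply: pfin_in_add hX pT.
apply: (pdle_step (H_ses h (iT _ pM'))); last exact: IH.
exact: H_projective.
Qed.

End HomModuleTheory.

Lemma stilt_cores (A : pzRingType) (T M : lmodType A) : noetherian A -> stilt T -> pfin M ->
  exists n, cores (in_add T) n M.
Proof.
move=> noe sT pM; have [d hd] := stilt_findim noe sT; have [pT iT _] := sT.
exists d; apply: (cores_embed noe) => //.
- by move=> X hX; split; [apply: pfin_in_add hX pT | apply: ext_injective_in_add hX].
- by move=> X Y; apply: in_add_retract.
by move=> N pN; have [X [C [f [g [[inf _ _] hX _]]]]] := stilt_embed noe sT pN; exists X, f.
Qed.

(** * Both hypotheses for the endomorphism rings *)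

Section NextStage.
Variables (A B : pzRingType) (e : A) (theta : B -> A) (hc : is_corner e theta).
Local Notation F := (Fm hc).
Hypothesis hA : artin_algebra A.
Let noe := artin_noetherian hA.
Let noeB := artin_noetherian (artin_corner hc hA).
Hypothesis C1 : forall M : lmodType A, finitely_generated M -> killed e M -> pfin M.
Hypothesis C2 : exists p, pdle p (F A^o).
Variables (T T' : lmodType A) (i : {linear T' -> T}) (p : {linear T -> T'}).
Hypotheses (pi : forall x, p (i x) = x) (sT : stilt T) (tfT' : torsion_free e T').
Hypothesis tf_embed : forall M : lmodType A, pfin M -> torsion_free e M ->
  exists k (f : {linear M -> {ffun 'I_k -> T'}}), injective f.
Hypothesis sFT' : stilt (F T').
Variables (D DB : pzRingType) (rho : {rmorphism D -> endring T}) (rhoB : {rmorphism DB -> endring (F T')}).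
Hypotheses (rho_bij : bijective rho) (rhoB_bij : bijective rhoB) (hD : artin_algebra D).

Let act (d : D) : {linear T -> T} := endring_fun (rho d).
Let actB (b : DB) : {linear F T' -> F T'} := endring_fun (rhoB b).

Let actD c d x : act (c + d) x = act c x + act d x.
Proof. by rewrite /act rmorphD. Qed.
Let act_sum n (G : 'I_n -> D) x : act (\sum_l G l) x = \sum_l act (G l) x.
Proof. by elim/big_rec2 : _ => [|l y z _ <-]; rewrite ?actD // /act rmorph0. Qed.
Let actBb c d x : act (c - d) x = act c x - act d x.
Proof. by rewrite /act rmorphB. Qed.
Let actM c d x : act (c * d) x = act c (act d x).
Proof. by rewrite /act rmorphM. Qed.
Let act_inj c d : (forall x, act c x = act d x) -> c = d.
Proof. by move=> h; apply: (bij_inj rho_bij); apply: endringP. Qed.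
Let act_surj (f : {linear T -> T}) : exists d, forall x, act d x = f x.
Proof. by have [r _ rK] := rho_bij; exists (r (endring_of f)) => x; rewrite /act rK. Qed.
Let actB_inj c d : (forall x, actB c x = actB d x) -> c = d.
Proof. by move=> h; apply: (bij_inj rhoB_bij); apply: endringP. Qed.
Let actB_surj (f : {linear F T' -> F T'}) : exists d, forall x, actB d x = f x.
Proof. by have [r _ rK] := rhoB_bij; exists (r (endring_of f)) => x; rewrite /actB rK. Qed.

Let iT' : ext_injective T'.
Proof. by have [_ iT _] := sT; move=> M pM; apply: (ext1_retractr (ex_intro _ i (ex_intro _ p pi))); apply: iT. Qed.
Let pT' : pfin T'.
Proof. by have [pT _ _] := sT; apply: pfin_retract pT; exists i, p. Qed.

Let liftT' (phi : {linear F T' -> F T'}) :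
  exists f : {linear T' -> T'}, forall x, fval (phi x) = f (fval x).
Proof. exact: (F_full C1 tfT' iT' phi pT'.1). Qed.

Let faithful (f g : {linear T' -> T'}) : (forall x : F T', f (fval x) = g (fval x)) -> forall x, f x = g x.
Proof.
move=> h; apply: (F_faithful hc tfT') => x ex; have [y <-] := fval_ex hc ex; exact: h.
Qed.

(** [theta' b] is the unique lift of [b] to an endomorphism of [T'], extended by zero on the
    complement of [T'] in [T]. *)
Lemma next_corner : exists (e' : D) (theta' : DB -> D) (h : is_corner e' theta'),
  (forall x, act e' x = i (p x)) /\
  forall b x, fval (actB b x) = p (act (theta' b) (i (fval x))).
Proof.
have [e' eE] := act_surj (i \o p).
have /choice[theta' tE] b : exists d, exists f : {linear T' -> T'},
    (forall x, fval (actB b x) = f (fval x)) /\ forall x, act d x = i (f (p x)).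
  have [f fE] := liftT' (actB b); have [d dE] := act_surj (i \o f \o p).
  by exists d, f.
have h : is_corner e' theta'.
  split.
  - by apply: act_inj => x; rewrite actM !eE /= pi.
  - move=> x y; have [f [fE dE]] := tE (x - y); have [g [gE dE']] := tE x; have [k [kE dE'']] := tE y.
    apply: act_inj => t; rewrite actBb dE dE' dE'' -linearB; congr (i _).
    apply: (faithful (g := g \- k)) => z.
    by rewrite -fE /= -gE -kE /actB rmorphB.
  - move=> x y; have [f [fE dE]] := tE (x * y); have [g [gE dE']] := tE x; have [k [kE dE'']] := tE y.
    apply: act_inj => t; rewrite actM dE dE' dE'' pi; congr (i _).
    apply: (faithful (g := g \o k)) => z.
    by rewrite -fE /= -kE -gE /actB rmorphM.
  - have [f [fE dE]] := tE 1; apply: act_inj => t; rewrite dE eE /=; congr (i _).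
    apply: (faithful (g := idfun)) => z.
    by rewrite -fE /actB rmorph1.
  - move=> x y xy; have [g [gE dE']] := tE x; have [k [kE dE'']] := tE y.
    apply: actB_inj => z; apply: fval_inj; rewrite gE kE.
    have := dE' (i (fval z)); rewrite xy dE'' => /(congr1 p).
    by rewrite !pi.
  move=> d; have [b bE] := actB_surj (Fmap hc (p \o act d \o i)).
  exists b; have [f [fE dE]] := tE b; apply: act_inj => t.
  rewrite dE !actM !eE /=; congr (i _).
  apply: (faithful (g := p \o act d \o i)) => z.
  by rewrite -fE bE FmapE.
exists e', theta', h; split=> // b x; have [f [fE dE]] := tE b.
by rewrite fE dE !pi.
Qed.

Section Properties.
Variables (e' : D) (theta' : DB -> D) (h : is_corner e' theta').
Hypotheses (eE : forall x, act e' x = i (p x))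
  (tE : forall b x, fval (actB b x) = p (act (theta' b) (i (fval x)))).

Lemma next_C2 : exists n, pdle n (Fm h D^o).
Proof.
have [pT iT _] := sT; have pFT : pfin (F T) by apply: F_pfin.
have [n hn] := stilt_cores noeB sFT' pFT; have [pFT' iFT' _] := sFT'.
exists n; apply: pdle_iso (H_pdle rhoB_bij pFT' iFT' pFT hn); apply: module_isoC.
have eM d : e' * (d : D) = d -> forall x, act d x = i (p (act d x)).
  by move=> ed x; rewrite -{1}ed actM eE.
(* The map sends [d] to F (p d). Injectivity is faithfulness of F on maps into [T'], surjectivity
   its fullness. *)
have lin : linear (fun d : Fm h D^o => hmk rhoB (Fmap hc (p \o act (fval d : D)))).
  move=> b x y; apply: hval_ext => z; apply: fval_inj.
  transitivity (fval (actB b (Fmap hc (p \o act (fval x : D)) z)) + fval (Fmap hc (p \o act (fval y : D)) z)); last by [].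
  rewrite hmkE tE !FmapE /= fvalD actD linearD fvalZ; congr (_ + _).
  rewrite -eM; last exact: (fvalP x).
  by rewrite -[_ *: _]/(theta' b * (fval x : D)) actM.
apply: (@iso_of_bij _ _ _ (mklin lin)).
  apply: linear_inj => d /= d0; apply: fval_inj; rewrite fval0; apply: act_inj => t.
  have -> : act 0 t = 0 by rewrite /act rmorph0.
  rewrite eM; last exact: (fvalP d).
  suff z0 : forall x, (p \o act (fval d)) x = zero_map T T' x by rewrite [p _]z0 linear0.
  apply: (F_faithful hc tfT') => x ex; have [y <-] := fval_ex hc ex.
  have := congr1 (fun f => fval (hval f y)) d0.
  by rewrite hmkE hval0 FmapE.
move=> phi; have [f fE] := F_full C1 tfT' iT' (hval phi) pT.1.
have [d dE] := act_surj (i \o f).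
have [|z zE] := @fval_ex D DB e' theta' h D^o d.
  by apply: act_inj => x; rewrite -[_ *: _]/(e' * d) actM eE dE /= pi.
exists z; apply: hval_ext => x; rewrite /= hmkE; apply: fval_inj.
by rewrite FmapE /= zE dE /= pi fE.
Qed.

Let tor (x : T) : Prop := forall a, (e * a) *: x = 0.

Let tor_submod : submodP tor.
Proof.
split=> [a|c x y hx hy a]; first by rewrite scaler0.
by rewrite scalerDr scalerA -mulrA hx hy addr0.
Qed.

(** Such a [d] factors through the quotient [W] of [T] by its torsion part, which embeds into a
    power of [T'] with cokernel in [pfin]. Ext-injectivity of [T] extends the factor to that power,
    so [d] lies in the ideal D e' D. *)
Lemma factor_through (d : D) : (forall x, tor x -> act d x = 0) ->
  exists k (b a : 'I_k -> D), d = \sum_l b l * e' * a l.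
Proof.
move=> hd; have [pT iT _] := sT.
have [U [j [inj_j jE]]] := ker_exists tor_submod.
have [W [q hq]] := coker_ses inj_j; have [_ sq exq] := hq.
have fU : finitely_generated U := noe inj_j pT.1.
have kU : killed e U.
  move=> x; apply: inj_j; rewrite linear0 linearZ /= -[e]mulr1.
  have /jE : exists y, j y = j x by exists x.
  exact.
have pW : pfin W := pfin_right hq (C1 fU kU) pT.
have tfW : torsion_free e W.
  move=> x; have [t <-] := sq x => hx; apply/exq/jE => a.
  have /exq/jE/(_ 1) : q ((e * a) *: t) = 0 by rewrite linearZ; apply: hx.
  by rewrite mulr1 scalerA mulrA (corner_idem hc).
have [k [f inf]] := tf_embed pW tfW.
have [C [g hg]] := coker_ses inf.
have pC : pfin C by apply: (pfin_right hg) => //; apply: pfin_ffun.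
have [|c cE] := @factor_surj _ _ _ _ q (act d) sq.
  by move=> x /exq/jE; apply: hd.
have [m mE] := iT _ pC _ _ _ _ hg c.
have [v vE] := ffun_components m; have [w wE] := ffun_eval f.
have /choice[b bE] l := act_surj (v l \o p).
have /choice[a aE] l := act_surj (i \o w l \o q).
exists k, b, a; apply: act_inj => x.
rewrite -cE -mE vE.
rewrite act_sum; apply: eq_bigr => l _.
by rewrite !actM bE eE aE /= !pi wE.
Qed.

(** Write [Y] as D / I and let [M] be the annihilator of [I] in the torsion part of [T]. Restriction
    to [M] maps [D] onto Hom(M, T) by Ext-injectivity of [T]; once its kernel is shown to be [I], a
    coresolution of [M] in add(T) resolves [Y]. *)
Lemma next_C1_simple (Y : lmodType D) : simple Y -> killed e' Y -> pfin Y.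
Proof.
move=> sY kY; split; first exact: simple_fg.
have [pT iT _] := sT; have [/existsNP[y ny] hY] := sY.
pose I (d : D^o) : Prop := (d : D) *: y = 0.
have hI : submodP I.
  by split=> [|a c d hc' hd]; rewrite /I ?scale0r // scalerDl -[a *: c]/(a * (c : D)) -scalerA hc' hd scaler0 addr0.
pose S x := tor x /\ forall d : D, I d -> act d x = 0.
have hS : submodP S.
  apply: submodI => //; split=> [d _|a u v hu hv d Id]; first by rewrite linear0.
  by rewrite linearP hu // hv // scaler0 addr0.
have [M [m [inj_m mE]]] := ker_exists hS.
have fM : finitely_generated M := noe inj_m pT.1.
have kM : killed e M.
  move=> x; apply: inj_m; rewrite linear0 linearZ /= -[e]mulr1.
  have /mE[t _] : exists y, m y = m x by exists x.
  exact: t.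
have pM : pfin M := C1 fM kM.
have [C [g hg]] := coker_ses inj_m.
have pC : pfin C := pfin_right hg pM pT.
have [n hn] := stilt_cores noe sT pM.
exists n; apply: pdle_iso (H_pdle rho_bij pT iT pM hn).
have lin1 : linear (fun d : D^o => (d : D) *: y) by move=> a u v; rewrite scalerDl scalerA.
have lin2 : linear (fun d : D^o => hmk rho (act d \o m)).
  move=> a u v; apply: hval_ext => x; rewrite hvalD hvalZ !hmkE /=.
  by rewrite actD -[a *: u]/(a * (u : D)) actM.
have [r rE] : exists r : {linear D^o -> homm rho M}, forall d x, hval (r d) x = act d (m x).
  by exists (mklin lin2).
have sr : surj r.
  move=> f; have [k kE] := iT _ pC _ _ _ _ hg (hval f); have [d dE] := act_surj k.
  by exists d; apply: hval_ext => x; rewrite rE dE kE.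
(* If [d] vanishes on [M], then on the torsion part [U] it factors through the map to T^k given by
   generators [c l] of [I]. Extending the factor to T^k shows that [d] agrees on [U] with a
   combination of these generators. *)
have kr d : r d = 0 <-> I d.
  split=> [rd|Id]; last first.
    by apply: hval_ext => x; rewrite rE hval0; have /mE[_] : exists y, m y = m x by [exists x]; apply.
  have dM x : S x -> act d x = 0 by move=> /mE[z <-]; rewrite -rE rd.
  have [K [c0 [inj_c cI]]] := ker_exists hI.
  have [k [c hcc]] := artin_noetherian hD inj_c (@fg_regular D).
  have cI' l : I (c0 (c l)) by apply/cI; exists (c l).
  have [U [j [inj_j jE]]] := ker_exists tor_submod.
  have fU : finitely_generated U := noe inj_j pT.1.
  have kU : killed e U.
    move=> x; apply: inj_j; rewrite linear0 linearZ /= -[e]mulr1.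
    have /jE : exists y, j y = j x by exists x.
    exact.
  have linu : linear (fun x : U => [ffun l => act (c0 (c l)) (j x)] : {ffun 'I_k -> T}).
    by move=> a u v; apply/ffunP => l; rewrite !ffunE !linearP.
  have [X [q [jj [sq inj_jj qE]]]] := image_fact (mklin linu).
  have qE' x l : jj (q x) l = act (c0 (c l)) (j x) by rewrite qE ffunE.
  have [Q [t ht]] := coker_ses inj_jj.
  have pX : pfin X by apply: C1; [apply: fg_surj sq fU | apply: killed_surj sq kU].
  have pQ : pfin Q by apply: (pfin_right ht pX); apply: pfin_ffun.
  have [|psi0 p0E] := @factor_surj _ _ _ _ q (act d \o j) sq.
    move=> x qx; apply: dM; split=> [|d' Id'] /=; first by apply/jE; exists x.
    have /cI[z zE] := Id'; have [cc ccE] := hcc z.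
    rewrite -zE ccE linear_sum /=.
    rewrite act_sum big1 // => l _; rewrite linearZ /= -[_ *: _]/(cc l * (c0 (c l) : D)) actM.
    by rewrite -qE' qx linear0 ffunE linear0.
  have [psi psiE] := iT _ pQ _ _ _ _ ht psi0.
  have [v vE] := ffun_components psi; have /choice[b bE] l := act_surj (v l).
  (* The difference vanishes on the torsion part, hence lies in D e' D, which kills [Y]. *)
  have [k' [b' [a' dE]]] : exists k' (b' a' : 'I_k' -> D),
      d - \sum_l b l * (c0 (c l) : D) = \sum_l b' l * e' * a' l.
    apply: factor_through => x /jE[u <-].
    rewrite actBb act_sum -[act d _]p0E -psiE vE; apply/eqP; rewrite subr_eq0; apply/eqP.
    by apply: eq_bigr => l _; rewrite actM bE qE'.
  rewrite /I -(subrK (\sum_l b l * (c0 (c l) : D)) (d : D)) dE scalerDl !scaler_suml !big1 ?addr0 //.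
    by move=> l _; rewrite -scalerA cI' scaler0.
  by move=> l _; rewrite -!scalerA kY scaler0.
have [|f fE] := @factor_surj _ _ _ _ r (mklin lin1) sr; first by move=> d /kr.
apply: (@iso_of_bij _ _ _ f).
  by apply: linear_inj => x; have [d <-] := sr x; rewrite fE => /kr.
move=> z; have [d ->] := hY y z ny; exists (r d); exact: fE.
Qed.

Lemma next_C1 (Y : lmodType D) : finitely_generated Y -> killed e' Y -> pfin Y.
Proof.
move=> fY; apply: killed_pfin (fg_finlen hD fY); exact: next_C1_simple.
Qed.
End Properties.

Lemma next_stage : exists (e' : D) (theta' : DB -> D) (h : is_corner e' theta'),
  (forall M : lmodType D, finitely_generated M -> killed e' M -> pfin M) /\
  exists n, pdle n (Fm h D^o).
Proof.
have [e' [theta' [h [eE tE]]]] := next_corner; exists e', theta', h; split.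
  by move=> M; apply: next_C1.
exact: next_C2.
Qed.

End NextStage.

(* Hom_B(e A, X) as a left A-module, the action of A coming from right multiplication on e A. *)
Section Coinduced.
Variables (A B : pzRingType) (e : A) (theta : B -> A) (hc : is_corner e theta) (X : lmodType B).
Definition coind_type : Type := homset (Fm hc A^o) X.
Local Notation coind := coind_type.
HB.instance Definition _ := GRing.Zmodule.on coind.
Definition coind_scale (a : A) (f : coind) : coind :=
  (homset_fun f \o Fmap hc (rmul a) : {linear Fm hc A^o -> X}).
Lemma coind_scaleA a b x : coind_scale a (coind_scale b x) = coind_scale (a * b) x.
Proof.
apply: homset_ext => y; rewrite /coind_scale /=; congr (homset_fun x _).
by apply: fval_inj; rewrite !FmapE /= mulrA.
Qed.
Lemma coind_scale1 : left_id 1 coind_scale.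
Proof.
move=> x; apply: homset_ext => y; rewrite /coind_scale /=; congr (homset_fun x _).
by apply: fval_inj; rewrite FmapE /= mulr1.
Qed.
Lemma coind_scaleDr : right_distributive coind_scale +%R.
Proof. by move=> a x y; apply: homset_ext. Qed.
Lemma coind_scaleDl x : {morph coind_scale^~ x : a b / a + b}.
Proof.
move=> a b; apply: homset_ext => y.
rewrite -[RHS]/(homset_fun x (Fmap hc (rmul a) y) + homset_fun x (Fmap hc (rmul b) y)) -linearD.
rewrite /coind_scale /=; congr (homset_fun x _).
by apply: fval_inj; rewrite FmapE fvalD !FmapE /= mulrDr.
Qed.
HB.instance Definition _ := GRing.Zmodule_isLmodule.Build A coind
  coind_scaleA coind_scale1 coind_scaleDr coind_scaleDl.
End Coinduced.

(** * Pullbacks of coinduced modules *)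

Section CoinducedTheory.
Variables (A B : pzRingType) (e : A) (theta : B -> A) (hc : is_corner e theta).
Implicit Types (K M P T : lmodType A) (X Y : lmodType B).
Local Notation F := (Fm hc).
Hypothesis hA : artin_algebra A.
Let noe := artin_noetherian hA.
Let hB := artin_corner hc hA.
Let noeB := artin_noetherian hB.
Hypothesis C1 : forall M, finitely_generated M -> killed e M -> pfin M.
Hypothesis C2 : exists p, pdle p (F A^o).

Definition coind (X : lmodType B) : lmodType A := coind_type hc X.
Definition cval X (f : coind X) : {linear F A^o -> X} := f.
Definition cmk X (f : {linear F A^o -> X}) : coind X := f.

Lemma cvalZ X a (f : coind X) u : cval (a *: f) u = cval f (Fmap hc (rmul a) u).
Proof. by []. Qed.
Lemma cvalD X (f g : coind X) u : cval (f + g) u = cval f u + cval g u.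
Proof. by []. Qed.
Lemma cval0 X u : cval (0 : coind X) u = 0.
Proof. by []. Qed.
Lemma cmkE X (f : {linear F A^o -> X}) u : cval (cmk f) u = f u.
Proof. by []. Qed.
Lemma cval_ext X (f g : coind X) : (forall u, cval f u = cval g u) -> f = g.
Proof. exact: homset_ext. Qed.

Lemma coind_fg X : finitely_generated X -> finitely_generated (coind X).
Proof.
move=> fX; have [R [f [g [hR cf gf gE]]]] := corner_algebra hc hA.
have [cg gg] := corner_algebra_fg hc cf gf gE.
have [m [u hu]] := hom_gen hR cg gg (fg_F hc hA (@fg_regular A)) fX.
exists m, (fun i => cmk (u i)) => v; have [c cE] := hu (cval v).
exists (fun i => f (c i)); apply: cval_ext => x; rewrite cE.
have csum n (G : 'I_n -> coind X) : cval (\sum_i G i) x = \sum_i cval (G i) x.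
  by elim/big_rec2 : _ => // i y z _ <-.
rewrite csum; apply: eq_bigr => i _; rewrite cvalZ cmkE -linearZ; congr (u i _).
apply: fval_inj; rewrite FmapE fvalZ gE /= -cf.
by rewrite -[in RHS](fvalP x) -[_ *: _]/((f (c i) * e) * (fval x : A)) -[e *: _]/(e * (fval x : A)) mulrA.
Qed.

(** The element [e] of e A; evaluation at [eps] is the counit of the adjunction between F and
    coinduction. *)
Let eps : F A^o := sval (cid (@fval_ex A B e theta hc A^o e (corner_idem hc))).
Let epsE : fval eps = e :> A.
Proof. exact: (svalP (cid (@fval_ex A B e theta hc A^o e (corner_idem hc)))). Qed.

Definition actm M (x : M) : {linear A^o -> M}.
Proof. by refine (@mklin A A^o M (fun a => (a : A) *: x) _) => a y z; rewrite scalerDl scalerA. Defined.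

Section Construction.
Variables (E : lmodType A) (X : lmodType B) (q : {linear X -> F E}).

(** The pullback of Hom_B(e A, X) -> Hom_B(e A, F E) along the unit of [E], which sends an element
    to its multiples by e A. *)
Definition coind_pred (z : (coind X * E)%type) : Prop :=
  forall u, fval (q (cval z.1 u)) = (fval u : A) *: z.2.

Lemma coind_submod : submodP coind_pred.
Proof.
split=> [u|a z w hz hw u]; first by rewrite cval0 linear0 scaler0.
rewrite cvalD cvalZ linearD fvalD hz hw FmapE /= scalerDr !scalerA.
by [].
Qed.

Variables (V : lmodType A) (j : {linear V -> (coind X * E)%type}).
Hypotheses (inj_j : injective j) (jE : forall z, coind_pred z <-> exists v, j v = z).

Let jP v u : fval (q (cval (j v).1 u)) = (fval u : A) *: (j v).2.
Proof. by move: u; apply/jE; exists v. Qed.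

(** Together with [coind_map_inv] and [coind_ext] this is the universal property of [V]: a map
    [M -> V] amounts to a map [M -> E] and a lift of its image under F along [q]. *)
Lemma coind_map M (a : {linear M -> E}) (b : {linear F M -> X}) :
  (forall x, fval (q (b x)) = a (fval x)) ->
  exists c : {linear M -> V}, (forall x, (j (c x)).2 = a x) /\
    forall x, cval (j (c (fval x))).1 eps = b x.
Proof.
move=> ab.
have lin : linear (fun x => (cmk (b \o Fmap hc (actm x)), a x) : (coind X * E)%type).
  move=> r x y; apply/pair_equal_spec; split; last exact: linearP.
  apply: cval_ext => u.
  transitivity (b (Fmap hc (actm x) (Fmap hc (rmul r) u)) + b (Fmap hc (actm y) u)); last by [].
  rewrite -linearD -[LHS]/(b (Fmap hc (actm (r *: x + y)) u)); congr (b _).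
  apply: fval_inj; rewrite fvalD !FmapE /= scalerDr scalerA.
  by [].
have [|c cE] := @factor_inj _ _ _ _ j (mklin lin) inj_j.
  move=> x; apply/jE => u; rewrite -[cval _ u]/(b (Fmap hc (actm x) u)) ab FmapE; exact: linearZ.
exists c; split=> x; rewrite cE // -[LHS]/(b (Fmap hc (actm (fval x)) eps)); congr (b _).
apply: fval_inj; rewrite FmapE /= epsE; exact: fvalP.
Qed.

Lemma coind_map_inv M (c : {linear M -> V}) : exists b : {linear F M -> X},
  (forall x, fval (q (b x)) = (j (c (fval x))).2) /\ forall x, b x = cval (j (c (fval x))).1 eps.
Proof.
have lin : linear (fun x : F M => cval (j (c (fval x))).1 eps).
  move=> r x y.
  have -> : (j (c (fval (r *: x + y)))).1 = theta r *: (j (c (fval x))).1 + (j (c (fval y))).1.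
    by rewrite fvalD fvalZ !linearP.
  rewrite cvalD cvalZ; congr (_ + _).
  rewrite -linearZ; congr (cval _ _); apply: fval_inj.
  rewrite FmapE /= epsE fvalZ epsE (corner_l hc) -[_ *: _]/(theta r * e).
  by rewrite (corner_r hc).
exists (mklin lin); split=> // x; rewrite /= jP epsE.
by rewrite -[e *: _]/(snd_map _ _ (e *: j (c (fval x)))) -!linearZ /= fvalP.
Qed.

Lemma coind_ext M (c c' : {linear M -> V}) : (forall x, (j (c x)).2 = (j (c' x)).2) ->
  (forall x : F M, cval (j (c (fval x))).1 eps = cval (j (c' (fval x))).1 eps) ->
  forall x, c x = c' x.
Proof.
have key (d : {linear M -> V}) (x : M) u : cval (j (d x)).1 u =
    cval (j (d (fval (Fmap hc (actm x) u)))).1 eps.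
  rewrite FmapE /= -[u in LHS](_ : Fmap hc (rmul (fval u : A)) eps = u); last first.
    by apply: fval_inj; rewrite FmapE /= epsE; apply: fvalP.
  by rewrite -cvalZ !linearZ.
move=> h2 h1 x; apply: inj_j; rewrite (surjective_pairing (j (c x))) (surjective_pairing (j (c' x))).
rewrite h2; apply/pair_equal_spec; split=> //; apply: cval_ext => u.
rewrite [LHS](key c) [RHS](key c'); exact: h1.
Qed.

(** F takes Hom_B(e A, X) back to [X] and the unit of [E] to an isomorphism, so the pullback becomes
    [X]; the isomorphism is evaluation at [eps]. *)
Lemma coind_F : module_iso (F V) X.
Proof.
have [b [bq bE]] := coind_map_inv (idfun : {linear V -> V}).
apply: (@iso_of_bij _ _ _ b).
  apply: linear_inj => v bv; apply: fval_inj.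
  have v2 : (j (fval v)).2 = 0 by rewrite -bq bv linear0.
  apply: inj_j; rewrite fval0 linear0 (surjective_pairing (j (fval v))) v2; congr pair.
  apply: cval_ext => u; rewrite cval0.
  have -> : cval (j (fval v)).1 u = cval (j (fval v)).1 (Fmap hc (rmul e) u).
    rewrite -cvalZ -[e *: _]/(fst_map _ _ (e *: j (fval v))) -linearZ /=.
    by rewrite fvalP.
  have [r rE] := corner_surj hc (fval u : A).
  have -> : Fmap hc (rmul e) u = r *: eps.
    apply: fval_inj; rewrite FmapE fvalZ rE epsE /= -[in LHS](fvalP u).
    by rewrite -[RHS]/((e * (fval u : A) * e) * e) -[RHS]mulrA (corner_idem hc).
  by rewrite linearZ /= -[cval _ eps]bE bv scaler0.
(* For surjectivity, [x] and [q x] define a map to [V] from [P], a copy of A e with F P free of rank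
   one. *)
move=> x; have [P [d [h [pP fP bh hE hu]]]] := Pe_exists hc 1.
have [a aE] := hu E (fun=> q x).
have [h0 [h' [h'h hh']]] := module_iso_inv (ex_intro _ h bh : module_iso _ _).
have [k hk kh] := bh.
have lin : linear (fun z : F P => (k z ord0 : B) *: x).
  move=> r y z; rewrite scalerA -scalerDl; congr (_ *: _).
  have -> : k (r *: y + z) = r *: k y + k z.
    by apply: (bij_inj bh); rewrite kh linearP !kh.
  by rewrite !ffunE.
have [|c [c2 c1]] := @coind_map P a (mklin lin).
  move=> z; rewrite /= linearZ fvalZ -[in RHS](kh z) hE big_ord1 linearZ aE.
  by [].
have [v vE] : exists v : F V, fval v = c (fval (h [ffun=> 1])).
  by apply: (fval_ex hc); rewrite -linearZ /= fvalP.
exists v; rewrite bE /= vE c1 /= hk ffunE.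
exact: scale1r.
Qed.

Lemma coind_torsion_free : torsion_free e E -> torsion_free e V.
Proof.
move=> tfE v hv; have v2 : (j v).2 = 0.
  apply: tfE => a; rewrite -[_ *: _]/(snd_map _ _ ((e * a) *: j v)) -linearZ hv.
  by rewrite !linear0.
apply: inj_j; rewrite linear0 (surjective_pairing (j v)) v2; congr pair.
apply: cval_ext => u; rewrite cval0.
have -> : u = Fmap hc (rmul (e * (fval u : A))) eps.
  apply: fval_inj; rewrite FmapE /= epsE mulrA (corner_idem hc); exact/esym/fvalP.
rewrite -cvalZ -[_ *: (j v).1]/(fst_map _ _ ((e * (fval u : A)) *: j v)) -linearZ hv.
by rewrite !linear0.
Qed.

Section Extension.
Variables (Y : lmodType B) (i : {linear Y -> X}).
Hypotheses (hq : ses i q) (iY : ext_injective Y) (iE : forall M, finitely_generated M -> ext1 M E).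

Let lift M (a : {linear M -> E}) : pfin M -> exists b : {linear F M -> X}, forall x, fval (q (b x)) = a (fval x).
Proof.
move=> pM; have [b bE] := ext1_lift (Fmap hc a) (iY (F_pfin hA C2 pM)) hq.
by exists b => x; rewrite bE FmapE.
Qed.

(** The component in [E] extends because [E] is injective, and the extension lifts along [q] under
    F. On F K this lift differs from the given map by a map into [Y], which extends because [Y] is
    Ext-injective over [B] and F preserves [pfin]. *)
Lemma coind_ext_injective : ext_injective V.
Proof.
move=> M pM; have [k [K [f [g [hf pK]]]]] := pfin_cover noe pM.
apply: (ext1_cover hf (@projective_free A k)) => c.
have [b [bq bE]] := coind_map_inv c.
have [a aE] := iE pM.1 hf (snd_map _ _ \o j \o c).
have [b0 b0E] := lift a (pfin_free A k).
have [inj_i _ exq] := hq.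
have [|d dE] := @factor_inj _ _ _ _ i (b \- (b0 \o Fmap hc f)) inj_i.
  move=> x; apply/exq; rewrite /= linearB; apply/eqP; rewrite subr_eq0; apply/eqP.
  by apply: fval_inj; rewrite bq b0E FmapE aE.
have [d' d'E] := iY (F_pfin hA C2 pM) (F_ses hc hf) d.
have [|c' [c2 c1]] := @coind_map _ a (b0 \+ (i \o d')).
  move=> x; rewrite /= linearD.
  have -> : q (i (d' x)) = 0 by apply/exq; exists (d' x).
  by rewrite addr0 b0E.
exists c' => x; apply: (coind_ext (c := c' \o f)) x => x; first by rewrite /= c2 aE.
transitivity (cval (j (c' (fval (Fmap hc f x)))).1 eps); first by rewrite FmapE.
by rewrite c1 /= d'E dE /= addrC subrK bE.
Qed.

Lemma coind_embed M (f : {linear M -> E}) : pfin M -> injective f ->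
  exists g : {linear M -> V}, injective g.
Proof.
move=> pM inf; have [b bE] := lift f pM; have [c [c2 _]] := coind_map bE.
by exists c => x y xy; apply: inf; rewrite -!c2 xy.
Qed.
End Extension.

End Construction.

(** It is used with [E] an injective module containing a given one, to embed the latter into an
    Ext-injective module of finite projective dimension, and with [E = 0], to build a torsion-free
    module with prescribed image under F. *)
Lemma coinduced (E : lmodType A) (X Y : lmodType B) (i : {linear Y -> X}) (q : {linear X -> F E}) :
  finitely_generated E -> (forall M, finitely_generated M -> ext1 M E) ->
  ses i q -> pfin X -> ext_injective Y ->
  exists V, [/\ pfin V, ext_injective V, module_iso (F V) X,
    forall M (f : {linear M -> E}), pfin M -> injective f -> exists g : {linear M -> V}, injective g &
    torsion_free e E -> torsion_free e V].
Proof.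
move=> fE iE hq pX iY; have [V [j [inj_j jE]]] := ker_exists (coind_submod q).
have isoF := coind_F inj_j jE.
exists V; split=> //.
- apply: (pfin_F (hc := hc) hA C1); last exact: pfin_iso isoF pX.
  by apply: noe inj_j _; apply: fg_prod => //; apply: coind_fg; case: pX.
- exact: (coind_ext_injective inj_j jE hq iY iE).
- by move=> M f; apply: (coind_embed inj_j jE hq iY).
exact: coind_torsion_free inj_j.
Qed.

End CoinducedTheory.

(** * Existence of basic strong tilting modules *)

Section StrongTilting.
Variable A : pzRingType.
Implicit Types M N T X Y W Z : lmodType A.

Lemma stilt_add T T' : stilt T -> retract T' T -> in_add T' T -> stilt T'.
Proof.
move=> [pT iT [s hs]] rT hT; split; first exact: pfin_retract rT pT.
  by move=> M pM; apply: ext1_retractr rT (iT M pM).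
by exists s; apply: cores_sub hs => X; apply: in_add_trans.
Qed.

Lemma stilt_iso T T' : module_iso T T' -> stilt T -> stilt T'.
Proof.
move=> iso sT; have r := module_iso_retract iso; have r' := module_iso_retract (module_isoC iso).
by apply: stilt_add sT r' _; apply: in_add_of_retract.
Qed.

(** Take a summand [T'] of least length bound with add(T') containing [T]; a repeated summand could
    be dropped once. *)
Lemma stilt_basic T : finlen T -> stilt T -> exists T', stilt T' /\ basicm T'.
Proof.
move=> [n0 h0] sT.
have [|n [T' [rT hT hn]] hmin] := @nat_min (fun n => exists T',
    [/\ retract T' T, in_add T' T & len_le (@is0 A T') n (@full A T')]).
  by exists n0, T; split=> //; [apply: retract_refl | apply: in_add_refl].
exists T'; split; first exact: stilt_add sT rT hT.
move=> N /retract_iso[Y iso]; apply: contrapT => nN.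
have isoN : module_iso (N * (N * Y)%type)%type T' := module_iso_trans (module_isoC (prod_isoA N N Y)) iso.
have [u [v [uv vu]]] := module_iso_inv isoN.
have inj1 : injective (u \o inr_map N (N * Y)%type) by move=> x y /= /(congr1 v); rewrite !uv => /(congr1 snd).
have ns : ~ surj (u \o inr_map N (N * Y)%type).
  move=> s; apply: nN => x; have [y] := s (u (x, 0)).
  by move=> /(congr1 v); rewrite /= !uv => -[].
have := len_proper inj1 ns hn; case: n hn hmin => // n hn hmin hn'.
have [_ rNY] := retract_lr isoN.
have /hmin : exists T', [/\ retract T' T, in_add T' T & len_le (@is0 A T') n (@full A T')].
  exists (N * Y)%type; split=> //; first exact: retract_trans rNY rT.
  apply: in_add_trans hT; apply: (in_add_iso (module_isoC isoN)); apply: in_add_prod.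
    by apply: in_add_of_retract; apply: retract_l.
  exact: in_add_refl.
by rewrite ltnn.
Qed.

Lemma cores_collect Q n M : (forall X Y, Q X -> Q Y -> Q (X * Y)%type) -> cores Q n M ->
  exists T, Q T /\ cores (in_add T) n M.
Proof.
move=> hQ; elim: n M => [|n IH] M /=; first by exists M; split=> //; apply: in_add_refl.
move=> [X [M' [f [g [h QX /IH[T [QT hT]]]]]]]; exists (X * T)%type; split; first exact: hQ.
exists X, M', f, g; split=> //; first by apply: in_add_of_retract; apply: retract_l.
apply: cores_sub hT => Y; apply: in_add_trans.
by apply: in_add_of_retract; apply: retract_r.
Qed.

(** A finite finitistic dimension makes a coresolution of the ring by such embeddings stop; [T] is
    the sum of its terms. *)
Lemma stilt_of_embed (Q : lmodType A -> Prop) : noetherian A ->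
  (forall X, Q X -> pfin X /\ ext_injective X) -> (forall X Y, retract X Y -> Q Y -> Q X) ->
  (forall X Y, Q X -> Q Y -> Q (X * Y)%type) ->
  (forall N, pfin N -> exists X (f : {linear N -> X}), Q X /\ injective f) ->
  (exists d, findim_le A d) -> exists T, Q T /\ stilt T.
Proof.
move=> noe hQ Qr Qp emb [d hd].
have [T [QT hT]] := cores_collect Qp (cores_embed noe hQ Qr emb hd (pfin_regular A)).
by exists T; split=> //; have [pT iT] := hQ _ QT; split=> //; exists d.
Qed.

Lemma endring_iso T T' : module_iso T T' ->
  exists f : {rmorphism endring T -> endring T'}, bijective f.
Proof.
move=> /module_iso_inv[u [v [uv vu]]].
pose f (g : endring T) : endring T' := (u \o endring_fun g \o v : {linear T' -> T'}).
pose f' (g : endring T') : endring T := (v \o endring_fun g \o u : {linear T -> T}).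
have gadd : {morph f : x y / x - y}.
  by move=> x y; apply: endringP => z; rewrite endring_addE endring_oppE /f /endring_fun /= linearB.
have gmul : monoid_morphism f.
  split; first by apply: endringP => z; rewrite /f /endring_fun /= vu.
  by move=> x y; apply: endringP => z; rewrite endring_mulE /f /endring_fun /= uv.
pose G : {rmorphism endring T -> endring T'} := HB.pack f (GRing.isZmodMorphism.Build _ _ f gadd)
  (GRing.isMonoidMorphism.Build _ _ f gmul).
exists G; exists f' => g; apply: endringP => z; rewrite /= /f /f' /endring_fun /=.
  by rewrite !uv.
by rewrite !vu.
Qed.

End StrongTilting.

(** * Passage of strong tilting modules between a ring and its corner *)

Section Transfer.
Variables (A B : pzRingType) (e : A) (theta : B -> A) (hc : is_corner e theta).
Implicit Types M N T W X Z : lmodType A.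
Local Notation F := (Fm hc).
Hypothesis hA : artin_algebra A.
Let noe := artin_noetherian hA.
Let hB := artin_corner hc hA.
Let noeB := artin_noetherian hB.
Hypothesis C1 : forall M, finitely_generated M -> killed e M -> pfin M.
Hypothesis C2 : exists p, pdle p (F A^o).

Lemma torsion_free_sub M N (f : {linear M -> N}) : injective f -> torsion_free e N -> torsion_free e M.
Proof.
move=> inf tfN x hx; apply: inf; rewrite linear0; apply: tfN => a.
by rewrite -linearZ hx linear0.
Qed.

Lemma torsion_free_prod M N : torsion_free e M -> torsion_free e N -> torsion_free e (M * N)%type.
Proof.
move=> hM hN [x y] hxy; apply/pair_equal_spec; split; [apply: hM|apply: hN] => a.
  by have := hxy a => -[].
by have := hxy a => -[].
Qed.

(* T' is the largest torsion-free direct summand of T, and F T' the strong tilting module over B. *)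
Definition tilting_pair T (T' : lmodType A) : Prop :=
  [/\ stilt T, basicm T, retract T' T, torsion_free e T' & stilt (F T')] /\
  forall M : lmodType A, pfin M -> torsion_free e M ->
    exists k (f : {linear M -> {ffun 'I_k -> T'}}), injective f.

Section Descend.
Variable T : lmodType A.
Hypotheses (sT : stilt T) (bT : basicm T).
Let fT : finlen T.
Proof. by have [[h _] _ _] := sT; apply: fg_finlen. Qed.

(** [X] is a torsion-free summand whose complement [Z] has the least length bound, so a torsion-free
    [W] shares no summand with [Z]. If [W] is in add(T), the part of its identity that passes
    through [Z] is radical, and the part through [X] is invertible. *)
Lemma torsion_free_summand : exists T', [/\ retract T' T, torsion_free e T' &
  forall W, finlen W -> torsion_free e W -> in_add T W -> in_add T' W].
Proof.
have [|n [X [Z [iX tX hn]]] hmin] := @nat_min (fun n => exists X Z,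
    [/\ module_iso (X * Z)%type T, torsion_free e X & len_le (@is0 A Z) n (@full A Z)]).
  have [n hn] := fT; exists n, (zero_mod A), T; split=> //.
    exists (snd_map _ _); exists (fun y => (0, y)) => // -[x y] /=.
    by congr pair; rewrite (zero_modP x).
  by move=> x _; apply: zero_modP.
have [rX rZ] := retract_lr iX; exists X; split=> // W fW tW hW.
have nc : no_common W Z.
  move=> N [i [p ip]] /retract_iso[Z1 i1]; apply: contrapT => nN.
  have [u [v [uv vu]]] := module_iso_inv i1.
  have inj1 : injective (u \o inr_map N Z1) by move=> x y /= /(congr1 v); rewrite !uv => -[].
  have ns : ~ surj (u \o inr_map N Z1).
    move=> s; apply: nN => x; have [y] := s (u (x, 0)).
    by move=> /(congr1 v); rewrite /= !uv => -[].
  have := len_proper inj1 ns hn; case: n hn hmin => // n hn hmin hn'.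
  have /hmin : exists X Z, [/\ module_iso (X * Z)%type T, torsion_free e X &
      len_le (@is0 A Z) n (@full A Z)].
    exists (X * N)%type, Z1; split=> //.
      apply: module_iso_trans iX; apply: module_iso_trans (prod_isoA _ _ _) _.
      exact: prod_iso (module_iso_refl X) i1.
    by apply: torsion_free_prod => //; apply: (torsion_free_sub (can_inj ip)).
  by rewrite ltnn.
have [k [P1 [Q1 [P2 [Q2 sum12]]]]] := in_add_split iX hW.
have [v [vs sv]] := @no_common_invertible A W Z k P2 Q2 (mklin (sum_linear P1 Q1)) fW nc sum12.
apply/in_addP; exists k.
have linq : linear (fun x => [ffun l => Q1 l x] : {ffun 'I_k -> X}).
  by move=> c x y; apply/ffunP => l; rewrite !ffunE linearP.
have linp : linear (fun z : {ffun 'I_k -> X} => \sum_l P1 l (z l)).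
  move=> c x y; rewrite scaler_sumr -big_split; apply: eq_bigr => j _.
  by rewrite !ffunE linearP.
exists (mklin linq), (v \o mklin linp) => x /=.
rewrite -[RHS]vs; congr (v _); apply: eq_bigr => l _; by rewrite ffunE.
Qed.

Lemma descend : exists T', tilting_pair T T'.
Proof.
have [T' [rT tT hT]] := torsion_free_summand; exists T'.
have [pT iT _] := sT.
have pT' : pfin T' := pfin_retract rT pT.
have iT' : ext_injective T' by move=> M pM; apply: ext1_retractr rT (iT M pM).
have emb M : pfin M -> torsion_free e M ->
    exists k (f : {linear M -> {ffun 'I_k -> T'}}), injective f.
  move=> pM tM; have [X [C [f [g [h hX pC]]]]] := stilt_embed noe sT pM.
  have [inf sg ex] := h; have pX := pfin_in_add hX pT.
  have htor : submodP (fun x : X => forall a, (e * a) *: x = 0).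
    split=> [a|c x y hx hy a]; first by rewrite scaler0.
    by rewrite scalerDr scalerA -mulrA hx hy addr0.
  have [K [j [inj_j jE]]] := ker_exists htor.
  have [W [q hq]] := coker_ses inj_j; have [_ sq exq] := hq.
  have pK : pfin K.
    apply: C1; first exact: noe inj_j pX.1.
    move=> x; apply: inj_j; rewrite linear0 linearZ /= -[e]mulr1.
    have /jE : exists y, j y = j x by exists x.
    exact.
  have pW := pfin_right hq pK pX.
  have infq : injective (q \o f).
    apply: linear_inj => x /= /exq/jE hx; apply: tM => a; apply: inf.
    by rewrite linear0 linearZ /= hx.
  have [C' [g' h']] := coker_ses infq; have pC' := pfin_right h' pM pW.
  have iX := ext_injective_in_add iT hX.
  have [g0 g0E] := iX _ pC' _ _ _ _ h' f.
  (* [u] fixes the copy of [M] in [X] and kills the torsion part of [X]. The image of its Fitting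
     idempotent is therefore a torsion-free summand of [X] that contains [M]. *)
  pose u := endring_of (g0 \o q).
  have uf x : endring_fun u (f x) = f x by rewrite endring_ofE /= g0E.
  have ufn n x : endring_fun (u ^+ n) (f x) = f x.
    by elim: n => [|n IH]; rewrite ?expr0 // exprS endring_mulE IH uf.
  have fX : finlen X := fg_finlen hA pX.1.
  have [n [w [wE wc]]] := fitting fX u.
  have idem := spr_idem wE wc.
  have [|N [i [p [pi ip]]]] := @idem_retract A X (endring_fun (u ^+ n.+1 * w)).
    by move=> x; rewrite -endring_mulE idem.
  have tN : torsion_free e N.
    move=> x hx; have ux : endring_fun u (i x) = 0.
      rewrite endring_ofE /=; have -> : q (i x) = 0; last by rewrite linear0.
      by apply/exq/jE => a; rewrite -linearZ hx linear0.
    rewrite -(pi x) -(pi x) ip wc exprSr mulrA !endring_mulE ux.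
    by rewrite !linear0.
  have hN : in_add T' N.
    have rN : retract N X by exists i, p.
    apply: hT => //; first by apply: (finlen_sub (can_inj pi)).
    exact: in_add_retract rN hX.
  have pf : injective (p \o f).
    move=> x y /= /(congr1 i); rewrite !ip => exy; apply: inf.
    have key z : endring_fun (u ^+ n.+1 * w) (f z) = f z.
      rewrite -{1}(ufn n.+1 z) -endring_mulE wE; exact: ufn.
    by rewrite -key exy key.
  have /in_addP[k [a [b ba]]] := hN; exists k, (a \o p \o f) => x y /= /(can_inj ba).
  exact: pf.
split=> //; split=> //.
have pFT : pfin (F T') := F_pfin hA C2 pT'.
have iFT : ext_injective (F T').
  (* [N] is F M with [M] torsion-free and in [pfin]. A map from F K to F T' comes from a map
     [K -> T'], which extends to [P]. *)
  move=> N pN; have [K [P [M [i [u [h pFP fP tM iso]]]]]] := F_dense hc pN.1.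
  have [inj_i su _] := h; have fM := fg_surj su fP.
  have pM : pfin M by apply: (pfin_F (hc := hc) hA C1 fM); apply: pfin_iso iso pN.
  have [g' h'] := ses_isor (F_ses hc h) iso.
  apply: (ext1_cover h' pFP) => phi.
  have [f fE] := F_full C1 tT iT' phi (noe inj_i fP).
  have [f' f'E] := iT' _ pM _ _ _ _ h f.
  by exists (Fmap hc f') => x; apply: fval_inj; rewrite FmapE FmapE f'E fE.
have [T0 [hT0 sT0]] : exists T0 : lmodType B, in_add (F T') T0 /\ stilt T0.
  apply: (stilt_of_embed noeB).
  - by move=> X hX; split; [apply: pfin_in_add hX pFT | apply: ext_injective_in_add hX].
  - by move=> X Y; apply: in_add_retract.
  - by move=> X Y; apply: in_add_prod.
  - move=> N pN; have [K [P [M [i [u [h pFP fP tM iso]]]]]] := F_dense hc pN.1.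
    have [_ su _] := h; have fM := fg_surj su fP.
    have pM : pfin M by apply: (pfin_F (hc := hc) hA C1 fM); apply: pfin_iso iso pN.
    have [k [f inf]] := emb M pM tM.
    have [a [b [ab ba]]] := module_iso_inv iso.
    exists (F {ffun 'I_k -> T'}), (Fmap hc f \o b); split.
      apply: (in_add_iso (F_ffun hc k T')); apply: in_add_ffun; exact: in_add_refl.
    move=> x y /= xy; apply: (can_inj ba); apply: fval_inj; apply: inf.
    by rewrite -!FmapE xy.
  (* Finitistic dimension of [B]: [d] bounds that of [A], and F adds at most the dimension [p] of e
     A. *)
  have [d hd] := stilt_findim noe sT; have [p hp] := C2.
  exists (d + p)%N => N pN; have [K [P [M [i [u [h pFP fP tM iso]]]]]] := F_dense hc pN.1.
  have [_ su _] := h; have fM := fg_surj su fP.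
  have pM : pfin M by apply: (pfin_F (hc := hc) hA C1 fM); apply: pfin_iso iso pN.
  by apply: pdle_iso iso _; apply: F_pdle => //; apply: hd.
split=> //; have [_ _ [s hs]] := sT0; exists s; apply: cores_sub hs => X.
exact: in_add_trans.
Qed.

End Descend.

Lemma basicm_F T' : ext_injective T' -> torsion_free e T' -> pfin T' -> basicm T' -> basicm (F T').
Proof.
move=> iT tT pT /basicm_nmu h; apply/basicm_nmu => a b e1 e2 e3 e4.
have lift (x : endring (F T')) : exists y : endring T', forall z, fval (endring_fun x z) = endring_fun y (fval z).
  have [f fE] := F_full C1 tT iT (endring_fun x) pT.1.
  by exists (endring_of f).
have [a' aE] := lift a; have [b' bE] := lift b.
have faithful (f g : endring T') : (forall x : F T', endring_fun f (fval x) = endring_fun g (fval x)) -> f = g.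
  move=> fg; apply: endringP; apply: (F_faithful hc tT) => x ex.
  have [y <-] := fval_ex hc ex; exact: fg.
have a0 : a' = 0.
  apply: (h _ b'); apply: faithful => x; rewrite !endring_mulE -?aE -?bE -?aE -?bE -!endring_mulE ?e1 ?e2 ?e3 ?e4 //;
    by rewrite -?aE -?bE.
by apply: endringP => x; apply: fval_inj; rewrite aE a0.
Qed.

Lemma ascend (TB : lmodType B) : stilt TB -> basicm TB ->
  exists T T', tilting_pair T T' /\ module_iso TB (F T').
Proof.
move=> sB bB; have [pB iB _] := sB.
have [T1 [_ sT1]] : exists T, (pfin T /\ ext_injective T) /\ stilt T.
  apply: (stilt_of_embed noe) => //.
  - move=> X Y r [pY iY]; split; first exact: pfin_retract r pY.
    by move=> M pM; apply: ext1_retractr r (iY M pM).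
  - move=> X Y [pX iX] [pY iY]; split; first exact: pfin_prod.
    by move=> M pM; apply: ext1_prodr; [apply: iX | apply: iY].
  (* The lift of F E needed to coinduce from is its approximation over [B], which exists because
     [TB] is strong tilting. *)
  - move=> N pN; have [E [f [fE inf iE]]] := enough_inj_artin hA pN.1.
    have [Y [X [j [q [hq pX _ iY]]]]] := approximation noeB (hom_fin_artin hB) (enough_inj_artin hB)
      sB (fg_F hc hA fE).
    have [V [pV iV _ hV _]] := coinduced hA C1 C2 fE iE hq pX iY.
    by have [g ing] := hV N f pN inf; exists V, g.
  have [d hd] := stilt_findim noeB sB; have [c hF] := F_back hc hA C1.
  exists (d + c)%N => M pM; apply: hF; first by case: pM.
  by apply: hd; apply: F_pfin.
have [T [sT bT]] := stilt_basic (fg_finlen hA (let: And3 h _ _ := sT1 in h).1) sT1.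
(* The case [E = 0]: here [V] is the module coinduced from [TB]. *)
have hq : ses (idfun : {linear TB -> TB}) (zero_map TB (F (zero_mod A))).
  split=> // [y|y]; first by exists 0; rewrite (F_zero (zero_modP (A := A)) y).
  by split=> // _; exists y.
have [T' [pT' iT' iso _ tT']] := coinduced hA C1 C2 (fg_zero (@zero_modP A))
  (fun M _ => ext1_zero (@zero_modP A)) hq pB iB.
have {}tT' : torsion_free e T' by apply: tT' => x _; apply: zero_modP.
have [fT' _] := pT'; have flT' : finlen T' := fg_finlen hA fT'.
have bT' : basicm T'.
  move=> N rN; have rF := retract_trans (F_retract hc rN) (module_iso_retract iso).
  have FN0 : zero_module (F N).
    by apply: bB; apply: retract_trans rF; apply: module_iso_retract; apply: module_isoC; apply: F_prod.
  have [i [p ip]] := retract_trans (retract_l N N) rN.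
  have tN := torsion_free_sub (can_inj ip) tT'.
  move=> x; apply: tN => a; have [y yE] := fval_e hc (a *: x).
  by rewrite -scalerA -yE (FN0 y) fval0.
(* An embedding of [T'] into add(T) with cokernel in [pfin] splits. Since [T'] is basic,
   [basic_retract] then makes it a summand of [T] itself. *)
have hT' : in_add T T'.
  have [X [C [f [g [h hX pC]]]]] := stilt_embed noe sT pT'.
  apply: in_add_retract hX; apply: retract_trans (retract_l T' C) _.
  exact/module_iso_retract/(ext1_split (iT' _ pC) h).
exists T, T'; split; last exact: module_isoC.
split; first split=> //.
- exact: basic_retract.
- exact: stilt_iso (module_isoC iso) sB.
(* The components of an embedding of F M into a power of F T' lift to maps [M -> T']; an element in
   their common kernel generates a submodule killed by [e]. *)
move=> M pM tM; have pFM := F_pfin hA C2 pM.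
have [X [C [f [g [[inf _ _] /in_addP[k [a [b ba]]] _]]]]] := stilt_embed noeB sB pFM.
have [u [v [uv vu]]] := module_iso_inv iso.
have [w wE] := ffun_eval (a \o f).
have /choice[l lE] i : exists l : {linear M -> T'}, forall x, fval (v (w i x)) = l (fval x).
  by have [l lE] := F_full C1 tT' iT' (v \o w i) pM.1; exists l.
have lin : linear (fun x => [ffun i => l i x] : {ffun 'I_k -> T'}).
  by move=> c x y; apply/ffunP => i; rewrite !ffunE linearP.
exists k, (mklin lin); apply: linear_inj => x /= /ffunP x0.
apply: tM => r; have [y yE] := fval_e hc (r *: x); rewrite -scalerA -yE.
have -> : y = 0; last by [].
apply: inf; apply: (can_inj ba); rewrite !linear0; apply/ffunP => i.
have := wE y i; rewrite /= => ->; rewrite ffunE.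
have v0 : v (w i y) = v 0.
  apply: fval_inj; rewrite lE yE scalerA linearZ /=; have := x0 i; rewrite !ffunE => ->.
  by rewrite scaler0 linear0.
by rewrite -[LHS]vu v0 vu.
Qed.

End Transfer.

(** * Iteration *)

Section Converse.
Implicit Types A R : pzRingType.

(** An equality rather than an isomorphism, so that sequences of rings can be rewritten; the two
    structures differ only in proofs. *)
Lemma converseK R : ((R^c)^c : pzRingType) = R.
Proof.
case: R => R [m1 m2 m3 m4 m5 m6 m7 m8 m9 m].
pose pack m : pzRingType := GRing.PzRing.Pack (@GRing.PzRing.Class R m1 m2 m3 m4 m5 m6 m7 m8 m9 m).
set Rc := ((pack m)^c)^c : pzRingType.
have -> : Rc = pack (GRing.PzRing.GRing_Nmodule_isPzSemiRing_mixin (GRing.PzRing.class Rc)) by [].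
congr (pack _); rewrite {}/Rc; move: m => [a b c d f g h i j].
by congr GRing.Nmodule_isPzSemiRing.Axioms_; apply: Prop_irrelevance.
Qed.

Lemma converse_morphism A R (f : {rmorphism A -> R}) :
  exists g : {rmorphism A^c -> R^c}, forall x : A, g x = f x.
Proof.
have gadd : {morph (f : A^c -> R^c) : x y / x - y} by exact: (rmorphB f).
have gmul : monoid_morphism (f : A^c -> R^c).
  by split=> [|x y]; [exact: (rmorph1 f) | exact: (rmorphM f y x)].
pose G : {rmorphism A^c -> R^c} := HB.pack (f : A^c -> R^c)
  (GRing.isZmodMorphism.Build _ _ _ gadd) (GRing.isMonoidMorphism.Build _ _ _ gmul).
by exists G.
Qed.

Lemma artin_converse A : artin_algebra A -> artin_algebra A^c.
Proof.
move=> [R [f [hR cf [n [v hv]]]]].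
have gadd : {morph (f : R -> A^c) : x y / x - y} by exact: (rmorphB f).
have gmul : monoid_morphism (f : R -> A^c).
  split=> [|x y]; first exact: (rmorph1 f).
  by rewrite mulrC; exact: (rmorphM f y x).
pose G : {rmorphism R -> A^c} := HB.pack (f : R -> A^c)
  (GRing.isZmodMorphism.Build _ _ _ gadd) (GRing.isMonoidMorphism.Build _ _ _ gmul).
exists R, G; split=> //; first by move=> r a; apply/esym/cf.
exists n, v => a; have [c cE] := hv a; exists c; rewrite [LHS]cE.
by apply: eq_bigr => i _; apply: cf.
Qed.

Lemma nmu_converse A : no_matrix_units A -> no_matrix_units A^c.
Proof.
move=> h a b e1 e2 e3 e4; apply: (h _ b) => //.
  by rewrite -mulrA; apply: e1.
by rewrite -mulrA; apply: e2.
Qed.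

Lemma artin_basicP A : artin_algebra A -> basic_ring A <-> no_matrix_units A.
Proof. by move=> hA; split; [apply: basic_nmu | apply/nmu_basic/artin_finlen]. Qed.

Lemma basic_converse A : artin_algebra A -> basic_ring A -> basic_ring A^c.
Proof.
move=> hA /(artin_basicP hA)/nmu_converse h.
exact/(artin_basicP (artin_converse hA)).
Qed.

Lemma ring_iso_converse A R : ring_iso A R -> ring_iso A^c R^c.
Proof.
move=> [f [g fK gK]]; have [h hE] := converse_morphism f.
by exists h; exists g => x; rewrite hE; [apply: fK | apply: gK].
Qed.

Lemma ring_iso_trans A R (S : pzRingType) : ring_iso A R -> ring_iso R S -> ring_iso A S.
Proof.
move=> [f bf] [g bg]; exists (g \o f : {rmorphism A -> S}).
exact: bij_comp.
Qed.

End Converse.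

Definition tilts (D D' : pzRingType) : Prop :=
  exists T : lmodType D, [/\ basic_module T, strong_tilting T & ring_iso D' (endring T)].

(** The invariant carried from stage to stage: [DB] is a corner of [D] up to isomorphism and both
    homological hypotheses hold, the first stated for all finitely generated modules killed by
    [e]. *)
Definition reduction (D DB : pzRingType) : Prop :=
  artin_algebra D /\ exists (e : D) (theta : DB -> D) (hc : is_corner e theta),
    (forall M : lmodType D, finitely_generated M -> killed e M -> pfin M) /\
    exists p, pdle p (Fm hc D^o).

Lemma basicm_moduleP (A : pzRingType) (T : lmodType A) : finlen T -> basic_module T <-> basicm T.
Proof. by move=> fT; rewrite basic_moduleP // basicm_nmu. Qed.

Lemma artin_strong_tiltingP (A : pzRingType) (T : lmodType A) : artin_algebra A ->
  basic_module T /\ strong_tilting T <-> basicm T /\ stilt T.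
Proof.
move=> hA; have noe := artin_noetherian hA; split=> [[bT /(strong_tiltingP _ noe) sT]|[bT sT]].
  have [[fT _] _ _] := sT; by split=> //; apply/(basicm_moduleP (fg_finlen hA fT)).
have [[fT _] _ _] := sT; split; first exact/(basicm_moduleP (fg_finlen hA fT)).
exact/strong_tiltingP.
Qed.

Lemma tilting_next (A B : pzRingType) (e : A) (theta : B -> A) (hc : is_corner e theta)
    (T T' : lmodType A) (D DB : pzRingType) : artin_algebra A ->
  (forall M : lmodType A, finitely_generated M -> killed e M -> pfin M) ->
  (exists p, pdle p (Fm hc A^o)) -> tilting_pair hc T T' ->
  ring_iso D (endring T) -> ring_iso DB (endring (Fm hc T')) -> artin_algebra D -> reduction D DB.
Proof.
move=> hA C1 C2 [[sT bT [i [p pi]] tT sF] emb] [rho rho_bij] [rhoB rhoB_bij] hD; split=> //.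
exact: (next_stage hA C1 C2 pi sT tT emb sF rho_bij rhoB_bij hD).
Qed.

Lemma ring_iso_refl (A : pzRingType) : ring_iso A A.
Proof. by exists (idfun : {rmorphism A -> A}); exists idfun. Qed.

Lemma endring_basic (A : pzRingType) (T : lmodType A) : artin_algebra A -> basicm T -> stilt T ->
  artin_algebra (endring T) /\ basic_ring (endring T).
Proof.
move=> hA bT [[fT _] _ _]; have hE := endring_artin hA fT; split=> //.
by apply/(artin_basicP hE)/basicm_nmu.
Qed.

Lemma step_down (D DB D' : pzRingType) : reduction D DB -> tilts D D' -> artin_algebra D' ->
  exists DB', [/\ tilts DB DB', reduction D' DB', artin_algebra DB' & basic_ring DB'].
Proof.
move=> [hD [e [theta [hc [C1 C2]]]]] [T [bT sT rho]] hD'.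
have [{}bT {}sT] : basicm T /\ stilt T by apply/(artin_strong_tiltingP _ hD).
have [T' pT'] := descend hD C1 C2 sT bT.
have hB := artin_corner hc hD.
have [[_ _ rT tT sF] _] := pT'.
have bF : basicm (Fm hc T').
  have [pT iT _] := sT; apply: (basicm_F C1 _ tT).
  - by move=> M pM; apply: ext1_retractr rT (iT M pM).
  - exact: pfin_retract rT pT.
  by move=> N rN; apply: bT; apply: retract_trans rN rT.
have [hE bE] := endring_basic hB bF sF.
exists (endring (Fm hc T')); split=> //.
  exists (Fm hc T'); have [|b s] := (artin_strong_tiltingP (Fm hc T') hB).2; first by [].
  by split=> //; apply: ring_iso_refl.
exact: (tilting_next hD C1 C2 pT' rho (ring_iso_refl _) hD').
Qed.

Lemma step_up (D DB DB' : pzRingType) : reduction D DB -> tilts DB DB' ->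
  exists D', [/\ tilts D D', reduction D' DB', artin_algebra D' & basic_ring D'].
Proof.
move=> [hD [e [theta [hc [C1 C2]]]]] [TB [bT sT rho]].
have hB := artin_corner hc hD.
have [{}bT {}sT] : basicm TB /\ stilt TB by apply/(artin_strong_tiltingP _ hB).
have [T [T' [pT' iso]]] := ascend hD C1 C2 sT bT.
have [[sT0 bT0 _ _ _] _] := pT'.
have [hE bE] := endring_basic hD bT0 sT0.
exists (endring T); split=> //.
  exists T; have [|b s] := (artin_strong_tiltingP T hD).2; first by [].
  by split=> //; apply: ring_iso_refl.
apply: (tilting_next hD C1 C2 pT' (ring_iso_refl _) _ hE).
exact: ring_iso_trans rho (endring_iso iso).
Qed.

Definition twist (i : nat) (A : pzRingType) : pzRingType := if odd i then (A^c : pzRingType) else A.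

(* Replacing every second ring by its converse turns left and right tilting steps alike into [tilts]. *)
Lemma unlimitedP (A : pzRingType) : unlimited_strong_tilting A <->
  exists D : nat -> pzRingType, [/\ D 0 = A, forall i, artin_algebra (D i) /\ basic_ring (D i) &
    forall i, tilts (D i) (D i.+1)].
Proof.
have tw i (E : pzRingType) : artin_algebra E /\ basic_ring E ->
    artin_algebra (twist i E) /\ basic_ring (twist i E).
  rewrite /twist; case: (odd i) => // -[hE bE].
  by split; [apply: artin_converse | apply: basic_converse].
split=> [[A_ [A0 hA st]]|[D [D0 hD st]]].
  exists (fun i => twist i (A_ i)); split=> [//|i|i]; first exact: tw.
  have := st i; rewrite /twist /=; case: (odd i) => /= -[T [bT sT r]]; exists T; split=> //.
  by have := ring_iso_converse r; rewrite converseK.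
exists (fun i => twist i (D i)); split=> [//|i|i]; first exact: tw.
have [T [bT sT r]] := st i; rewrite /twist /=; case: (odd i) => /=.
  by rewrite /left_results_from_right converseK; exists T.
by exists T; split=> //; apply: ring_iso_converse.
Qed.

(** Dependent choice along [x]; a state stores its index together with the chosen element, since the
    relation to be maintained varies with the index. *)
Lemma follow_sequence (X Y : Type) (R : X -> Y -> Prop) (S : Y -> Y -> Prop) (x : nat -> X) (y0 : Y) :
  R (x 0) y0 -> (forall i y, R (x i) y -> exists y', R (x i.+1) y' /\ S y y') ->
  exists y : nat -> Y, [/\ y 0 = y0, forall i, R (x i) (y i) & forall i, S (y i) (y i.+1)].
Proof.
move=> R0 next.
have /choice[f fP] (p : {i & {y | R (x i) y}}) : exists y', R (x (tag p).+1) y' /\ S (sval (tagged p)) y'.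
  by case: p => i [y Ry]; apply: next.
pose step (p : {i & {y | R (x i) y}}) : {i & {y | R (x i) y}} :=
  existT _ (tag p).+1 (exist _ (f p) (proj1 (fP p))).
pose s n := iter n step (existT _ 0 (exist _ y0 R0)).
have ts n : tag (s n) = n by elim: n => //= n ->.
exists (fun n => sval (tagged (s n))); split=> // n; last exact: (proj2 (fP (s n))).
by rewrite -{1}(ts n); apply: svalP.
Qed.

Lemma unlimited_reduction (D DB : pzRingType) : artin_algebra D -> basic_ring D ->
  artin_algebra DB -> basic_ring DB -> reduction D DB ->
  unlimited_strong_tilting D <-> unlimited_strong_tilting DB.
Proof.
move=> hD bD hDB bDB red; split=> /unlimitedP[E [E0 hE st]]; apply/unlimitedP.
  have [||E' [E'0 h s]] := @follow_sequence _ _ (fun X Y => reduction X Y /\ artin_algebra Y /\ basic_ring Y)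
      tilts E DB; [by rewrite E0| |by exists E'; split=> // i; have [] := h i].
  move=> i Y [rY _]; have [Y' [tY rY' hY bY]] := step_down rY (st i) (hE _).1.
  by exists Y'.
have [||E' [E'0 h s]] := @follow_sequence _ _ (fun X Y => reduction Y X /\ artin_algebra Y /\ basic_ring Y)
    tilts E D; [by rewrite E0| |by exists E'; split=> // i; have [] := h i].
move=> i Y [rY _]; have [Y' [tY rY' hY bY]] := step_up rY (st i).
by exists Y'.
Qed.

(** * The hypotheses at the first stage *)

Lemma jacobson_simple (A : pzRingType) (S : lmodType A) (j : A) (x : S) : simple S -> jacobson j -> j *: x = 0.
Proof.
move=> [_ hS] Jj; apply: contrapT => nx; have [a xE] := hS _ x nx.
have [_ _ JM] := jacobson_left_ideal A; have [v vE] := jacobson_left_inv (JM a _ Jj).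
apply: nx; suff -> : x = 0 by rewrite scaler0.
by rewrite -[x]scale1r -vE -scalerA scalerBl scale1r -scalerA -xE subrr scaler0.
Qed.

(** [1 - e] fixes [S], and [S] is generated by [a i *: s] for an [a i] that lifts the unit of one
    division ring. Sending [b *: (a i *: s)] to the class of [b * a i * (1 - e)] is a section of the
    map from the top module to [S] given by action on [s]. *)
Lemma killed_simple_retract (A : pzRingType) (e : A) (S : lmodType A) : basic_ring A -> simple S ->
  killed e S -> retract S (top_module (1 - e)).
Proof.
move=> [n [D [f [hD sf hJ]]]] sS kS; have [/existsNP[s ns] hS] := sS.
have es (x : S) : (1 - e) *: x = x by rewrite scalerBl scale1r kS subr0.
have /choice[a aE] i : exists a, forall k, f k a = (k == i)%:R.
  exact: (sf (fun k => (k == i)%:R)).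
(* [1 - \sum_i a i] lies in the radical, which kills [S], so not all [a i] can kill [s]. *)
have [i nas] : exists i, a i *: s <> 0.
  apply: contrapT => no; apply: ns.
  suff : (1 - \sum_i a i) *: s = 0.
    rewrite scalerBl scale1r scaler_suml big1 ?subr0 // => i _.
    by apply: contrapT => h; apply: no; exists i.
  apply: jacobson_simple sS _; apply/hJ => k; rewrite rmorphB rmorph1 rmorph_sum.
  by rewrite (bigD1 k) //= aE eqxx big1 ?addr0 ?subrr // => l lk; rewrite aE eq_sym (negbTE lk).
have lp : linear (@quot_pi _ _ _ (radical_closed (1 - e)) : principal (1 - e) -> top_module (1 - e)).
  by move=> c x y; rewrite quot_piD -quot_piZ.
pose pi : {linear principal (1 - e) -> top_module (1 - e)} := mklin lp.
have pi0 w : pi w = 0 <-> exists2 j : A, jacobson j & val w = j * (1 - e).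
  have -> : (0 : top_module (1 - e)) = pi 0 by rewrite linear0.
  by rewrite /= quot_pi_eq subr0; split=> [/asboolP|h]; last exact/asboolP.
have spi : surj pi by move=> q; have [y ->] := quot_piP q; exists y.
have elt c : exists w : principal (1 - e), val w = c * (1 - e).
  have h : c * (1 - e) \in principal_pred (1 - e) by apply/asboolP; exists c.
  by exists (Principal h).
have lr : linear (fun w : principal (1 - e) => (val w : A) *: s).
  by move=> c x y; rewrite /= scalerDl -scalerA.
have [|r rE] := @factor_surj _ _ _ _ pi (mklin lr) spi.
  by move=> w /pi0[j Jj /= ->]; rewrite -scalerA es; apply: jacobson_simple.
have [|||t tE] := @linear_graph A S (top_module (1 - e)) (fun z q => exists b w,
    [/\ z = b *: (a i *: s), val w = b * a i * (1 - e) & q = pi w]).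
- move=> z; have [b ->] := hS _ z nas; have [w wE] := elt (b * a i).
  by exists (pi w), b, w.
- move=> z q q' [b [w [zE wE ->]]] [b' [w' [zE' wE' ->]]].
  apply/subr0_eq; rewrite -linearB; apply/pi0; exists ((b - b') * a i); last first.
    by rewrite /= wE wE' -mulrBl -mulrBl.
  have bz : (b - b') *: (a i *: s) = 0 by rewrite scalerBl -zE -zE' subrr.
  have fb : f i (b - b') = 0.
    apply: contrapT => nb; have [_ hinv] := hD i; have [y [_ yb]] := hinv _ nb.
    (* [d] lifts the family with [y] at the index [i] and 0 elsewhere. The cast only moves [y] along
       [k = i] and is removed by [eq_axiomK]. *)
    have [d dE] := sf (fun k => if k =P i is ReflectT ki then ecast k (D k) (esym ki) y else 0).
    have di : f i d = y by rewrite dE; case: eqP => // ki; rewrite eq_axiomK.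
    apply: nas; apply/esym/subr0_eq; rewrite sub0r -[X in - X]scale1r -scaleNr.
    have : (d * (b - b') * a i - a i) *: s = 0.
      apply: jacobson_simple sS _; apply/hJ => k; rewrite rmorphB !rmorphM aE.
      have [ki|ki] := eqVneq k i; last by rewrite mulr0 subrr.
      by subst k; rewrite di yb !mulr1 subrr.
    rewrite scalerBl -!scalerA bz scaler0 sub0r => h.
    by rewrite scaleNr scale1r.
  apply/hJ => k; rewrite rmorphM aE; have [ki|] := eqVneq k i; last by rewrite mulr0.
  by subst k; rewrite fb mul0r.
- move=> c z z' q q' [b [w [-> wE ->]]] [b' [w' [-> wE' ->]]].
  exists (c * b + b'), (c *: w + w'); split.
  + by rewrite scalerDl scalerA.
  + by rewrite /= wE wE' -!mulrA -[c *: _]/(c * _) !mulrDl !mulrA.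
  + by rewrite linearP.
exists t, r => z; have [b [w [zE wE ->]]] := tE z.
by rewrite rE /= wE -scalerA es zE scalerA.
Qed.

Section InitialReduction.
Variables (L : pzRingType) (e : L) (he : e * e = e).

Lemma corner_is_corner : is_corner e (val : corner he -> L).
Proof.
split=> //; first exact: val_inj.
move=> a; have h : e * a * e \in peirce_pred e e by apply/asboolP; exists a.
by exists (Peirce h).
Qed.
Let hc := corner_is_corner.

(** The Peirce decomposition of e L: right multiplication by [e] has kernel e L (1 - e) and image e
    L e. It turns the bound for e L (1 - e) into one for e L. *)
Lemma corner_regular_ses : exists (u : {linear corner_module he (1 - e) -> Fm hc L^o})
  (v : {linear Fm hc L^o -> (corner he)^o}), ses u v.
Proof.
have [|||u uE] := @linear_graph (corner he) (corner_module he (1 - e)) (Fm hc L^o)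
    (fun x y => fval y = val x).
- by move=> x; apply: fval_ex; exact: (peirce_unitl he x).
- by move=> x y y' h1 h2; apply: fval_inj; rewrite h1 h2.
- by move=> b x x' y y' h1 h2; rewrite fval_lin h1 h2.
have [|||v vE] := @linear_graph (corner he) (Fm hc L^o) (corner he)^o
    (fun x (y : corner he) => val y = (fval x : L) * e).
- move=> x; have h : (fval x : L) * e \in peirce_pred e e.
    by apply/asboolP; exists (fval x : L); rewrite -[e * _]/(e *: fval x) fvalP.
  by exists (Peirce h).
- by move=> x y y' h1 h2; apply: val_inj; rewrite h1 h2.
- by move=> b x x' y y' h1 h2; rewrite fval_lin mulrDl -mulrA -h1 -h2.
exists u, v; split.
- by move=> x y xy; apply: val_inj; rewrite -!uE xy.
- move=> y; have [|x xE] := @fval_ex _ _ _ _ hc L^o (val (y : corner he)); first exact: (peirce_unitl he y).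
  by exists x; apply: val_inj; rewrite vE xE; exact: (peirce_unitr he y).
move=> y; split=> [vy|[x <-]].
  have ye : (fval y : L) * e = 0 by rewrite -vE vy.
  have h : (fval y : L) \in peirce_pred e (1 - e).
    apply/asboolP; exists (fval y : L); rewrite -[e * _]/(e *: fval y) fvalP.
    by rewrite mulrBr mulr1 ye subr0.
  by exists (Peirce h); apply: fval_inj; rewrite uE.
apply: val_inj; rewrite vE uE /=; case: x => x /= /asboolP[c ->].
by rewrite -mulrA mulrBl mul1r he subrr mulr0.
Qed.

Lemma initial_reduction : artin_algebra L -> basic_ring L ->
  finite_pdim (top_module (1 - e)) -> finite_pdim (corner_module he (1 - e)) ->
  reduction L (corner he).
Proof.
move=> hL bL /finite_pdimP[n hn] /finite_pdimP[p hp]; split=> //.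
exists e, val, hc; split; last first.
  have [u [v h]] := corner_regular_ses; exists p; apply: (pdle_mid h hp).
  exact/pdle_proj/(projective_of_iso (ffun1_iso _))/projective_free.
move=> M fM; apply: killed_pfin (fg_finlen hL fM) => S sS kS; split; first exact: simple_fg.
by exists n; apply: pdle_ret (killed_simple_retract bL sS kS) hn.
Qed.

End InitialReduction.

Theorem corollary5p6 (L : pzRingType) (e : L) (he : e * e = e) :
  artin_algebra L -> basic_ring L ->
  finite_pdim (top_module (1 - e)) ->
  finite_pdim (corner_module he (1 - e)) ->
  unlimited_strong_tilting L <-> unlimited_strong_tilting (corner he).
Proof.
move=> hL bL h1 h2; have hc := corner_is_corner he.
have hB := artin_corner hc hL.
apply: unlimited_reduction => //; last exact: initial_reduction.
by apply/(artin_basicP hB)/(nmu_corner hc)/(artin_basicP hL).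
Qed.
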